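(* If $G$ is a $5/2$-critical graph that is not (isomorphic to) the triangle $C_3$, then $p(G)\le 2$, where $p(G)=5n(G)-4e(G)$.
   Context: All graphs are finite and simple. A homomorphism from $G$ to $H$ is a function $f:V(G)\to V(H)$ such that $f(u)f(v)\in E(H)$ for every $uv\in E(G)$. $C_k$ denotes the cycle with $k$ vertices. A graph $G$ is $5/2$-critical if $G$ has no homomorphism to $C_5$ (equivalently, no circular $5/2$-coloring), but every proper subgraph of $G$ has one. $n(G)$ and $e(G)$ denote the numbers of vertices and edges of $G$, and the potential of $G$ is $p(G)=5n(G)-4e(G)$. *)

(* Defs.v *)
From mathcomp Require Import all_boot all_order all_algebra.

Set Implicit Arguments.
Unset Strict Implicit.
Unset Printing Implicit Defensive.

Import GRing.Theory Num.Theory.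

Local Open Scope ring_scope.

Record sgraph := SGraph {
  vertex :> finType;
  adj : rel vertex;
  adj_sym : symmetric adj;
  adj_irrefl : irreflexive adj
}.

Definition edges (G : sgraph) : {set {set G}} :=
  [set A : {set G} | [exists u : G, exists v : G,
                        adj u v && (A == [set u; v])]].

Definition is_hom (G H : sgraph) (f : G -> H) : Prop :=
  forall u v : G, adj u v -> adj (f u) (f v).

Definition hom_to (G H : sgraph) : Prop := exists f : G -> H, is_hom f.

Definition isomorphic (G H : sgraph) : Prop :=
  exists2 f : G -> H, bijective f & forall u v : G, adj (f u) (f v) = adj u v.

(* The guard [i != j] only matters for [k = 1], where the successor modulo [k]
   would give a loop; [k >= 3] yields the usual cycle. *)
Definition cycle_adj (k : nat) : rel 'I_k :=
  fun i j => (i != j) && ((j == ordS i) || (i == ordS j)).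

Lemma cycle_adj_sym k : symmetric (@cycle_adj k).
Proof. by move=> i j; rewrite /cycle_adj eq_sym orbC. Qed.

Lemma cycle_adj_irrefl k : irreflexive (@cycle_adj k).
Proof. by move=> i; rewrite /cycle_adj eqxx. Qed.

Definition cycle_graph (k : nat) : sgraph :=
  SGraph (@cycle_adj_sym k) (@cycle_adj_irrefl k).

(* A subgraph is a set of vertices together with a set of edges of [G], not
   necessarily induced, whose ends all lie in that set of vertices. *)
Record subgraph (G : sgraph) := Subgraph {
  sub_verts : {set G};
  sub_adj : rel G;
  sub_adj_sym : symmetric sub_adj;
  sub_adj_adj : forall u v, sub_adj u v -> adj u v;
  sub_adj_verts : forall u v, sub_adj u v -> (u \in sub_verts) && (v \in sub_verts)
}.

Definition graph_of_sub_adj (G : sgraph) (H : subgraph G) :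
    rel {x : G | x \in sub_verts H} :=
  fun u v => sub_adj H (val u) (val v).

Lemma graph_of_sub_sym (G : sgraph) (H : subgraph G) :
  symmetric (@graph_of_sub_adj G H).
Proof. by move=> u v; apply: sub_adj_sym. Qed.

Lemma graph_of_sub_irrefl (G : sgraph) (H : subgraph G) :
  irreflexive (@graph_of_sub_adj G H).
Proof.
move=> u; apply/negbTE/negP => /sub_adj_adj.
by rewrite adj_irrefl.
Qed.

Definition graph_of_sub (G : sgraph) (H : subgraph G) : sgraph :=
  SGraph (@graph_of_sub_sym G H) (@graph_of_sub_irrefl G H).

Coercion graph_of_sub : subgraph >-> sgraph.

Definition proper_subgraph (G : sgraph) (H : subgraph G) : Prop :=
  ~ (sub_verts H = [set: G] /\ sub_adj H =2 @adj G).

Definition critical52 (G : sgraph) : Prop :=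
  ~ hom_to G (cycle_graph 5) /\
  forall H : subgraph G, proper_subgraph H -> hom_to H (cycle_graph 5).

Definition potential (G : sgraph) : int :=
  5 * (#|G|)%:Z - 4 * (#|edges G|)%:Z.

(* Main.v *)
Require Import Defs.
From mathcomp Require Import all_boot all_order all_algebra.
From mathcomp Require Import zify.
From Stdlib Require Import Classical.
Set Implicit Arguments.
Unset Strict Implicit.
Unset Printing Implicit Defensive.

(** Colours live in Z/5; after doubling, a homomorphism to [C_5] is a map [x] with
[x u - x v \in {2, 3}] on every edge. More generally every pair [u, v] carries a
set [C u v] of forbidden differences, of cost |C u v| + (number of cyclic runs of
C u v); an edge of the graph costs 4. The potential of [S] is
5 |S| - (sum of the costs of the pairs inside S), and the claim proved for all
instances is that a minimal uncolourable set has potential at most 2, or has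
potential at most 3 and at most as many runs as vertices. The triangle is the only
graph of the second kind.

In a minimal counterexample every proper set of at least two vertices has
potential at least 6: otherwise colour it, contract it to one vertex, and apply
induction. Consequently, removing a few vertices and forbidding some further
differences of total cost k yields by induction a set of potential at most 3 + k,
and putting removed vertices back brings the potential down to 5, a contradiction
as soon as every colouring of the modified instance extends. This excludes a list
of local configurations, after which discharging (each vertex [D] with three pairs
of cost 3 needs one unit) shows that the total potential is not positive. *)
(** * Subsets of Z/5 *)

(** Deleting a vertex and remembering which colourings extend leaves relations between its former
    neighbours that need not be edges; hence arbitrary sets of forbidden differences. The cost is
    fitted to three demands: an edge forbids the arc -1, 0, 1 and costs 4; merging two constraints
    on a pair costs at most their sum; an uncolourable pair satisfies the claim. An arc of three and
    the complementary arc of two cost 4 + 3, and 5 * 2 - 7 = 3, so the full set must cost exactly 7.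

    The obstacle is the triangle, of potential 3: reductions may stop one unit short because of it.
    Runs repair this. A merge that saves no cost keeps the runs apart, so the exceptional
    alternative survives only on sets with few runs. Two counts work against such sets: every vertex
    has at least three neighbours and every constrained pair at least one run, so a set with few
    pairs leaving it has many runs; and a pair costs at most four times its runs, so few runs leave
    at most three vertices. Where neither count is decisive, a second reduction of the same
    configuration gains the missing unit. *)

Ltac is_arith T := lazymatch T with
  | is_true (_ <= _) => idtac
  | is_true (~~ (?a == _)) => let T := type of a in unify T nat
  | @eq ?T _ _ => unify T nat
  | ?A /\ _ => is_arith A
  | ?A \/ _ => is_arith A
  | ?A -> _ => is_arith A
  | ~ ?A => is_arith A
  | nat => idtac
  | _ => fail
  end.
(* The preprocessing of [lia] is slow in the presence of irrelevant hypotheses. *)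
Ltac alia := intros; repeat match goal with
  | H : ?T |- _ => tryif is_arith T then fail else clear H end; lia.

(* Unlike [implb], this implication is lazy under call-by-value reduction. *)
Notation "a =>> b" := (if a then b else true) (at level 71, right associativity).

Inductive z5 := z0 | z1 | z2 | z3 | z4.

Definition suc5 a := match a with z0 => z1 | z1 => z2 | z2 => z3 | z3 => z4 | z4 => z0 end.

Definition add5 a b :=
  match b with
  | z0 => a | z1 => suc5 a | z2 => suc5 (suc5 a)
  | z3 => suc5 (suc5 (suc5 a)) | z4 => suc5 (suc5 (suc5 (suc5 a)))
  end.

Definition opp5 a := match a with z0 => z0 | z1 => z4 | z2 => z3 | z3 => z2 | z4 => z1 end.

Definition sub5 a b := add5 a (opp5 b).

Definition eq5 a b := if sub5 a b is z0 then true else false.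

Lemma eq5P a b : reflect (a = b) (eq5 a b).
Proof. by case: a; case: b; constructor. Qed.

Lemma sub5K a b : add5 (sub5 a b) b = a.
Proof. by case: a; case: b. Qed.
Lemma add5K a b : sub5 (add5 a b) b = a.
Proof. by case: a; case: b. Qed.
Lemma opp5B a b : opp5 (sub5 a b) = sub5 b a.
Proof. by case: a; case: b. Qed.
Lemma sub5BB a b c : sub5 (sub5 a c) (sub5 b c) = sub5 a b.
Proof. by case: a; case: b; case: c. Qed.
Lemma add5B a b c : add5 (sub5 a b) (sub5 b c) = sub5 a c.
Proof. by case: a; case: b; case: c. Qed.
Lemma sub5_add a b c : sub5 (sub5 a b) c = sub5 a (add5 c b).
Proof. by case: a; case: b; case: c. Qed.

Record s5 := S5 { b0 : bool; b1 : bool; b2 : bool; b3 : bool; b4 : bool }.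

Definition mem5 C d :=
  match d with z0 => b0 C | z1 => b1 C | z2 => b2 C | z3 => b3 C | z4 => b4 C end.

Definition mk5 f := S5 (f z0) (f z1) (f z2) (f z3) (f z4).

Lemma mem_mk5 f d : mem5 (mk5 f) d = f d.
Proof. by case: d. Qed.

Definition emp5 := mk5 (fun=> false).
Definition one5 d := mk5 (eq5 d).
Definition cup5 A B := mk5 (fun d => mem5 A d || mem5 B d).
Definition cap5 A B := mk5 (fun d => mem5 A d && mem5 B d).
Definition cpl5 A := mk5 (fun d => ~~ mem5 A d).
Definition neg5 A := mk5 (fun d => mem5 A (opp5 d)).
Definition shift5 A a := mk5 (fun d => mem5 A (sub5 d a)).
Definition card5 (C : s5) : nat := b0 C + b1 C + b2 C + b3 C + b4 C.
Definition all5 (f : z5 -> bool) := [&& f z0, f z1, f z2, f z3 & f z4].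
Definition ex5 (f : z5 -> bool) := [|| f z0, f z1, f z2, f z3 | f z4].
Definition empb C := ~~ ex5 (mem5 C).
Definition fullb C := all5 (mem5 C).
(* The full set is given two cyclic runs, hence cost 7. *)
Definition runs (C : s5) : nat :=
  if fullb C then 2 else card5 (mk5 (fun d => mem5 C d && ~~ mem5 C (sub5 d z1))).
Definition cost C := card5 C + runs C.

Definition enum_s5 : seq s5 :=
  let bs := [:: true; false] in
  flatten [seq [seq S5 t.1.1.1 t.1.1.2 t.1.2 t.2 x | x <- bs] |
    t <- [seq (p, x) | p <- [seq (p, x) | p <- [seq (p, x) | p <- bs, x <- bs], x <- bs], x <- bs]].
Definition alls (f : s5 -> bool) := all f enum_s5.

Lemma allsP f : alls f = true -> forall C, f C.
Proof.
rewrite /alls /=; do 32! case/andP => ?; move=> _.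
by case=> [[] [] [] [] []].
Qed.

Lemma all5P (f : z5 -> bool) : reflect (forall d, f d) (all5 f).
Proof.
apply: (iffP idP) => [|H]; last by rewrite /all5 !H.
by case/and5P => ? ? ? ? ? [].
Qed.

Lemma ex5P (f : z5 -> bool) : reflect (exists d, f d) (ex5 f).
Proof.
apply: (iffP idP) => [|[d Hd]]; last by move: Hd; rewrite /ex5; case: d => -> //=; rewrite ?orbT.
by case/or4P => [||| /orP [] ] ?; [exists z0|exists z1|exists z2|exists z3|exists z4].
Qed.

Lemma empbP C : empb C -> C = emp5.
Proof. by case: C => [[] [] [] [] []]. Qed.

Lemma cost_neg C : cost (neg5 C) = cost C.
Proof. by case: C => [[] [] [] [] []]. Qed.
Lemma runs_neg C : runs (neg5 C) = runs C.
Proof. by case: C => [[] [] [] [] []]. Qed.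
Lemma neg5K C : neg5 (neg5 C) = C.
Proof. by case: C. Qed.
Lemma neg5U A B : neg5 (cup5 A B) = cup5 (neg5 A) (neg5 B).
Proof. by []. Qed.
Lemma cost_shift C a : cost (shift5 C a) = cost C.
Proof. by case: C => [[] [] [] [] []]; case: a. Qed.
Lemma runs_shift C a : runs (shift5 C a) = runs C.
Proof. by case: C => [[] [] [] [] []]; case: a. Qed.
Lemma mem_neg C a b : mem5 (neg5 C) (sub5 a b) = mem5 C (sub5 b a).
Proof. by rewrite mem_mk5 opp5B. Qed.

(* A merged union either saves cost or keeps the two families of runs apart. *)
Lemma costU A B : cost (cup5 A B) <= cost A + cost B /\
  (cost (cup5 A B) < cost A + cost B \/ runs A + runs B <= runs (cup5 A B)).
Proof.
have := allsP (f := fun A => alls (fun B => (cost (cup5 A B) <= cost A + cost B) &&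
  ((cost (cup5 A B) < cost A + cost B) || (runs A + runs B <= runs (cup5 A B)))))
  ltac:(by vm_compute) A.
by move/allsP => /(_ B) /andP [? /orP].
Qed.

(** * Weights on pairs *)

Section Weights.
Variable V : finType.
Implicit Types (w : V -> V -> nat) (S T : {set V}).

Definition deg w v S := \sum_(u in S) w v u.
(** Comparing [enum_rank] selects each unordered pair once. *)
Definition ew w S :=
  \sum_(u in S) \sum_(v in S | enum_rank u < enum_rank v) w u v.

Lemma rank_lt u v : u != v :> V ->
  (enum_rank v < enum_rank u) = ~~ (enum_rank u < enum_rank v).
Proof.
move=> uv; rewrite -leqNgt ltn_neqAle; case: eqP => //= /ord_inj /enum_rank_inj vu.
by rewrite vu eqxx in uv.
Qed.

Lemma ew0 w : ew w set0 = 0.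
Proof. by rewrite /ew big_set0. Qed.

Lemma degU1 w v u S : u \notin S -> deg w v (u |: S) = w v u + deg w v S.
Proof. by move=> uS; rewrite /deg big_setU1. Qed.

Lemma ewU1 w v S : (forall x y, w x y = w y x) -> v \notin S ->
  ew w (v |: S) = ew w S + deg w v S.
Proof.
move=> wC vS; rewrite /ew /deg big_setU1 //=.
have -> : \sum_(x in v |: S | enum_rank v < enum_rank x) w v x =
          \sum_(x in S) (if enum_rank v < enum_rank x then w v x else 0).
  rewrite big_mkcondr big_setU1 //= ltnn add0n.
  by [].
have -> : \sum_(u in S) \sum_(x in v |: S | enum_rank u < enum_rank x) w u x =
   \sum_(u in S) ((if enum_rank u < enum_rank v then w v u else 0) +
       \sum_(x in S | enum_rank u < enum_rank x) w u x).
  apply: eq_bigr => u uS.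
  by rewrite big_mkcondr big_setU1 //= -big_mkcondr wC.
rewrite big_split /= addnA addnC; congr (_ + _).
rewrite -big_split /=; apply: eq_bigr => u uS.
have uv : u != v by apply: contraNneq vS => <-.
by rewrite (rank_lt uv); case: (_ < _); rewrite /= ?addn0 ?add0n.
Qed.

Lemma eq_deg w w' v S : {in S, w v =1 w' v} -> deg w v S = deg w' v S.
Proof. by move=> H; apply: eq_bigr => u uS; apply: H. Qed.

Lemma eq_ew w w' S : {in S &, w =2 w'} -> ew w S = ew w' S.
Proof.
move=> H; apply: eq_bigr => u uS; apply: eq_bigr => v /andP [vS _]; exact: H.
Qed.

Lemma leq_deg w w' v S : (forall x y, w x y <= w' x y) -> deg w v S <= deg w' v S.
Proof. by move=> H; apply: leq_sum => u uS. Qed.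

Lemma leq_ew w w' S : (forall x y, w x y <= w' x y) -> ew w S <= ew w' S.
Proof. by move=> H; apply: leq_sum => u uS; apply: leq_sum => v _. Qed.

Lemma deg_sub w v S T : S \subset T -> deg w v S <= deg w v T.
Proof.
move=> ST; rewrite /deg [X in _ <= X](big_setID S) /= (setIidPr ST).
exact: leq_addr.
Qed.

Lemma deg_seq w v S s : uniq s -> {subset s <= S} -> \sum_(u <- s) w v u <= deg w v S.
Proof.
move=> us sS; rewrite big_uniq //= /deg [X in _ <= X](bigID (mem s)) /=.
rewrite [X in _ <= X + _](eq_bigl (mem s)); first exact: leq_addr.
by move=> u /=; case: (boolP (u \in s)) => [/sS ->|]; rewrite ?andbF.
Qed.

Lemma deg_eq_seq w v S s : uniq s -> {subset s <= S} ->
  {in S, forall u, u \notin s -> w v u = 0} -> deg w v S = \sum_(u <- s) w v u.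
Proof.
move=> us sS w0; rewrite /deg (bigID (mem s)) /= [X in _ + X]big1 ?addn0 => [|u /andP [uS us']].
  rewrite big_uniq //=.
  by apply: eq_bigl => u /=; case: (boolP (u \in s)) => [/sS ->|]; rewrite ?andbF.
exact: w0.
Qed.

Section Sym.
Variable w : V -> V -> nat.
Hypotheses (wC : forall x y, w x y = w y x) (w0 : forall x, w x x = 0).

Lemma degU v S T : [disjoint S & T] -> deg w v (S :|: T) = deg w v S + deg w v T.
Proof. by move=> ST; rewrite /deg (eq_bigl [predU S & T]) ?bigU // => x; rewrite !inE. Qed.

Definition cross S T := \sum_(u in S) deg w u T.

Lemma crossC S T : cross S T = cross T S.
Proof.
rewrite /cross /deg exchange_big /=; apply: eq_bigr => u _.
by apply: eq_bigr => v _; rewrite wC.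
Qed.

Lemma ewU S T : [disjoint S & T] -> ew w (S :|: T) = ew w S + ew w T + cross S T.
Proof.
elim: {S}#|S| {-2}S (erefl #|S|) => [S /eqP|n IH S Sn ST].
  rewrite cards_eq0 => /eqP ->; rewrite set0U ew0 /cross big_set0; lia.
have [x xS] : exists x, x \in S by apply/set0Pn; rewrite -cards_eq0 Sn.
have Sx : S = x |: S :\ x by rewrite setD1K.
have xT : x \notin T by rewrite (disjointFr ST).
have xS' : x \notin S :\ x by rewrite !inE eqxx.
have ST' : [disjoint S :\ x & T] by apply: disjointWl ST; apply: subsetDl.
have cS : #|S :\ x| = n by move: (cardsD1 x S); rewrite xS Sn; lia.
rewrite {1 2}Sx -setUA !ewU1 // ?IH ?degU //; last by rewrite inE negb_or xS'.
have -> : cross S T = deg w x T + cross (S :\ x) T.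
  by rewrite /cross {1}Sx big_setU1.
lia.
Qed.

Lemma sum_deg S : \sum_(v in S) deg w v S = (ew w S).*2.
Proof.
elim: {S}#|S| {-2}S (erefl #|S|) => [S /eqP|n IH S Sn].
  by rewrite cards_eq0 => /eqP ->; rewrite ew0 big_set0.
have [x xS] : exists x, x \in S by apply/set0Pn; rewrite -cards_eq0 Sn.
have Sx : S = x |: S :\ x by rewrite setD1K.
have xS' : x \notin S :\ x by rewrite !inE eqxx.
have cS : #|S :\ x| = n by move: (cardsD1 x S); rewrite xS Sn; lia.
rewrite {1 2 3}Sx ewU1 // big_setU1 //= degU1 // w0 add0n doubleD -IH //.
under eq_bigr => v _ do rewrite degU1 // wC.
rewrite big_split /= -[\sum_(i in _ :\ _) w x i]/(deg w x (S :\ x)); lia.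
Qed.

Lemma cross_sub S S' T T' : S \subset S' -> T \subset T' -> cross S T <= cross S' T'.
Proof.
move=> SS TT; apply: (@leq_trans (cross S T')); first by apply: leq_sum => u _; exact: deg_sub.
rewrite /cross [X in _ <= X](big_setID S) /= (setIidPr SS); exact: leq_addr.
Qed.

(** The pairs joining [S :\: T] to [T :\: S] are counted only in the union. Cardinality being
    modular, the potential is submodular. *)
Lemma ew_submod S T : ew w S + ew w T <= ew w (S :|: T) + ew w (S :&: T).
Proof.
have eS : ew w S = ew w (S :\: T) + ew w (S :&: T) + cross (S :\: T) (S :&: T).
  rewrite -ewU; first by rewrite setUC setID.
  by rewrite -setI_eq0 setIC; apply/eqP/setP => x; rewrite !inE; by case: (x \in T); case: (x \in S).
have eST : ew w (S :|: T) = ew w (S :\: T) + ew w T + cross (S :\: T) T.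
  rewrite -ewU; first by congr (ew w _); apply/setP => x; rewrite !inE; by case: (x \in T); case: (x \in S).
  by rewrite -setI_eq0; apply/eqP/setP => x; rewrite !inE; by case: (x \in T); case: (x \in S).
have : cross (S :\: T) (S :&: T) <= cross (S :\: T) T by apply: cross_sub => //; exact: subsetIr.
lia.
Qed.

End Sym.

Lemma ew_pair w w' p q S : (forall x y, w x y = w y x) -> (forall x y, w' x y = w' y x) ->
  p != q -> (forall x y, [set x; y] != [set p; q] -> w' x y = w x y) ->
  p \in S -> q \in S -> ew w' S + w p q = ew w S + w' p q.
Proof.
move=> wC w'C pq H pS qS.
have pS1 : p \notin S :\ p :\ q by rewrite !inE eqxx /= andbF.
have pS2 : p \notin q |: (S :\ p :\ q) by rewrite !inE eqxx (negPf pq) ?andbF.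
have qS1 : q \notin S :\ p :\ q by rewrite !inE eqxx.
have -> : S = p |: (q |: (S :\ p :\ q)).
  by apply/setP => x; rewrite !inE; case: eqP => [->|_]; case: eqP => [->|_].
rewrite !ewU1 // !degU1 //.
have HS x y : x \in S :\ p :\ q -> w' x y = w x y.
  rewrite !inE => /and3P [xq xp _]; apply: H; apply/eqP => E.
  have : x \in [set p; q] by rewrite -E !inE eqxx.
  by rewrite !inE (negPf xq) (negPf xp).
have -> : ew w' (S :\ p :\ q) = ew w (S :\ p :\ q).
  by apply: eq_ew => x y xS _; exact: HS.
have E z : deg w' z (S :\ p :\ q) = deg w z (S :\ p :\ q).
  by apply: eq_deg => x xS; rewrite wC w'C HS.
rewrite !E; lia.
Qed.

End Weights.

(** * Constraint instances and their modifications *)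

Section Inst.
Variable V : finType.
Implicit Types (C D : V -> V -> s5) (x : V -> z5) (S W A : {set V}).

Definition sym_inst C :=
  (forall u v, C u v = neg5 (C v u)) /\ (forall v, C v v = emp5).
Definition valid C x S :=
  forall u v, u \in S -> v \in S -> ~~ mem5 (C u v) (sub5 (x u) (x v)).
Definition col C S := exists x, valid C x S.
Definition crit C W := ~ col C W /\ forall S, S \proper W -> col C S.
Definition wcost C u v := cost (C u v).
Definition wruns C u v := runs (C u v).
Definition wadj C u v : nat := ~~ empb (C u v).
Definition eC C := ew (wcost C).
Definition rC C := ew (wruns C).
Definition aC C := ew (wadj C).
(* The second alternative is the one met by the triangle. *)
Definition good C W :=
  5 * #|W| <= eC C W + 2 \/ (5 * #|W| <= eC C W + 3 /\ rC C W <= #|W|).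

Lemma uncol_crit C A : ~ col C A -> exists2 W : {set V}, W \subset A & crit C W.
Proof.
elim: {A}#|A| {-2}A (leqnn #|A|) => [|n IH] A An nA.
  exists A => //; split=> // S /proper_card; lia.
case: (classic (forall S, S \proper A -> col C S)) => [H|].
  by exists A.
move/not_all_ex_not => [S /(imply_to_and (S \proper A)) [SA nS]].
have [||W WS cW] := IH S => //; first by move: (proper_card SA); lia.
by exists W => //; apply: subset_trans WS (proper_sub SA).
Qed.

Lemma wcostC C : sym_inst C -> forall u v, wcost C u v = wcost C v u.
Proof. by move=> [sC _] u v; rewrite /wcost sC cost_neg. Qed.
Lemma wrunsC C : sym_inst C -> forall u v, wruns C u v = wruns C v u.
Proof. by move=> [sC _] u v; rewrite /wruns sC runs_neg. Qed.
Lemma empb_neg (A : s5) : empb (neg5 A) = empb A.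
Proof. by case: A => [[] [] [] [] []]. Qed.
Lemma wadjC C : sym_inst C -> forall u v, wadj C u v = wadj C v u.
Proof. by move=> [sC _] u v; rewrite /wadj sC empb_neg. Qed.
Lemma wcost0 C : sym_inst C -> forall v, wcost C v v = 0.
Proof. by move=> [_ iC] v; rewrite /wcost iC. Qed.
Lemma wruns0 C : sym_inst C -> forall v, wruns C v v = 0.
Proof. by move=> [_ iC] v; rewrite /wruns iC. Qed.
Lemma wadj0 C : sym_inst C -> forall v, wadj C v v = 0.
Proof. by move=> [_ iC] v; rewrite /wadj iC. Qed.
Lemma wadj_runs C u v : wadj C u v <= wruns C u v.
Proof. by rewrite /wadj /wruns; case: (C u v) => [[] [] [] [] []]. Qed.

Definition upd x v t u := if u == v then t else x u.

Lemma valid_upd C x v t S : sym_inst C -> valid C x S ->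
  (forall u, u \in S -> u != v -> ~~ mem5 (C v u) (sub5 t (x u))) ->
  valid C (upd x v t) (v |: S).
Proof.
move=> [sC iC] xS H a b; rewrite !inE /upd.
case: (eqVneq a v) => [->|av] /= aS; case: (eqVneq b v) => [->|bv] /= bS.
- by rewrite iC; case: t {H} => //; case: (sub5 _ _).
- exact: H.
- by rewrite sC mem_neg; exact: H.
- exact: xS.
Qed.

(* A modification forbids the differences [mn] on the pair [mp, mq]; [mk] and
   [mr] bound the resulting increase of cost and of the number of runs. *)
Record md := Md { mp : V; mq : V; mn : s5; mk : nat; mr : nat }.
Implicit Types (m : md) (l : seq md).

Definition mdd p q N := Md p q N (cost N) (runs N).
Definition addp C m u v :=
  if (u == mp m) && (v == mq m) then cup5 (C u v) (mn m)
  else if (u == mq m) && (v == mp m) then cup5 (C u v) (neg5 (mn m)) else C u v.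
Definition touched m S := (mp m \in S) && (mq m \in S).
(** The dichotomy of [costU] for the pair as it stands: a modification that overlaps an existing
    constraint may be charged less than [cost (mn m)]. *)
Definition okm C m := mp m != mq m /\
  let A := C (mp m) (mq m) in let B := cup5 A (mn m) in
  cost B <= cost A + mk m /\ (cost B < cost A + mk m \/ runs A + mr m <= runs B).

Fixpoint addl C l := if l is m :: l' then addp (addl C l') m else C.
Fixpoint okl C l := if l is m :: l' then okm (addl C l') m /\ okl C l' else True.
Fixpoint kap l S := if l is m :: l' then (if touched m S then mk m else 0) + kap l' S else 0.
Fixpoint rho l S := if l is m :: l' then (if touched m S then mr m else 0) + rho l' S else 0.
Fixpoint touch l S := if l is m :: l' then touched m S || touch l' S else false.
Fixpoint resp l x S := if l is m :: l' then
  (touched m S -> ~~ mem5 (mn m) (sub5 (x (mp m)) (x (mq m)))) /\ resp l' x S else True.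

Lemma okm_dd C p q N : p != q -> okm C (mdd p q N).
Proof. by rewrite /okm /= => pq; split=> //; have [] := costU (C p q) N. Qed.

Lemma addp_sym C m : mp m != mq m -> sym_inst C -> sym_inst (addp C m).
Proof.
move=> pq [sC iC]; split=> [u v|v]; rewrite /addp.
  rewrite [(v == mp m) && _]andbC [(v == mq m) && _]andbC.
  case: (boolP ((u == mp m) && _)) => [/andP [/eqP -> /eqP ->]|_].
    by rewrite (negPf pq) /= neg5U neg5K -sC.
  case: (boolP ((u == mq m) && _)) => [/andP [/eqP -> /eqP ->]|_]; last exact: sC.
  by rewrite neg5U -sC.
case: (eqVneq v (mp m)) => [->|_] /=; first by rewrite (negPf pq) iC.
by rewrite andbF iC.
Qed.

Lemma addp_other C m u v : [set u; v] != [set mp m; mq m] -> addp C m u v = C u v.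
Proof.
rewrite /addp => H.
case: (boolP ((u == mp m) && _)) => [/andP [/eqP uu /eqP vv]|_].
  by rewrite uu vv eqxx in H.
case: (boolP ((u == mq m) && _)) => [/andP [/eqP uu /eqP vv]|_ //].
by rewrite uu vv setUC eqxx in H.
Qed.

Lemma addp_pq C m : addp C m (mp m) (mq m) = cup5 (C (mp m) (mq m)) (mn m).
Proof. by rewrite /addp !eqxx. Qed.

Lemma addl_sym C l : sym_inst C -> okl C l -> sym_inst (addl C l).
Proof.
by move=> sC; elim: l => //= m l IH [[pq _] /IH]; apply: addp_sym.
Qed.

Lemma set2_mem (p q u v : V) S : [set u; v] = [set p; q] -> u \in S -> v \in S ->
  p \in S /\ q \in S.
Proof.
move=> E uS vS; have H w : w \in [set p; q] -> w \in S by rewrite -E !inE => /orP [] /eqP ->.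
by split; apply: H; rewrite !inE eqxx ?orbT.
Qed.

Lemma addp_untouched C m S : ~~ touched m S -> {in S &, addp C m =2 C}.
Proof.
move=> tS u v uS vS; apply: addp_other; apply: contra tS => /eqP E.
by have [pS qS] := set2_mem E uS vS; rewrite /touched pS qS.
Qed.

Lemma addp_e C m S : sym_inst C -> okm C m ->
  let k := if touched m S then mk m else 0 in
  let r := if touched m S then mr m else 0 in
  eC (addp C m) S <= eC C S + k /\
  (eC (addp C m) S < eC C S + k \/ rC C S + r <= rC (addp C m) S).
Proof.
move=> sC [pq [k1 k2]] /=; have sC' := addp_sym pq sC.
case: (boolP (touched m S)) => tS.
  have [pS qS] := andP tS.
  have E1 := ew_pair (wcostC sC) (wcostC sC') pq _ pS qS.
  have E2 := ew_pair (wrunsC sC) (wrunsC sC') pq _ pS qS.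
  rewrite /wcost /wruns addp_pq in E1 E2.
  have {}E1 := E1 (fun u v H => congr1 cost (addp_other C H)).
  have {}E2 := E2 (fun u v H => congr1 runs (addp_other C H)).
  rewrite /eC /rC /wcost /wruns; lia.
have E := addp_untouched C tS.
have -> : eC (addp C m) S = eC C S by apply: eq_ew => u v uS vS; rewrite /wcost E.
have -> : rC (addp C m) S = rC C S by apply: eq_ew => u v uS vS; rewrite /wruns E.
lia.
Qed.

(** One modification that saves cost makes the total strict; if none does, all the runs add up. *)
Lemma addl_e C l S : sym_inst C -> okl C l ->
  eC (addl C l) S <= eC C S + kap l S /\
  (eC (addl C l) S < eC C S + kap l S \/ rC C S + rho l S <= rC (addl C l) S).
Proof.
move=> sC; elim: l => [|m l IH] /=; first lia.
move=> [okM okL]; have := IH okL; have := addp_e S (addl_sym sC okL) okM => /=; lia.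
Qed.

Lemma mem_cup (A B : s5) d : mem5 (cup5 A B) d = mem5 A d || mem5 B d.
Proof. exact: mem_mk5. Qed.

Lemma addl_valid C l x S : okl C l -> valid (addl C l) x S -> valid C x S /\ resp l x S.
Proof.
elim: l => //= m l IH [[pq _] okL] xS.
have xS' : valid (addl C l) x S.
  move=> u v uS vS; move: (xS u v uS vS); rewrite /addp.
  by do ?[case: ifP => _]; rewrite ?mem_cup ?negb_or // => /andP [].
have [x1 x2] := IH okL xS'; split=> //; split=> // /andP [pS qS].
by move: (xS _ _ pS qS); rewrite addp_pq mem_cup negb_or => /andP [].
Qed.

Lemma valid_untouch C l x S : ~~ touch l S -> valid C x S -> valid (addl C l) x S.
Proof.
elim: l => //= m l IH; rewrite negb_or => /andP [tm tl] xS u v uS vS.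
by rewrite (addp_untouched _ tm) //; apply: IH.
Qed.

Lemma small_col C S : sym_inst C -> #|S| <= 1 -> col C S.
Proof.
move=> [_ iC] S1; exists (fun=> z0) => u v uS vS.
have -> : u = v by apply: (card_le1_eqP S1).
by rewrite iC.
Qed.

End Inst.

Arguments okm_dd {V C p q N}.

(** * Minimal counterexamples and the reduction step *)

Section Kay.
Variable V : finType.
Variable C : V -> V -> s5.

(** The induction hypothesis covers proper subsets with arbitrary constraints on them, since
    reductions change the constraints. *)
Definition mincex :=
  [/\ sym_inst C,
      (forall C' (W : {set V}), sym_inst C' -> W <> setT -> crit C' W -> good C' W),
      crit C setT & ~ good C setT].

Hypothesis K : mincex.
Let sC : sym_inst C. Proof. by case: K. Qed.

Lemma proper_col S : S <> setT -> col C S.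
Proof.
move=> ST; case: K => _ _ [_ H] _; apply: H; rewrite properT; exact/eqP.
Qed.

Lemma uncolT : ~ col C setT.
Proof. by case: K => _ _ [H _] _. Qed.

(** A colouring of the modified instance on [R] would yield one of everything, so some [W] inside
    [R] is critical there. [W] contains both ends of a modified pair, for otherwise it is coloured
    as a proper subset in [C]. The two final alternatives are those of [good], carried back to [C];
    any cost saved by merging falls under the first. *)
Lemma reduce l (R : {set V}) : okl C l -> R <> setT ->
  (forall x, valid C x R -> resp l x R -> col C setT) ->
  exists W : {set V}, [/\ W \subset R, 2 <= #|W|, W <> setT & touch l W] /\
    (crit (addl C l) W /\
    (5 * #|W| + 1 <= eC C W + kap l W + 3 \/
     (5 * #|W| <= eC C W + kap l W + 3 /\ rC C W + rho l W <= #|W|))).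
Proof.
move=> okL RT ext; have sL := addl_sym sC okL.
have [|W WR cW] := @uncol_crit V (addl C l) R.
  by move=> [x /(addl_valid okL) [x1 x2]]; apply: uncolT; apply: ext x1 x2.
have WT : W <> setT.
  by move=> WT; apply: RT; apply/eqP; rewrite -subTset -WT.
exists W; split; first split=> //.
- by rewrite ltnNge; apply/negP => W1; case: cW => H _; apply: H; apply: small_col.
- apply: contraT => nt; case: cW => H _; case: H.
  by have [x xW] := proper_col WT; exists x; apply: valid_untouch.
split=> //; have := addl_e W sC okL.
by case: K => _ IH _ _; case: (IH _ _ sL WT cW); lia.
Qed.

End Kay.

(** * Minimal counterexamples: degrees *)

(* Differences [x1 - x2] of two neighbours that leave no colour in between. *)
Definition comp5 A B :=
  mk5 (fun d => all5 (fun t => mem5 A (sub5 t d) || mem5 B t)).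

Lemma comp5P A B a b : ~~ mem5 (comp5 A B) (sub5 a b) ->
  exists t, ~~ mem5 A (sub5 t a) && ~~ mem5 B (sub5 t b).
Proof.
rewrite mem_mk5 => /all5P H; apply: NNPP => H'; apply: H => t.
apply: contraT => Ht; case: H'; exists (add5 t b).
by move: Ht; rewrite add5K negb_or; case: a; case: b; case: t.
Qed.

(** The 5 saved pays for the vertex deleted in [degree_ge3]. If no more is saved, at most one run
    disappears, and the bound on the runs grows by one when that vertex is put back. *)
Lemma comp5_cost A B : ~~ fullb A -> ~~ fullb B -> ~~ empb (comp5 A B) ->
  cost (comp5 A B) + 6 <= cost A + cost B \/
  (cost (comp5 A B) + 5 <= cost A + cost B /\ runs A + runs B <= runs (comp5 A B) + 1).
Proof.
have := allsP (f := fun A => alls (fun B =>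
  [==> ~~ fullb A, ~~ fullb B, ~~ empb (comp5 A B) =>
  (cost (comp5 A B) + 6 <= cost A + cost B) ||
  (cost (comp5 A B) + 5 <= cost A + cost B) && (runs A + runs B <= runs (comp5 A B) + 1)]))
  ltac:(by vm_compute) A.
move/allsP => /(_ B) H h1 h2 h3; move: H; rewrite h1 h2 h3 /= => /orP [->|/andP []]; auto.
Qed.

Section MinCex.
Variables (V : finType) (C : V -> V -> s5).
Hypothesis K : mincex C.
Implicit Types (S W R : {set V}) (x : V -> z5).
Let sC : sym_inst C. Proof. by case: K. Qed.
Let eCC := wcostC sC.
Let eC0 := wcost0 sC.

Definition N v := [set u | ~~ empb (C v u)].

Lemma mem_N v u : (u \in N v) = ~~ empb (C v u).
Proof. by rewrite inE. Qed.

Lemma N_sym v u : (u \in N v) = (v \in N u).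
Proof. by rewrite !mem_N (proj1 sC v u) empb_neg. Qed.

Lemma N_irr v : (v \in N v) = false.
Proof. by rewrite mem_N (proj2 sC v). Qed.

Lemma setC1T (v : V) : [set~ v] <> setT.
Proof. by move/setP/(_ v); rewrite !inE eqxx. Qed.

Lemma ext_at v x t S : valid C x S ->
  (forall u, u \in S -> u \in N v -> ~~ mem5 (C v u) (sub5 t (x u))) ->
  valid C (upd x v t) (v |: S).
Proof.
move=> xS H; apply: valid_upd => // u uS uv.
case: (boolP (u \in N v)) => [|]; first exact: H.
by rewrite mem_N negbK => /empbP ->; case: (sub5 _ _).
Qed.

(** A full pair is uncolourable, hence by minimality the whole set; two vertices with cost 7 and two
    runs meet the second alternative of [good]. *)
Lemma not_full u v : ~~ fullb (C u v).
Proof.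
apply/negP => F; case: K => _ _ [nc pc] []; right.
have uv : u != v by apply: contraTneq F => ->; rewrite (proj2 sC).
have E : [set u; v] = setT.
  apply: NNPP => H; have /pc [x xS] : [set u; v] \proper setT by rewrite properT; apply/eqP.
  have := xS u v; rewrite !inE !eqxx orbT => /(_ isT isT).
  by move/all5P: F => ->.
have Ec w : (forall a b, w a b = w b a) -> (forall a, w a a = 0) -> ew w [set u; v] = w u v.
  move=> wC w0; rewrite (ewU1 wC) ?inE // /deg big_set1.
  have -> : [set v] = v |: set0 by rewrite setU0.
  by rewrite (ewU1 wC) ?inE // ew0 /deg big_set0.
rewrite -E cards2 uv /eC /rC !Ec //; try exact: wcostC; try exact: wrunsC;
  try exact: wcost0; try exact: wruns0.
by rewrite /wcost /wruns; move: F; case: (C u v) => [[] [] [] [] []].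
Qed.

Lemma setU1C (v : V) : v |: [set~ v] = setT.
Proof. by apply/setP => u; rewrite !inE orbN. Qed.

Lemma eU1 v S : v \notin S -> eC C (v |: S) = eC C S + deg (wcost C) v S.
Proof. exact: ewU1. Qed.
Lemma rU1 v S : v \notin S -> rC C (v |: S) = rC C S + deg (wruns C) v S.
Proof. by apply: ewU1; exact: wrunsC. Qed.

Lemma not_good : 5 * #|[set: V]| <= eC C setT + 2 -> False.
Proof. by move=> H; case: K => _ _ _ []; left. Qed.
Lemma not_exc : 5 * #|[set: V]| <= eC C setT + 3 -> rC C setT <= #|[set: V]| -> False.
Proof. by move=> H1 H2; case: K => _ _ _ []; right. Qed.

(** With at most one neighbour a colour is left, as no pair is full. With two, [v] is replaced by
    the constraint [comp5] between them, and the bound on the critical set found passes to that set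
    with [v] put back. *)
Lemma degree_ge3 v : 3 <= #|N v|.
Proof.
rewrite ltnNge; apply/negP => N2.
have v' : v \notin [set~ v] by rewrite !inE eqxx.
have EXT x : valid C x [set~ v] -> (exists t, forall u, u \in N v -> ~~ mem5 (C v u) (sub5 t (x u))) -> False.
  move=> xS [t Ht]; apply: (uncolT K); exists (upd x v t); rewrite -(setU1C v).
  by apply: ext_at => // u _; exact: Ht.
case: (ltnP #|N v| 2) => N1.
  have [x xS] := proper_col K (@setC1T v).
  apply: (EXT x) => //.
  have [->|[u uN]] := set_0Vmem (N v); first by exists z0 => u; rewrite inE.
  have /ex5P [t Ht] : ex5 (fun t => ~~ mem5 (C v u) (sub5 t (x u))).
    by move: (not_full v u) (x u); case: (C v u) => [[] [] [] [] []] // _ [].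
  exists t => w wN; suff -> : w = u by [].
  by apply: (card_le1_eqP (A := N v)); rewrite // -ltnS.
have /cards2P [u1 [u2 [u12 E]]] : #|N v| == 2 by apply/eqP; alia.
have uv1 : u1 \in [set~ v] by rewrite !inE; apply: contraFneq (N_irr v) => ev; rewrite E !inE -ev eqxx.
have uv2 : u2 \in [set~ v] by rewrite !inE; apply: contraFneq (N_irr v) => ev; rewrite E !inE -ev eqxx orbT.
set M := comp5 (C v u1) (C v u2).
pose l := if empb M then [::] else [:: mdd u1 u2 M].
have okL : okl C l by rewrite /l; case: ifP => //= _; split=> //; apply: okm_dd.
have [||W [[WR W2 WT] tW [cW gW]]] := reduce (R := [set~ v]) K okL; first exact: setC1T.
  move=> x xS rx; exfalso; apply: (EXT x) => //.
  have : ~~ mem5 M (sub5 (x u1) (x u2)).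
    move: rx; rewrite /l; case: (boolP (empb M)) => [/empbP -> _|_ /= []]; first by case: (sub5 _ _).
    by rewrite /touched /= uv1 uv2 => ->.
  by move/comp5P => [t /andP [t1 t2]]; exists t => u; rewrite E !inE => /orP [] /eqP ->.
move: tW gW; rewrite /l; case: (boolP (empb M)) => //= nM.
rewrite !orbF !addn0 => tW; rewrite tW => gW.
have [uW1 uW2] := andP tW; rewrite /= in uW1 uW2.
have vW : v \notin W by apply/negP => /(subsetP WR); rewrite !inE eqxx.
(* A colouring of [v |: W] in [C] respects [M], because [v] itself has a colour; restricted to [W]
   it would colour the modified instance. *)
have vT : v |: W = setT.
  apply: NNPP => H; have [x xS] := proper_col K H.
  case: cW => nc _; apply: nc; exists x; rewrite /l (negPf nM) /= => a b aW bW.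
  rewrite /addp /=.
  have xab := xS a b (setU1r v aW) (setU1r v bW).
  have nM' : ~~ mem5 M (sub5 (x u1) (x u2)).
    rewrite mem_mk5; apply/all5P => H'.
    have := xS v u1 (setU11 _ _) (setU1r v uW1); have := xS v u2 (setU11 _ _) (setU1r v uW2).
    move: (H' (sub5 (x v) (x u2))).
    by rewrite sub5_add sub5K => /orP [] ->.
  case: ifP => [/andP [/eqP ea /eqP eb]|_]; first by subst; rewrite mem_cup negb_or xab.
  case: ifP => [/andP [/eqP ea /eqP eb]|_ //]; subst.
  by rewrite mem_cup negb_or xab mem_neg.
have dE w : (forall u, u \notin N v -> w v u = 0) -> deg w v W = w v u1 + w v u2.
  move=> w0; rewrite (@deg_eq_seq _ w v W [:: u1; u2]) /= ?inE ?u12 //.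
  - by rewrite !big_cons big_nil addn0.
  - by move=> u; rewrite !inE => /orP [] /eqP ->.
  - by move=> u _ uu; apply: w0; rewrite E !inE negb_or; move: uu; rewrite !inE negb_or.
have de := dE (wcost C); have dr := dE (wruns C).
have cT : #|[set: V]| = #|W|.+1 by rewrite -vT cardsU1 vW.
have eT : eC C setT = eC C W + (cost (C v u1) + cost (C v u2)).
  by rewrite -vT eU1 // de // => u; rewrite mem_N negbK /wcost => /empbP ->.
have rT : rC C setT = rC C W + (runs (C v u1) + runs (C v u2)).
  by rewrite -vT rU1 // dr // => u; rewrite mem_N negbK /wruns => /empbP ->.
have := not_good; have := not_exc; rewrite cT eT rT.
have := comp5_cost (not_full v u1) (not_full v u2) nM; rewrite -/M; alia.
Qed.

End MinCex.

(** * Contraction and the potential of proper sets *)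

Lemma bigcup_cost (V : finType) (X : {set V}) (F : V -> s5) :
  let U := \big[cup5/emp5]_(r in X) F r in
  cost U <= \sum_(r in X) cost (F r) /\
  (cost U < \sum_(r in X) cost (F r) \/ \sum_(r in X) runs (F r) <= runs U).
Proof.
move=> U; rewrite /U; elim/big_rec3: _ => [|r a b c _]; first by split; [|right].
have := costU (F r) c; alia.
Qed.

Lemma sum_gain (V : finType) (W : {set V}) (a b c d : V -> nat) :
  (forall v, a v <= b v /\ (a v < b v \/ c v <= d v)) ->
  \sum_(v in W) a v <= \sum_(v in W) b v /\
  (\sum_(v in W) a v < \sum_(v in W) b v \/ \sum_(v in W) c v <= \sum_(v in W) d v).
Proof.
move=> H; rewrite -!big_enum /=; elim: (enum W) => [|v s]; first by rewrite !big_nil; alia.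
by rewrite !big_cons; have := H v; alia.
Qed.

Lemma mem_bigcup (V : finType) (X : {set V}) (F : V -> s5) d r :
  r \in X -> mem5 (F r) d -> mem5 (\big[cup5/emp5]_(r in X) F r) d.
Proof.
move=> rX Fd; have : forall s, r \in s -> mem5 (\big[cup5/emp5]_(r <- s | r \in X) F r) d.
  elim=> // a s IH; rewrite inE big_cons => /orP [/eqP <-|/IH H].
    by rewrite rX mem_cup Fd.
  by case: ifP => // _; rewrite mem_cup H orbT.
by apply; rewrite mem_index_enum.
Qed.

Section MinCex.
Variables (V : finType) (C : V -> V -> s5).
Hypothesis K : mincex C.
Implicit Types (S W R X : {set V}) (x : V -> z5).
Let sC : sym_inst C. Proof. by case: K. Qed.

Section Con.
Variables (X : {set V}) (r0 : V) (f : V -> z5).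
Hypotheses (r0X : r0 \in X) (fX : valid C f X).

(* Contraction of [X], coloured by [f], to its vertex [r0]. *)
Definition port v := \big[cup5/emp5]_(r in X) shift5 (C v r) (sub5 (f r) (f r0)).
Definition con u v :=
  if u \in X then (if v \in X then emp5 else if u == r0 then neg5 (port v) else emp5)
  else if v \in X then (if v == r0 then port u else emp5) else C u v.

Lemma con_sym : sym_inst con.
Proof.
split=> [u v|v]; rewrite /con; last by case: (v \in X) => //; apply: (proj2 sC).
case: (u \in X); case: (v \in X) => //; try by case: ifP; rewrite ?neg5K.
exact: (proj1 sC).
Qed.

Definition glue x v := if v \in X then add5 (sub5 (f v) (f r0)) (x r0) else x v.

Lemma con_valid R x : valid con x (r0 |: (R :\: X)) -> valid C (glue x) R.
Proof.
move=> xR.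
have H u v : u \in R -> u \notin X -> v \in X -> ~~ mem5 (C u v) (sub5 (glue x u) (glue x v)).
  move=> uR uX vX; rewrite /glue (negPf uX) vX.
  have := xR u r0; rewrite !inE eqxx uX uR orbT /con (negPf uX) r0X eqxx => /(_ isT isT).
  apply: contra => H; rewrite /port; apply: (@mem_bigcup _ X (fun r => shift5 (C u r) (sub5 (f r) (f r0))) _ v vX).
  rewrite mem_mk5.
  by rewrite sub5_add.
move=> u v uR vR; case: (boolP (u \in X)) => uX; case: (boolP (v \in X)) => vX.
- rewrite /glue uX vX; have := fX uX vX.
  by case: (f u) (f v) (f r0) (x r0) => [] [] [] [].
- by rewrite (proj1 sC) mem_neg; apply: H.
- exact: H.
have := xR u v; rewrite /glue /con !inE uX vX uR vR !orbT (negPf uX) (negPf vX).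
by apply.
Qed.

(** All constraints from one vertex to [X] are merged into a single port, so the dichotomy of
    [costU] carries over. *)
Lemma con_deg W : r0 \notin W -> [disjoint W & X] ->
  deg (wcost con) r0 W <= cross (wcost C) W X /\
  (deg (wcost con) r0 W < cross (wcost C) W X \/
   cross (wruns C) W X <= deg (wruns con) r0 W).
Proof.
move=> _ dWX.
have E (w : s5 -> nat) v : (forall A, w (neg5 A) = w A) -> v \in W -> w (con r0 v) = w (port v).
  by move=> wn vW; rewrite /con r0X (disjointFr dWX vW) eqxx wn.
rewrite /deg /wcost /wruns.
rewrite (eq_bigr (fun v => cost (port v))); last by move=> v vW; rewrite E //; apply: cost_neg.
rewrite [\sum_(i in W) runs _](eq_bigr (fun v => runs (port v))); last first.
  by move=> v vW; rewrite E //; apply: runs_neg.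
rewrite /cross /deg; apply: sum_gain => v.
pose F r := shift5 (C v r) (sub5 (f r) (f r0)).
have Ec : \sum_(r in X) cost (F r) = \sum_(r in X) cost (C v r).
  by apply: eq_bigr => r _; rewrite cost_shift.
have Er : \sum_(r in X) runs (F r) = \sum_(r in X) runs (C v r).
  by apply: eq_bigr => r _; rewrite runs_shift.
by have := bigcup_cost X F; rewrite Ec Er.
Qed.

Lemma eC_con S : [disjoint S & X] -> eC con S = eC C S /\ rC con S = rC C S.
Proof.
move=> dS; have H u v : u \in S -> v \in S -> con u v = C u v.
  by move=> uS vS; rewrite /con (disjointFr dS uS) (disjointFr dS vS).
by split; apply: eq_ew => u v uS vS; rewrite /wcost /wruns H.
Qed.

(** If the critical set contains [r0], this vertex is expanded to [X]: a potential of at most 2 (or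
    3, with few runs) plus the added cost, in which the weight 5 of [r0] is exchanged for the
    potential of [X]. This explains the drops by 3 and by 2. Either part of the hypothesis
    [R <> setT \/ 2 <= #|X|] makes the critical set miss a vertex, so that induction applies. *)
Lemma con_reduce l R : X \subset R -> okl con l -> R <> setT \/ 2 <= #|X| ->
  (forall x, valid C x R -> (forall r, r \in X -> sub5 (x r) (x r0) = sub5 (f r) (f r0)) ->
     resp l x (r0 |: (R :\: X)) -> False) ->
  exists W, [/\ W \subset (r0 |: (R :\: X)), 2 <= #|W|, (r0 \in W) || touch l W &
    if r0 \in W then
      exists Y : {set V}, [/\ W = r0 |: Y, Y \subset R :\: X, Y <> set0 &
        5 * #|Y :|: X| + eC C X + 3 <= eC C (Y :|: X) + 5 * #|X| + kap l W \/
        (5 * #|Y :|: X| + eC C X + 2 <= eC C (Y :|: X) + 5 * #|X| + kap l W /\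
         rC C Y + cross (wruns C) Y X + rho l W <= #|Y| + 1)]
    else 5 * #|W| <= eC C W + kap l W + 3].
Proof.
move=> XR okL RX ext; have sL := addl_sym con_sym okL.
have [|W WR cW] := @uncol_crit V (addl con l) (r0 |: (R :\: X)).
  move=> [x /(addl_valid okL) [x1 x2]]; apply: (ext (glue x)); first exact: con_valid.
    move=> r rX; rewrite /glue rX r0X.
    by case: (f r) (f r0) (x r0) => [] [] [].
  elim: (l) x2 => //= m l' IH [h1 h2]; split; last exact: IH.
  move=> /andP [m1 m2].
  have G u : u \in r0 |: R :\: X -> glue x u = x u.
    rewrite !inE /glue => /orP [/eqP ->|/andP [/negPf -> _] //].
    by rewrite r0X; case: (f r0) (x r0) => [] [].
  by rewrite !G //; apply: h1; rewrite /touched m1 m2.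
have WT : W <> setT.
  move=> WT; rewrite WT subTset in WR.
  case: RX => [RT|X2].
    apply: RT; apply/setP => u; move/eqP/setP: WR => /(_ u); rewrite !inE.
    by case/orP=> [/eqP ->|/andP [_ ->] //]; rewrite (subsetP XR).
  have [u uX ur] : exists2 u, u \in X & u != r0.
    have : 0 < #|X :\ r0| by move: (cardsD1 r0 X); rewrite r0X; alia.
    by case/card_gt0P => u; rewrite !inE => /andP [? ?]; exists u.
  by move/eqP/setP: WR => /(_ u); rewrite !inE (negPf ur) uX.
have gW : good (addl con l) W by case: K => _ IH _ _; apply: IH.
have W2 : 2 <= #|W|.
  by rewrite ltnNge; apply/negP => W1; case: cW => H _; apply: H; apply: small_col.
have dRX : [disjoint R :\: X & X].
  by rewrite -setI_eq0; apply/eqP/setP => u; rewrite !inE; case: (u \in X); rewrite ?andbF.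
have W0 : r0 \notin W -> W \subset R :\: X.
  move=> r0W; apply/subsetP => u uW; move/subsetP: WR => /(_ u uW); rewrite 2!inE.
  by case: eqP => // ur; rewrite -ur uW in r0W.
exists W; split => //.
  apply: contraT; rewrite negb_or => /andP [r0W nt]; case: cW => H _; case: H.
  have [x xW] := proper_col K WT; exists x; apply: valid_untouch => // u v uW vW.
  have H w : w \in W -> w \in X = false.
    by move=> wW; apply: (disjointFr dRX); apply: (subsetP (W0 r0W)).
  by rewrite /con !H //; apply: xW.
have := addl_e W con_sym okL.
case: ifP => r0W; last first.
  have dW : [disjoint W & X] by apply: disjointWl dRX; apply: W0; rewrite r0W.
  have [-> ->] := eC_con dW; move: gW; rewrite /good; alia.
have r0Y : r0 \notin W :\ r0 by rewrite !inE eqxx.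
have YR : W :\ r0 \subset R :\: X.
  apply/subsetP => u; rewrite in_setD1 => /andP [ur uW].
  by move/subsetP: WR => /(_ u uW); rewrite 2!inE (negPf ur).
have dY : [disjoint W :\ r0 & X] by apply: disjointWl dRX.
have := con_deg r0Y dY.
have e1 : eC con W = eC con (W :\ r0) + deg (wcost con) r0 (W :\ r0).
  by rewrite -{1}(setD1K r0W) /eC ewU1 //; apply: wcostC con_sym.
have r1 : rC con W = rC con (W :\ r0) + deg (wruns con) r0 (W :\ r0).
  by rewrite -{1}(setD1K r0W) /rC ewU1 //; apply: wrunsC con_sym.
have [E1 E2] := eC_con dY; rewrite e1 r1 E1 E2.
have e2 : eC C (W :\ r0 :|: X) = eC C (W :\ r0) + eC C X + cross (wcost C) (W :\ r0) X.
  by apply: ewU => //; apply: wcostC sC.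
have c2 : #|W :\ r0 :|: X| = #|W :\ r0| + #|X|.
  by rewrite cardsU (disjoint_setI0 dY) cards0 subn0.
have c1 : #|W| = #|W :\ r0|.+1 by rewrite (cardsD1 r0 W) r0W.
move=> h1 h2; exists (W :\ r0); split=> //.
- by rewrite setD1K.
- by move=> Y0; move: c1; rewrite Y0 cards0; alia.
rewrite e2 c2; move: gW; rewrite /good c1; alia.
Qed.

End Con.

Definition aN v S := deg (wadj C) v S.

Lemma degN w v : (forall u, ~~ empb (C v u) = (0 < w v u)) -> deg w v setT = deg w v (N C v).
Proof.
move=> H; rewrite /deg (bigID (mem (N C v))) /= [X in _ + X]big1 ?addn0 => [|u].
  by apply: eq_bigl => u; rewrite inE.
by rewrite inE mem_N H /= => /negbTE; case: (w v u).
Qed.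

Lemma aNT v : aN v setT = #|N C v|.
Proof.
rewrite /aN degN => [|u]; last by rewrite /wadj; case: (empb _).
by rewrite /deg -sum1_card; apply: eq_bigr => u; rewrite mem_N /wadj => ->.
Qed.

Lemma aN_ge v S : 3 <= aN v S + aN v (~: S).
Proof.
rewrite /aN -degU; last by rewrite -setI_eq0 setICr.
by rewrite setUCr -/(aN v _) aNT degree_ge3.
Qed.

Lemma aC_bound Y : (aC C Y).*2 + #|Y| <= #|Y| * #|Y|.
Proof.
have : \sum_(u in Y) (deg (wadj C) u Y + 1) <= \sum_(u in Y) #|Y|.
  apply: leq_sum => u uY; rewrite (cardsD1 u Y) uY addnC leq_add2l.
  rewrite -{1}(setD1K uY) degU1 ?wadj0 //; last by rewrite !inE eqxx.
  by rewrite add0n -sum1_card; apply: leq_sum => v _; rewrite /wadj; case: (empb _).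
by rewrite big_split /= (sum_deg (wadjC sC) (wadj0 sC)) sum1_card sum_nat_const.
Qed.

(** Larger sets come earlier in the induction. Colouring and contracting an [R] of potential at most
    5 yields a larger set of potential at most 3, which must be the whole set. Potential 2 there is
    excluded outright, and potential 3 comes with too few runs. *)
Lemma potential_ge6 R : 2 <= #|R| -> R <> setT -> eC C R + 6 <= 5 * #|R|.
Proof.
elim: {R}#|~: R| {-2}R (leqnn #|~: R|) => [|n IH] R Rn R2 RT.
  by move: Rn; rewrite leqn0 cards_eq0 => /eqP H; case: RT; rewrite -(setCK R) H setC0.
rewrite leqNgt; apply/negP => PR.
have [f fR] := proper_col K RT.
have [r0 r0R] : exists r0, r0 \in R by apply/card_gt0P; alia.
have [||||W [WR W2 r0W H]] := @con_reduce R r0 f r0R fR [::] setT.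
- exact: subsetT.
- by [].
- by right.
- by move=> x xT _ _; apply: (uncolT K); exists x.
rewrite orbF in r0W; move: H; rewrite r0W => [[Y [WY YR Y0]]] /=.
have dY : [disjoint Y & R].
  rewrite -setI_eq0; apply/eqP/setP => u; rewrite !inE; case: (boolP (u \in Y)) => //.
  by move/(subsetP YR); rewrite !inE andbT => /negPf.
have cY : #|Y :|: R| = #|Y| + #|R| by rewrite cardsU (disjoint_setI0 dY) cards0 subn0.
have Y1 : 0 < #|Y| by rewrite lt0n cards_eq0; apply/eqP.
case: (classic (Y :|: R = setT)) => YT; last first.
  have := IH (Y :|: R) _ _ YT; rewrite cY.
  have : #|~: (Y :|: R)| + #|Y| = #|~: R|.
    have := cardsC R; have := cardsC (Y :|: R); rewrite cY; alia.
  alia.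
rewrite YT !addn0.
have := @not_good _ _ K; have := @not_exc _ _ K.
have YC : ~: Y = R.
  apply/setP => u; rewrite !inE; move/setP: YT => /(_ u); rewrite !inE.
  case: (boolP (u \in Y)) => [uY _|_ //]; by rewrite (disjointFr dY uY).
have a3 : 3 * #|Y| <= (aC C Y).*2 + cross (wadj C) Y R.
  rewrite /aC -(sum_deg (wadjC sC) (wadj0 sC)) /cross -big_split /= mulnC -sum_nat_const.
  by apply: leq_sum => u _; rewrite -YC; exact: aN_ge.
have ar : aC C Y <= rC C Y by apply: leq_ew => u v; exact: wadj_runs.
have cr : cross (wadj C) Y R <= cross (wruns C) Y R.
  by apply: leq_sum => u _; apply: leq_deg => a b; exact: wadj_runs.
have a2 := aC_bound Y.
rewrite -YT cY.
(* The runs inside [Y] and from [Y] to [R] number at most [#|Y| + 1], while all degrees are at least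
   3; hence [2 * #|Y| - 1 <= aC C Y <= #|Y| + 1], so [#|Y| <= 2], and one or two vertices span too
   few pairs. *)
case: (#|Y|) Y1 a3 a2 => [|[|[|[|k]]]] // _ a3 a2; nia.
Qed.

End MinCex.

(** * Vertices of degree 3 *)

(** Colours left for a vertex by a neighbour coloured [a]. *)
Definition F5 A a := mk5 (fun t => ~~ mem5 A (sub5 t a)).

Lemma mem_F5 A a t : mem5 (F5 A a) t = ~~ mem5 A (sub5 t a).
Proof. exact: mem_mk5. Qed.

Lemma mem_cap (A B : s5) t : mem5 (cap5 A B) t = mem5 A t && mem5 B t.
Proof. exact: mem_mk5. Qed.

Lemma card_F5 A a : card5 (F5 A a) + card5 A = 5.
Proof. by case: A => [[] [] [] [] []]; case: a. Qed.

Lemma card_cap A B : card5 A + card5 B <= card5 (cap5 A B) + 5.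
Proof.
have := allsP (f := fun A => alls (fun B => card5 A + card5 B <= card5 (cap5 A B) + 5))
  ltac:(by vm_compute) A.
by move/allsP => /(_ B).
Qed.

Lemma card5_gt0 A : 0 < card5 A -> exists t, mem5 A t.
Proof. by move=> H; apply/ex5P; move: H; case: A => [[] [] [] [] []]. Qed.

(* Differences of two neighbours that leave fewer than two colours in between. *)
Definition N2 A B := mk5 (fun d => card5 (cap5 (F5 A d) (F5 B z0)) < 2).

Lemma N2P A B a b : ~~ mem5 (N2 A B) (sub5 a b) -> 2 <= card5 (cap5 (F5 A a) (F5 B b)).
Proof.
have := allsP (f := fun A => alls (fun B => all5 (fun a => all5 (fun b =>
  ~~ mem5 (N2 A B) (sub5 a b) ==> (2 <= card5 (cap5 (F5 A a) (F5 B b)))))))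
  ltac:(by vm_compute) A.
by move/allsP => /(_ B) /all5P /(_ a) /all5P /(_ b) /implyP.
Qed.

(** The saving 3 is what the count needs: 3 plus the added cost, plus 5 for the vertex put back,
    minus the costs of [A] and [B], is at most 5. *)
Lemma N2_cost A B : cost A <= 4 -> cost B <= 4 -> ~~ empb A -> ~~ empb B ->
  cost (N2 A B) + 3 <= cost A + cost B.
Proof.
have := allsP (f := fun A => alls (fun B =>
  [==> cost A <= 4, cost B <= 4, ~~ empb A, ~~ empb B => cost (N2 A B) + 3 <= cost A + cost B]))
  ltac:(by vm_compute) A.
by move/allsP => /(_ B) H h1 h2 h3 h4; move: H; rewrite h1 h2 h3 h4.
Qed.

Lemma cost2_card A : cost A = 2 -> card5 A = 1.
Proof. by case: A => [[] [] [] [] []]. Qed.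
Lemma cost3_card A : cost A = 3 -> card5 A = 2.
Proof. by case: A => [[] [] [] [] []]. Qed.
Lemma cost_ge2 A : ~~ empb A -> 2 <= cost A.
Proof. by case: A => [[] [] [] [] []]. Qed.
Lemma cost_emp A : empb A = (cost A == 0).
Proof. by case: A => [[] [] [] [] []]. Qed.
Lemma runs_gt0 A : ~~ empb A -> 0 < runs A.
Proof. by case: A => [[] [] [] [] []]. Qed.

Lemma size3 (T : eqType) (s : seq T) : size s = 3 -> exists p q r, s = [:: p; q; r].
Proof. by case: s => [|p [|q [|r []]]] // _; exists p, q, r. Qed.
Lemma size4 (T : eqType) (s : seq T) : size s = 4 -> exists p q r t, s = [:: p; q; r; t].
Proof. by case: s => [|p [|q [|r [|t []]]]] // _; exists p, q, r, t. Qed.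

Section MinCex.
Variables (V : finType) (C : V -> V -> s5).
Hypothesis K : mincex C.
Implicit Types (S W R X : {set V}) (x : V -> z5).
Let sC : sym_inst C. Proof. by case: K. Qed.
Local Notation N := (N C).

Definition c u v := cost (C u v).

Lemma cC u v : c u v = c v u. Proof. exact: wcostC. Qed.
Lemma c0 v : c v v = 0. Proof. exact: (wcost0 sC). Qed.
Lemma cN u v : (v \in N u) = (c u v != 0).
Proof. by rewrite mem_N cost_emp. Qed.

Definition nbs v s := uniq s /\ N v =i s.

Lemma nbs_size v s : nbs v s -> #|N v| = size s.
Proof. by move=> [us e]; rewrite (eq_card e); apply/card_uniqP. Qed.

Lemma nbs_perm v s t : perm_eq s t -> nbs v s -> nbs v t.
Proof.
move=> st [us e]; split; first by rewrite -(perm_uniq st).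
by move=> u; rewrite e (perm_mem st).
Qed.

Lemma card_gt4 : 4 <= #|[set: V]|.
Proof.
have [v _] : exists v : V, v \in [set: V].
  apply/set0Pn; apply/eqP => V0; apply: (uncolT K); exists (fun=> z0) => u w.
  by rewrite V0 inE.
have : #|v |: N v| <= #|[set: V]| by apply: subset_leq_card; apply/subsetP.
by rewrite cardsU1 N_irr //; have := degree_ge3 K v; alia.
Qed.

Lemma ew1 (w : V -> V -> nat) v : ew w [set v] = 0.
Proof. by rewrite /ew big_set1 /= big1 // => u; rewrite !inE => /andP [/eqP ->]; rewrite ltnn. Qed.

Lemma ew2 (w : V -> V -> nat) u v : (forall a b, w a b = w b a) -> u != v ->
  ew w [set u; v] = w u v.
Proof. by move=> wC uv; rewrite ewU1 ?inE //; rewrite ew1 /deg big_set1. Qed.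

Lemma ew3 (w : V -> V -> nat) u v t : (forall a b, w a b = w b a) ->
  u != v -> u != t -> v != t -> ew w [set u; v; t] = w u v + w u t + w v t.
Proof.
move=> wC uv ut vt; rewrite -setUA ewU1 ?inE ?negb_or ?uv // ew2 //.
rewrite degU1 ?inE // /deg big_set1; alia.
Qed.

Lemma e2 u v : u != v -> eC C [set u; v] = c u v.
Proof. by apply: ew2; apply: wcostC. Qed.

Lemma e3 u v w : u != v -> u != w -> v != w -> eC C [set u; v; w] = c u v + c u w + c v w.
Proof. by apply: ew3; apply: wcostC. Qed.

Lemma r3 u v w : u != v -> u != w -> v != w ->
  rC C [set u; v; w] = wruns C u v + wruns C u w + wruns C v w.
Proof. by apply: ew3; apply: wrunsC. Qed.

Lemma card3 (u v w : V) : u != v -> u != w -> v != w -> #|[set u; v; w]| = 3.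
Proof. by move=> uv uw vw; rewrite -setUA cardsU1 !inE negb_or uv uw cards2 vw. Qed.

Lemma small_neT S : #|S| <= 3 -> S <> setT.
Proof. by move=> S3 E; move: card_gt4; rewrite -E; alia. Qed.

Lemma c4 u v : c u v <= 4.
Proof.
case: (eqVneq u v) => [->|uv]; first by rewrite c0.
have := @potential_ge6 _ _ K [set u; v]; rewrite cards2 uv e2 // => /(_ isT) H.
have := H (@small_neT _ _); rewrite cards2 uv /= => /(_ isT); alia.
Qed.

Lemma tri u v w : u != v -> u != w -> v != w -> c u v + c u w + c v w <= 9.
Proof.
move=> uv uw vw; have := @potential_ge6 _ _ K [set u; v; w]; rewrite card3 // e3 // => /(_ isT) H.
have := H (@small_neT _ _); rewrite card3 // => /(_ isT); alia.
Qed.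

Lemma cN2 u v : v \in N u -> 2 <= c u v.
Proof. by rewrite mem_N => /cost_ge2. Qed.

Lemma N_neq u v : v \in N u -> v != u.
Proof. by apply: contraTneq => ->; rewrite N_irr. Qed.

Lemma addv v s W : v \notin W -> uniq s -> {subset s <= W} ->
  #|v |: W| = #|W|.+1 /\ eC C W + \sum_(u <- s) c v u <= eC C (v |: W).
Proof.
move=> vW us sW; rewrite cardsU1 vW; split=> //.
rewrite /eC ewU1 //; last exact: wcostC.
by rewrite leq_add2l; apply: (@deg_seq _ (wcost C)).
Qed.

Lemma trap S : 2 <= #|S| -> 5 * #|S| <= eC C S + 5 -> S = setT.
Proof. by move=> S2 H; apply: NNPP => ST; have := potential_ge6 K S2 ST; alia. Qed.

(** Every vertex has at least three neighbours and every constrained pair at least one run. When few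
    pairs leave [W], this contradicts a bound of [rC C W] below [#|W|] and so discards the second
    alternative of [good]. *)
Lemma whole W : 3 * #|W| <= (rC C W).*2 + cross (wadj C) (~: W) W.
Proof.
have a3 : 3 * #|W| <= (aC C W).*2 + cross (wadj C) W (~: W).
  rewrite /aC -(sum_deg (wadjC sC) (wadj0 sC)) /cross -big_split /= mulnC -sum_nat_const.
  by apply: leq_sum => u _; exact: (aN_ge K).
have ar : aC C W <= rC C W by apply: leq_ew => u v; exact: wadj_runs.
rewrite (crossC (wadjC sC)); alia.
Qed.

Lemma whole1 v W : ~: W = [set v] -> 3 * #|W| <= (rC C W).*2 + #|N v|.
Proof.
move=> E; have := whole W; rewrite E /cross big_set1.
by have := deg_sub (wadj C) v (subsetT W); rewrite -/(aN C v setT) aNT //; alia.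
Qed.

Lemma setUT_C v W : v \notin W -> v |: W = setT -> ~: W = [set v].
Proof.
move=> vW E; apply/setP => u; rewrite !inE; move/setP: E => /(_ u); rewrite !inE.
by case: eqP => [-> _|_ /= ->].
Qed.

Lemma ext_all v s x : nbs v s -> valid C x [set~ v] ->
  (exists t, all (fun u => mem5 (F5 (C v u) (x u)) t) s) -> col C setT.
Proof.
move=> [_ e] xS [t /allP Ht]; exists (upd x v t); rewrite -(setU1C v).
by apply: ext_at => // u _; rewrite e => /Ht; rewrite mem_F5.
Qed.

Lemma notin_C (v : V) W : W \subset [set~ v] -> v \notin W.
Proof. by move/subsetP => H; apply/negP => /H; rewrite !inE eqxx. Qed.

(** The neighbour [r] kills a single colour, so it is enough that [p] and [q] leave two, which [N2]
    on the pair [p, q] ensures. *)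
Lemma deg3_no_cost2 v p q r : nbs v [:: p; q; r] -> c v r = 2 -> False.
Proof.
move=> nv cr; have [uq e] := nv; move: (uq); rewrite /= !inE negb_or andbT => /andP [/andP [pq pr] qr].
have nb u : u \in [:: p; q; r] -> ~~ empb (C v u) /\ u \in [set~ v].
  by rewrite -e => H; split; [rewrite -mem_N|rewrite !inE; apply: N_neq].
have [pN pv] := nb p ltac:(by rewrite inE eqxx).
have [qN qv] := nb q ltac:(by rewrite !inE eqxx orbT).
set M := N2 (C v p) (C v q).
pose l := if empb M then [::] else [:: mdd p q M].
have okL : okl C l by rewrite /l; case: ifP => //= _; split=> //; apply: okm_dd.
have [||W [[WR W2 WT] tW [_ gW]]] := reduce (R := [set~ v]) K okL; first exact: setC1T.
  move=> x xS rx; apply: (ext_all nv xS).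
  have : ~~ mem5 M (sub5 (x p) (x q)).
    move: rx; rewrite /l; case: (boolP (empb M)) => [/empbP -> _|_ /= []]; first by case: (sub5 _ _).
    by rewrite /touched /= pv qv => ->.
  move/N2P => h; have := card_cap (cap5 (F5 (C v p) (x p)) (F5 (C v q) (x q))) (F5 (C v r) (x r)).
  have := card_F5 (C v r) (x r); rewrite (cost2_card cr) => h1 h2.
  have [|t] := @card5_gt0 (cap5 (cap5 (F5 (C v p) (x p)) (F5 (C v q) (x q))) (F5 (C v r) (x r))); first alia.
  by rewrite !mem_cap => /andP [/andP [t1 t2] t3]; exists t; rewrite /= t1 t2 t3.
move: tW gW; rewrite /l; case: (boolP (empb M)) => //= nM.
rewrite !orbF !addn0 => tW; rewrite tW => gW.
have [pW qW] := andP tW; rewrite /= in pW qW.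
have vW := notin_C WR.
have kc := N2_cost (c4 v p) (c4 v q) pN qN; rewrite -/M -!/(c _ _) in kc.
have [cd eW] := @addv v [:: p; q] W vW ltac:(by rewrite /= inE pq)
  ltac:(by move=> u; rewrite !inE => /orP [] /eqP ->).
rewrite !big_cons big_nil in eW.
have VT : v |: W = setT by apply: trap; alia.
have rW : r \in W.
  by move/setP/(_ r): VT; rewrite !inE; case: eqP => // rv; have [_] := nb r ltac:(by rewrite !inE eqxx !orbT); rewrite !inE rv eqxx.
have [_ eW'] := @addv v [:: p; q; r] W vW uq
  ltac:(by move=> u; rewrite !inE => /or3P [] /eqP ->).
rewrite !big_cons big_nil cr in eW'.
have := whole1 (setUT_C vW VT); rewrite (nbs_size nv) /= => wh.
have := runs_gt0 nM => rM.
apply: (not_good K); rewrite -VT; move: gW; rewrite cd.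
have := card_gt4; rewrite -VT cd; alia.
Qed.

End MinCex.

(** * Vertices of type (2,2,2,3) *)

Lemma sub5_addl t y x : sub5 (add5 t y) x = sub5 t (sub5 x y).
Proof. by case: t; case: y; case: x. Qed.

(** Three differences [d] make the arcs forbidden by [x1] and [x2] overlap, and [D] forbids only
    two, so one of the three is available; the bound 5 expresses that [d] is not in [D]. The two
    arcs then leave an arc of two or three colours, and the arc forbidden by [y] covers it in at
    most one position. *)
Lemma D_triangle_table A1 A2 B D : cost A1 = 3 -> cost A2 = 3 -> cost B = 3 -> cost D = 3 ->
  exists d e, [/\ cost (cup5 D (cpl5 (one5 d))) <= 5, runs D <= runs (cup5 D (cpl5 (one5 d)))
   & forall x1 x2 y, sub5 x1 x2 = d -> sub5 y x2 <> e ->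
     exists t, [&& mem5 (F5 A1 x1) t, mem5 (F5 A2 x2) t & mem5 (F5 B y) t]].
Proof.
have := allsP (f := fun A1 => (cost A1 == 3) =>> alls (fun A2 => (cost A2 == 3) =>>
  alls (fun B => (cost B == 3) =>> alls (fun D => (cost D == 3) =>>
  ex5 (fun d => [&& cost (cup5 D (cpl5 (one5 d))) <= 5,
    runs D <= runs (cup5 D (cpl5 (one5 d))) &
    ex5 (fun e => all5 (fun y => eq5 y e || ex5 (fun t =>
     [&& mem5 (F5 A1 d) t, mem5 (F5 A2 z0) t & mem5 (F5 B y) t])))])))))
  ltac:(by vm_compute) A1.
move=> H h1 h2 h3 h4; move: H; rewrite h1 eqxx => /allsP /(_ A2); rewrite h2 eqxx.
move=> /allsP /(_ B); rewrite h3 eqxx => /allsP /(_ D); rewrite h4 eqxx.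
case/ex5P => d /and3P [D1 D2 /ex5P [e /all5P He]]; exists d, e; split=> // x1 x2 y xd ye.
have := He (sub5 y x2); case: eq5P => //= _ /ex5P [t]; rewrite -xd !mem_F5 => Ht.
by exists (add5 t x2); rewrite !mem_F5 !sub5_addl; move: Ht; case: (x2).
Qed.

(* [A] and [B] being the constraints from a vertex to two neighbours: the
   differences of these for which the first kills a value left by the second. *)
Definition kset A B := mk5 (fun d => ex5 (fun t => mem5 A (sub5 t d) && ~~ mem5 B t)).

Lemma one5P d e : ~~ mem5 (one5 d) e -> e <> d.
Proof. by move=> + ed; rewrite ed; case: d {ed}. Qed.

Lemma cost_one d : cost (one5 d) = 2. Proof. by case: d. Qed.
Lemma runs_one d : runs (one5 d) = 1. Proof. by case: d. Qed.

(** [y] leaves three colours; the first neighbour kills none of them, the two others at most one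
    each. *)
Lemma kill_cover A1 A2 A3 B x1 x2 x3 y : cost A1 = 2 -> cost A2 = 2 -> cost A3 = 2 -> cost B = 3 ->
  ~~ mem5 (kset A1 B) (sub5 x1 y) ->
  exists t, [&& mem5 (F5 A1 x1) t, mem5 (F5 A2 x2) t, mem5 (F5 A3 x3) t & mem5 (F5 B y) t].
Proof.
move=> c1 c2 c3 cB; rewrite mem_mk5 => /ex5P Hk.
have h2 := card_F5 A2 x2; have h3 := card_F5 A3 x3; have hB := card_F5 B y.
have k1 := card_cap (F5 A2 x2) (F5 A3 x3).
have k2 := card_cap (cap5 (F5 A2 x2) (F5 A3 x3)) (F5 B y).
rewrite (cost2_card c2) in h2; rewrite (cost2_card c3) in h3; rewrite (cost3_card cB) in hB.
have [|t] := @card5_gt0 (cap5 (cap5 (F5 A2 x2) (F5 A3 x3)) (F5 B y)); first alia.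
rewrite !mem_cap => /andP [/andP [t2 t3] tB]; exists t; rewrite t2 t3 tB !andbT.
rewrite mem_F5; apply/negP => t1; apply: Hk; exists (sub5 t y).
by rewrite sub5BB t1 -mem_F5.
Qed.

Lemma kset_cost A B : cost A = 2 -> cost B = 3 -> cost (kset A B) = 4 /\ runs (kset A B) = 1.
Proof.
have := allsP (f := fun A => alls (fun B => (cost A == 2) =>> (cost B == 3) =>>
  (cost (kset A B) == 4) && (runs (kset A B) == 1))) ltac:(by vm_compute) A.
by move/allsP => /(_ B) H h1 h2; move: H; rewrite h1 h2 !eqxx /= => /andP [/eqP -> /eqP ->].
Qed.

(** For [B] of cost 3: an allowed difference next to the forbidden arc, as opposed to the middle one
    of the three. *)
Definition extreme B e := ~~ mem5 B e && (cost (cup5 B (one5 e)) == 4).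

Lemma extreme_ex B : cost B = 3 -> exists e, extreme B e.
Proof.
by move=> h; apply/ex5P; move: h; case: B => [[] [] [] [] []].
Qed.

Lemma one_value A e : cost A = 2 -> exists f, forall d, d <> f -> ~~ mem5 A (sub5 e d).
Proof.
have := allsP (f := fun A => (cost A == 2) =>> all5 (fun e => ex5 (fun f => all5 (fun d =>
  eq5 d f || ~~ mem5 A (sub5 e d))))) ltac:(by vm_compute) A.
move=> H h; move: H; rewrite h eqxx => /all5P /(_ e) /ex5P [f /all5P H]; exists f => d df.
by have := H d; case: eq5P.
Qed.

(** An increase by 4 forces [D] to be the arc complementary to [kset A B]. Of the three differences
    still allowed, one kills [e]; as [e] is extreme, that one is adjacent to the arc [D], so
    forbidding it costs 1. *)
Lemma kill_pair_table A B D e : cost A = 2 -> cost B = 3 -> extreme B e -> cost D <= 4 ->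
  cost D + 4 <= cost (cup5 D (kset A B)) -> ~~ empb D ->
  exists M, [/\ cost (cup5 D M) <= cost D + 1, runs D <= runs (cup5 D M) &
    forall d, ~~ mem5 D d -> ~~ mem5 M d -> ~~ mem5 A (sub5 e d)].
Proof.
have := allsP (f := fun A => (cost A == 2) =>> alls (fun B => (cost B == 3) =>>
  all5 (fun e => extreme B e =>> alls (fun D => [==> cost D <= 4,
   cost D + 4 <= cost (cup5 D (kset A B)), ~~ empb D =>
   ex5 (fun m => [&& cost (cup5 D (one5 m)) <= cost D + 1, runs D <= runs (cup5 D (one5 m)) &
    all5 (fun d => [==> ~~ mem5 D d, ~~ eq5 m d => ~~ mem5 A (sub5 e d)])])]))))
  ltac:(by vm_compute) A.
move=> H h1 h2 h3 h4 h5 h6; move: H; rewrite h1 eqxx => /allsP /(_ B).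
rewrite h2 eqxx => /all5P /(_ e); rewrite h3 => /allsP /(_ D); rewrite h4 h5 h6.
case/ex5P => m /and3P [m1 m2 /all5P H]; exists (one5 m); split=> // d d1 d2.
by move: (H d); rewrite d1; move: d2; rewrite mem_mk5 => ->.
Qed.

(** The sums of allowed differences form an arc of three, hence all of [kset A B]. The sum that
    kills [e] is an end of this arc and is attained by only one of the two values that [D1] allows;
    forbidding this value costs 1. *)
Lemma kill_path_table A B D1 D2 e : cost A = 2 -> cost B = 3 -> extreme B e ->
  cost D1 = 4 -> runs D1 = 1 -> cost D2 = 4 -> runs D2 = 1 ->
  (forall d1 d2, ~~ mem5 D1 d1 -> ~~ mem5 D2 d2 -> mem5 (kset A B) (add5 d1 d2)) ->
  exists M, [/\ cost (cup5 D1 M) <= cost D1 + 1, runs D1 <= runs (cup5 D1 M) &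
    forall d1 d2, ~~ mem5 D1 d1 -> ~~ mem5 M d1 -> ~~ mem5 D2 d2 ->
      ~~ mem5 A (sub5 e (add5 d1 d2))].
Proof.
have := allsP (f := fun A => (cost A == 2) =>> alls (fun B => (cost B == 3) =>>
  all5 (fun e => extreme B e =>> alls (fun D1 => (cost D1 == 4) && (runs D1 == 1) =>>
  alls (fun D2 => (cost D2 == 4) && (runs D2 == 1) =>>
   all5 (fun d1 => all5 (fun d2 => [==> ~~ mem5 D1 d1, ~~ mem5 D2 d2 => mem5 (kset A B) (add5 d1 d2)])) =>>
   ex5 (fun m => [&& cost (cup5 D1 (one5 m)) <= cost D1 + 1, runs D1 <= runs (cup5 D1 (one5 m)) &
    all5 (fun d1 => all5 (fun d2 => [==> ~~ mem5 D1 d1, ~~ eq5 m d1, ~~ mem5 D2 d2 =>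
       ~~ mem5 A (sub5 e (add5 d1 d2))]))]))))))
  ltac:(by vm_compute) A.
move=> H h1 h2 h3 h4 h4' h5 h5' h6; move: H; rewrite h1 eqxx => /allsP /(_ B).
rewrite h2 eqxx => /all5P /(_ e); rewrite h3 => /allsP /(_ D1); rewrite h4 h4' !eqxx.
move=> /allsP /(_ D2); rewrite h5 h5' !eqxx /= => H.
have H0 : all5 (fun d1 => all5 (fun d2 => [==> ~~ mem5 D1 d1, ~~ mem5 D2 d2 => mem5 (kset A B) (add5 d1 d2)])).
  by apply/all5P => d1; apply/all5P => d2; apply/implyP => k1; apply/implyP; exact: h6.
rewrite H0 in H; case/ex5P: H => m /and3P [m1 m2 /all5P H'].
exists (one5 m); split=> // d1 d2 k1 k2 k3.
by have /all5P /(_ d2) := H' d1; rewrite k1 k3; move: k2; rewrite mem_mk5 => ->.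
Qed.

Lemma e5cup A : cup5 emp5 A = A.
Proof. by case: A. Qed.

Lemma cost_le_runs A : cost A <= 4 -> cost A <= 4 * runs A.
Proof. by case: A => [[] [] [] [] []]. Qed.

Section MinCex.
Variables (V : finType) (C : V -> V -> s5).
Hypothesis K : mincex C.
Implicit Types (S W R X : {set V}) (x : V -> z5).
Let sC : sym_inst C. Proof. by case: K. Qed.
Local Notation N := (N C).
Local Notation c := (c C).
Local Notation nbs := (nbs C).

Lemma nbs_in v s u : nbs v s -> u \in s -> (~~ empb (C v u)) * (u \in [set~ v]).
Proof. by move=> [_ e]; rewrite -e => H; split; [rewrite -mem_N|rewrite !inE; apply: (N_neq K)]. Qed.

Lemma nbs_card v s : nbs v s -> size s < #|[set: V]|.
Proof.
move=> h; have : #|v |: N v| <= #|[set: V]| by apply: subset_leq_card; apply/subsetP.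
by rewrite cardsU1 (N_irr K) //= (nbs_size h).
Qed.

Lemma sub_list (s : seq V) W : all (mem W) s -> {subset s <= W}.
Proof. by move/allP. Qed.

Lemma addv_whole v s W : nbs v s -> W \subset [set~ v] -> v |: W = setT ->
  [/\ #|[set: V]| = #|W|.+1, eC C W + \sum_(u <- s) c v u <= eC C setT &
     3 * #|W| <= (rC C W).*2 + size s].
Proof.
move=> nv WR VT; have vW := notin_C WR.
have [us e] := nv.
have [|c1 e1] := addv K vW us.
  move=> u us'; move/setP/(_ u): VT; rewrite !inE; case: eqP => // uv.
  by have [_] := nbs_in nv us'; rewrite !inE uv eqxx.
rewrite VT in c1 e1; split=> //.
by have := whole1 K (setUT_C vW VT); rewrite (nbs_size nv).
Qed.

(** The pair [p, q] already costs 3, so fixing its difference adds only 2; the difference forbidden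
    at [r, q] adds 2 more. With [v] back the potential is at most 3 + 4 + 5 - 9 = 3, and the runs
    exclude equality. *)
Lemma D_no_triangle v p q r : nbs v [:: p; q; r] -> c v p = 3 -> c v q = 3 -> c v r = 3 ->
  c p q = 3 -> False.
Proof.
move=> nv cp cq cr cpq; have [uq e] := nv.
move: (uq); rewrite /= !inE negb_or andbT => /andP [/andP [pq pr] qr].
have [_ pv] := nbs_in nv (u := p) ltac:(by rewrite !inE eqxx ?orbT).
have [_ qv] := nbs_in nv (u := q) ltac:(by rewrite !inE eqxx ?orbT).
have [_ rv] := nbs_in nv (u := r) ltac:(by rewrite !inE eqxx ?orbT).
have [d [f [t1 t2 t3]]] := D_triangle_table cp cq cr cpq.
pose l := [:: Md p q (cpl5 (one5 d)) 2 0; mdd r q (one5 f)].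
have okL : okl C l.
  split; last by split=> //; apply: okm_dd; rewrite eq_sym.
  rewrite /okm /= addp_other /=; last first.
    apply/eqP => /setP /(_ p); rewrite !inE eqxx (negPf pq) (negPf pr) //.
  by split=> //; rewrite -/(c p q) cpq /= addn0; split=> //; right.
have [||W [[WR W2 WT] tW [_ gW]]] := reduce (R := [set~ v]) K okL; first exact: setC1T.
  move=> x xS; rewrite /= /touched /= pv qv rv => [[/(_ isT) r1 [/(_ isT) /one5P r2 _]]].
  apply: (ext_all K nv xS); have [|t Ht] := t3 (x p) (x q) (x r) _ r2.
    by move: r1; rewrite mem_mk5 negbK mem_mk5 => /eq5P.
  by exists t; rewrite /= andbT.
have vW := notin_C WR.
move: gW; rewrite /= /touched /= cost_one runs_one !addn0.
have T := @trap _ _ K W W2; have {}T : ~ (5 * #|W| <= eC C W + 5) by move=> H; apply: WT; apply: T.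
case: (boolP ((p \in W) && _)) => [/andP [pW qW]|_]; last by case: ifP => _ ; alia.
rewrite qW andbT; case: ifP => [rW|_]; last by alia.
move=> gW.
have [|c1 e1] := @addv _ _ K v [:: p; q; r] W vW uq; first by apply: sub_list; rewrite /= pW qW rW.
rewrite !big_cons big_nil cp cq cr in e1.
have VT : v |: W = setT by apply: (trap K); alia.
have [c2 e2' wh] := addv_whole nv WR VT; have n3 := nbs_card nv.
rewrite !big_cons big_nil cp cq cr /= in e2' wh n3.
apply: (not_good K); alia.
Qed.

(* One more unit of cost at [a] prevents [a] from killing the value [x d + e] of [v]. *)
Definition forb v e a d (bad : seq V) := exists w M, [/\ a != w, w \notin v :: bad,
  cost (cup5 (C a w) M) <= c a w + 1, runs (C a w) <= runs (cup5 (C a w) M) &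
  forall x, valid C x [set~ v] -> ~~ mem5 M (sub5 (x a) (x w)) ->
    ~~ mem5 (C v a) (sub5 e (sub5 (x a) (x d)))].

(** Preventing [a] from killing any colour left by [d] costs 4 and gives [W] of potential at most 7.
    Neither [b] nor [g] lies in [W], as adding [v] would then reach 5. Potential exactly 7 means
    that merging saved nothing: either the pair [a, d] already carries the complementary arc, or [W]
    is a triangle through a third vertex [w], and a single unit protects the extreme colour. *)
Lemma kill_alternative v a b g d e : nbs v [:: a; b; g; d] ->
  c v a = 2 -> c v b = 2 -> c v g = 2 -> c v d = 3 -> extreme (C v d) e ->
  (exists W, [/\ W \subset [set~ v], 5 * #|W| <= eC C W + 6, a \in W, d \in W &
     (b \notin W) && (g \notin W)]) \/ forb v e a d [:: b; g].
Proof.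
move=> nv ca cb cg cd ext_e; have [uq _] := nv.
move: (uq); rewrite /= !inE !negb_or andbT => /and3P [/and3P [ab ag ad] /andP [bg bd] gd].
have [_ av] := nbs_in nv (u := a) ltac:(by rewrite !inE eqxx ?orbT).
have [_ dv] := nbs_in nv (u := d) ltac:(by rewrite !inE eqxx ?orbT).
set M := kset (C v a) (C v d); have [kM rM] := kset_cost ca cd; rewrite -/M in kM rM.
pose l := [:: mdd a d M].
have okL : okl C l by split=> //; apply: okm_dd.
have [||W [[WR W2 WT] tW [cW gW]]] := reduce (R := [set~ v]) K okL; first exact: setC1T.
  move=> x xS; rewrite /= /touched /= av dv => [[/(_ isT) r1 _]].
  have [t Ht] := kill_cover (x b) (x g) ca cb cg cd r1.
  by apply: (ext_all K nv xS); exists t; rewrite /= andbT.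
move: (tW) gW; rewrite /= orbF => {}tW; rewrite tW !addn0 kM rM => gW.
have [aW dW] := andP tW; rewrite /= in aW dW.
have vW := notin_C WR.
have no s : uniq s -> all (mem W) s -> \sum_(u <- s) c v u = 7 -> False.
  move=> us sW s7; have [|c1 e1] := addv K vW us; first exact: sub_list.
  have VT : v |: W = setT by apply: (trap K); alia.
  have [c2 e2' wh] := addv_whole nv WR VT; have n3 := nbs_card nv.
  rewrite !big_cons big_nil ca cb cg cd /= in e2' wh n3.
  apply: (not_good K); alia.
have bW : b \notin W.
  apply/negP => bW; apply: (no [:: a; b; d]); first by rewrite /= !inE negb_or ab ad bd.
    by rewrite /= aW bW dW.
  by rewrite !big_cons big_nil ca cb cd.
have gW' : g \notin W.
  apply/negP => gW'; apply: (no [:: a; g; d]); first by rewrite /= !inE negb_or ag ad gd.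
    by rewrite /= aW gW' dW.
  by rewrite !big_cons big_nil ca cg cd.
case: (leqP (5 * #|W|) (eC C W + 6)) => P6.
  by left; exists W; split=> //; rewrite bW gW'.
right.
have sL := addl_sym sC okL.
have GW : good (addl C l) W by case: K => _ IH _ _; apply: IH.
have okM := proj1 okL; have pq := proj1 okM.
have E1 := ew_pair (wcostC sC) (wcostC sL) ad (fun u v H => congr1 cost (addp_other C (m := mdd a d M) H)) aW dW.
rewrite /wcost [addl C l a d]addp_pq /= in E1; rewrite -/(eC C W) -/(wcost C) -/(wcost (addl C l)) -/(eC C W) -/(eC (addl C l) W) in E1.
have [k1 _] := proj2 okM; rewrite /= kM in k1.
have Ek : cost (cup5 (C a d) M) = c a d + 4.
  move: GW E1 k1; rewrite /good /c -!/(eC _ _); alia.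
case: (boolP (empb (C a d))) => [eD|nD]; last first.
  have [|M' [m1 m2 m3]] := kill_pair_table ca cd ext_e (c4 K a d) _ nD; first by rewrite -/M Ek.
  exists d, M'; split=> //.
    by rewrite !inE !negb_or; move: dv; rewrite !inE => ->; rewrite eq_sym bd eq_sym gd.
  by move=> x xS; apply: m3; apply: xS.
have Cad : forall u w, cost (addl C l u w) <= 4 * runs (addl C l u w).
  move=> u w; rewrite /= /addp /=.
  have H0 : forall u w, cost (C u w) <= 4 * runs (C u w) by move=> u' w'; apply: cost_le_runs; apply: (c4 K).
  case: ifP => [/andP [/eqP -> /eqP ->]|_]; first by rewrite (empbP eD) e5cup kM rM.
  case: ifP => [/andP [/eqP -> /eqP ->]|_]; last exact: H0.
  by rewrite (proj1 sC d a) -neg5U cost_neg runs_neg (empbP eD) e5cup kM rM.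
have E4 : eC (addl C l) W <= 4 * rC (addl C l) W.
  rewrite /eC /rC /ew big_distrr /=; apply: leq_sum => u _; rewrite big_distrr /=.
  by apply: leq_sum => w _; apply: Cad.
have W3 : 0 < #|W :\ a :\ d|.
  rewrite lt0n; apply/negP => /eqP W0.
  have EW : W = [set a; d].
    apply/setP => u; rewrite !inE; case: (eqVneq u a) => [->|ua] //=; case: (eqVneq u d) => [->|ud] //=.
    by move/eqP: W0; rewrite cards_eq0 => /eqP /setP /(_ u); rewrite !inE ua ud.
  by move: eD P6 gW; rewrite cost_emp -/(c a d) EW e2 // cards2 ad => /eqP -> /=; alia.
have [w] := card_gt0P W3; rewrite !inE => /and3P [wd wa wW].
have aw : a != w by rewrite eq_sym.
(* Potential 7 leaves only the second alternative of [good]; as each pair costs at most four times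
   its runs, [5 * #|W| <= 4 * #|W| + 3]. *)
have EW : W = [set a; w; d].
  apply/eqP; rewrite eq_sym eqEcard; apply/andP; split.
    by apply/subsetP => u; rewrite !inE => /orP [/orP []|] /eqP ->.
  rewrite card3 //; move: E4 GW P6 E1 Ek; rewrite /good; alia.
have wcad : cost (addl C l a d) = 4 /\ runs (addl C l a d) = 1.
  by rewrite /= addp_pq /= (empbP eD) e5cup.
have oth u : addl C l w u = C w u.
  rewrite /= addp_other //; apply/eqP => /setP /(_ w).
  by rewrite !inE eqxx (negPf wa) (negPf wd).
have X1 := oth a; have X2 := oth d.
have X3 : addl C l a w = C a w by rewrite (proj1 sL) X1 -(proj1 sC).
have EE : eC (addl C l) W = c a w + 4 + c w d.
  rewrite EW -setUA /eC ewU1 ?inE ?negb_or ?aw ?ad //; last exact: wcostC.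
  rewrite degU1 ?inE // ewU1 ?inE //; last exact: wcostC.
  rewrite ew1 /deg !big_set1 /wcost X2 X3 (proj1 wcad) /c; alia.
have RR : rC (addl C l) W = runs (C a w) + 1 + runs (C w d).
  rewrite EW -setUA /rC ewU1 ?inE ?negb_or ?aw ?ad //; last exact: wrunsC.
  rewrite degU1 ?inE // ewU1 ?inE //; last exact: wrunsC.
  rewrite ew1 /deg !big_set1 /wruns X2 X3 (proj2 wcad); alia.
have cW3 : #|W| = 3 by rewrite EW card3.
have [[D1 r1] [D2 r2]] : (cost (C a w) = 4 /\ runs (C a w) = 1) /\ (cost (C w d) = 4 /\ runs (C w d) = 1).
  have := c4 K a w; have := c4 K w d; have := cost_le_runs (c4 K a w); have := cost_le_runs (c4 K w d).
  move: GW P6 E1 Ek; rewrite /good EE RR cW3 /c; alia.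
have [d1 d2 h1 h2|M' [m1 m2 m3]] := kill_path_table ca cd ext_e D1 r1 D2 r2.
  apply: contraT => h3; case: cW => nc _; case: nc.
  pose x u := if u == a then add5 d1 d2 else if u == w then d2 else z0.
  have s0 : forall y, sub5 y z0 = y by case.
  have xa : x a = add5 d1 d2 by rewrite /x eqxx.
  have xw : x w = d2 by rewrite /x eqxx (negPf wa).
  have xd : x d = z0 by rewrite /x eq_sym (negPf ad) eq_sym (negPf wd).
  have V1 : ~~ mem5 (addl C l a w) (sub5 (x a) (x w)) by rewrite X3 xa xw add5K.
  have V2 : ~~ mem5 (addl C l w d) (sub5 (x w) (x d)) by rewrite X2 xw xd s0.
  have V3 : ~~ mem5 (addl C l a d) (sub5 (x a) (x d)).
    by rewrite xa xd s0 /= addp_pq mem_cup negb_or h3 (empbP eD); case: (add5 _ _).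
  have V4 u u' : ~~ mem5 (addl C l u u') (sub5 (x u) (x u')) -> ~~ mem5 (addl C l u' u) (sub5 (x u') (x u)).
    by rewrite [addl C l u' u](proj1 sL) mem_neg.
  have V5 u : ~~ mem5 (addl C l u u) (sub5 (x u) (x u)) by rewrite (proj2 sL); case: (sub5 _ _).
  exists x => u u'; rewrite EW !inE => /orP [/orP []|] /eqP -> /orP [/orP []|] /eqP -> //; exact: V4.
exists w, M'; split=> //.
- rewrite !inE !negb_or; apply/and3P; split; [| |].
  + by apply: contraNneq vW => <-.
  + by apply: contraNneq bW => <-.
  + by apply: contraNneq gW' => <-.
move=> x xS m; rewrite -(add5B (x a) (x w) (x d)); apply: m3 => //; apply: xS => //.
  by rewrite !inE; apply: contraNneq vW => <-.
by rewrite !inE; apply: contraNneq vW => <-.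
Qed.

(** The intersection contains [d] and has potential at least 5, so by submodularity the union has at
    most 12 - 5 = 7. Adding [v] with costs 2, 2, 3 reaches 5, yet [g] is outside. *)
Lemma kill_two_loose v a b g d : nbs v [:: a; b; g; d] ->
  c v a = 2 -> c v b = 2 -> c v g = 2 -> c v d = 3 ->
  forall W1 W2, W1 \subset [set~ v] -> 5 * #|W1| <= eC C W1 + 6 ->
  W2 \subset [set~ v] -> 5 * #|W2| <= eC C W2 + 6 ->
  a \in W1 -> d \in W1 -> b \in W2 -> d \in W2 -> g \notin W1 -> g \notin W2 -> False.
Proof.
move=> nv ca cb cg cd W1 W2 R1 P1 R2 P2 aW dW bW dW' g1 g2.
have [uq _] := nv.
move: (uq); rewrite /= !inE !negb_or andbT => /and3P [/and3P [ab ag ad] /andP [bg bd] gd].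
have sm := ew_submod (wcostC sC) W1 W2; rewrite -!/(eC _ _) in sm.
have cU := cardsUI W1 W2.
have vW : v \notin W1 :|: W2.
  by rewrite !inE negb_or (notin_C R1) (notin_C R2).
have [||c1 e1] := @addv _ _ K v [:: a; b; d] _ vW.
- by rewrite /= !inE negb_or ab ad bd.
- by apply: sub_list; rewrite /= !inE aW bW dW orbT.
rewrite !big_cons big_nil ca cb cd in e1.
have dI : d \in W1 :&: W2 by rewrite inE dW dW'.
have I1 : 5 * #|W1 :&: W2| >= eC C (W1 :&: W2) + 5.
  case: (ltnP 1 #|W1 :&: W2|) => I2.
    have IT : W1 :&: W2 <> setT by move/setP/(_ v); rewrite !inE (negPf (notin_C R1)).
    have := potential_ge6 K I2 IT; alia.
  have -> : W1 :&: W2 = [set d].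
    apply/eqP; rewrite eq_sym eqEcard sub1set dI cards1 //.
  by rewrite cards1 /eC ew1.
have VT : v |: (W1 :|: W2) = setT.
  apply: (trap K); first by rewrite c1; move: (cardsD1 d (W1 :|: W2)); rewrite inE dW; alia.
  rewrite c1; alia.
move/setP/(_ g): VT; rewrite !inE (negPf g1) (negPf g2) !orbF => /eqP gv.
by have [_] := nbs_in nv (u := g) ltac:(by rewrite !inE eqxx ?orbT); rewrite !inE gv eqxx.
Qed.

(** One unit each at [a] and [b], and two for a single difference at [g, d], keep the colour
    [x d + e] of [v] alive. *)
Lemma kill_two_forced v a b g d e : nbs v [:: a; b; g; d] ->
  c v a = 2 -> c v b = 2 -> c v g = 2 -> c v d = 3 -> extreme (C v d) e ->
  forb v e a d [:: b; g] -> forb v e b d [:: a; g] -> False.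
Proof.
move=> nv ca cb cg cd /andP [ext_e _] [wa [Ma [awa wabad a1 a2 a3]]] [wb [Mb [bwb wbbad b1 b2 b3]]].
have [uq _] := nv.
move: (uq); rewrite /= !inE !negb_or andbT => /and3P [/and3P [ab ag ad] /andP [bg bd] gd].
have [_ av] := nbs_in nv (u := a) ltac:(by rewrite !inE eqxx ?orbT).
have [_ bv] := nbs_in nv (u := b) ltac:(by rewrite !inE eqxx ?orbT).
have [_ gv] := nbs_in nv (u := g) ltac:(by rewrite !inE eqxx ?orbT).
have [_ dv] := nbs_in nv (u := d) ltac:(by rewrite !inE eqxx ?orbT).
move: wabad wbbad; rewrite !inE !negb_or => /and3P [wav wab wag] /and3P [wbv wba wbg].
have [f Hf] := one_value e cg.
pose l := [:: Md a wa Ma 1 0; Md b wb Mb 1 0; mdd g d (one5 f)].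
(* The pairs must be distinct, because the single units are counted relative to [C]; for the first
   two pairs the lists [bad] in [forb] provide this. *)
have okL : okl C l.
  split; last split; last by split=> //; apply: okm_dd.
    rewrite /okm /= !addp_other /=; first by split=> //; rewrite addn0; split=> //; right.
      by apply/eqP => /setP /(_ a); rewrite !inE eqxx (negPf ag) (negPf ad).
    by apply/eqP => /setP /(_ a); rewrite !inE eqxx (negPf ab) [a == wb]eq_sym (negPf wba).
  rewrite /okm /= !addp_other /=; first by split=> //; rewrite addn0; split=> //; right.
  by apply/eqP => /setP /(_ b); rewrite !inE eqxx (negPf bg) (negPf bd).
have [||W [[WR W2 WT] tW [_ gW]]] := reduce (R := [set~ v]) K okL; first exact: setC1T.
  move=> x xS; rewrite /= /touched /= av bv gv dv !inE wav wbv => [[/(_ isT) r1 [/(_ isT) r2 [/(_ isT) /one5P r3 _]]]].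
  apply: (ext_all K nv xS); exists (add5 e (x d)).
  by rewrite /= !mem_F5 add5K ext_e !sub5_addl a3 // b3 // Hf.
have vW := notin_C WR.
move: gW; rewrite /= /touched /= cost_one runs_one !addn0.
have T := @trap _ _ K W W2; have {}T : ~ (5 * #|W| <= eC C W + 5) by move=> H; apply: WT; apply: T.
case: (boolP ((g \in W) && _)) => [/andP [gW dW]|_]; last by do 2![case: ifP => _]; alia.
have no k s : uniq s -> all (mem W) s -> 7 <= \sum_(u <- s) c v u -> k <= 4 ->
  5 * #|W| + 1 <= eC C W + k + 3 \/ 5 * #|W| <= eC C W + k + 3 /\ rC C W + 1 <= #|W| -> False.
  move=> us sW s7 k4 gW'; have [|c1 e1] := addv K vW us; first exact: sub_list.
  have VT : v |: W = setT by apply: (trap K); alia.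
  have [c2 e2' wh] := addv_whole nv WR VT; have n3 := nbs_card nv.
  rewrite !big_cons big_nil ca cb cg cd /= in e2' wh n3.
  apply: (not_good K); alia.
case: (boolP ((a \in W) && _)) => [/andP [aW _]|_].
  have Hu : uniq [:: a; g; d] by rewrite /= !inE negb_or ag ad gd.
  have Hm : all (mem W) [:: a; g; d] by rewrite /= aW gW dW.
  have H7 : 7 <= \sum_(u <- [:: a; g; d]) c v u by rewrite !big_cons big_nil ca cg cd.
  by case: ifP => _ H; apply: (no _ _ Hu Hm H7 _ H).
case: (boolP ((b \in W) && _)) => [/andP [bW _]|_]; last by alia.
have Hu : uniq [:: b; g; d] by rewrite /= !inE negb_or bg bd gd.
have Hm : all (mem W) [:: b; g; d] by rewrite /= bW gW dW.
have H7 : 7 <= \sum_(u <- [:: b; g; d]) c v u by rewrite !big_cons big_nil cb cg cd.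
by move=> H; apply: (no _ _ Hu Hm H7 _ H).
Qed.

Lemma forb_swap v e a d b g : forb v e a d [:: b; g] -> forb v e a d [:: g; b].
Proof.
move=> [w [M [h1 h2 h3 h4 h5]]]; exists w, M; split=> //.
by move: h2; rewrite !inE !negb_or => /and3P [-> -> ->].
Qed.

(** Two of the three neighbours of cost 2 fall under the same alternative. *)
Lemma no_2223 v a b g d : nbs v [:: a; b; g; d] ->
  c v a = 2 -> c v b = 2 -> c v g = 2 -> c v d = 3 -> False.
Proof.
move=> nv ca cb cg cd.
have [e ee] := extreme_ex cd.
have n1 : nbs v [:: b; a; g; d].
  by apply: nbs_perm nv; rewrite -[X in perm_eq _ X]/([:: b; a] ++ [:: g; d]) -[[:: a; b; g; d]]/([:: a; b] ++ [:: g; d]) perm_cat2r (perm_catC [:: a] [:: b]).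
have n2 : nbs v [:: g; a; b; d].
  by apply: nbs_perm nv; rewrite -[X in perm_eq _ X]/(([:: g] ++ [:: a; b]) ++ [:: d]) -[[:: a; b; g; d]]/(([:: a; b] ++ [:: g]) ++ [:: d]) perm_cat2r (perm_catC [:: a; b] [:: g]).
have n3 : nbs v [:: a; g; b; d].
  by apply: nbs_perm nv; rewrite /= perm_cons -[X in perm_eq _ X]/(([:: g] ++ [:: b]) ++ [:: d]) -[[:: b; g; d]]/(([:: b] ++ [:: g]) ++ [:: d]) perm_cat2r (perm_catC [:: b] [:: g]).
have n4 : nbs v [:: b; g; a; d].
  by apply: nbs_perm n1; rewrite /= perm_cons -[X in perm_eq _ X]/(([:: g] ++ [:: a]) ++ [:: d]) -[[:: a; g; d]]/(([:: a] ++ [:: g]) ++ [:: d]) perm_cat2r (perm_catC [:: a] [:: g]).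
case: (kill_alternative nv ca cb cg cd ee) => [[W1 [? ? ? ? /andP [? ?]]]|fa];
case: (kill_alternative n1 cb ca cg cd ee) => [[W2 [? ? ? ? /andP [? ?]]]|fb];
case: (kill_alternative n2 cg ca cb cd ee) => [[W3 [? ? ? ? /andP [? ?]]]|fg].
- by apply: (kill_two_loose nv ca cb cg cd (W1 := W1) (W2 := W2)).
- by apply: (kill_two_loose nv ca cb cg cd (W1 := W1) (W2 := W2)).
- by apply: (kill_two_loose n3 ca cg cb cd (W1 := W1) (W2 := W3)).
- by apply: (kill_two_forced n4 cb cg ca cd ee (forb_swap fb) (forb_swap fg)).
- by apply: (kill_two_loose n4 cb cg ca cd (W1 := W2) (W2 := W3)).
- by apply: (kill_two_forced n3 ca cg cb cd ee (forb_swap fa) fg).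
- by apply: (kill_two_forced nv ca cb cg cd ee fa fb).
- by apply: (kill_two_forced nv ca cb cg cd ee fa fb).
Qed.

End MinCex.

(** * Light neighbours of a vertex of type D *)

Definition AA A B p q := cap5 (F5 A p) (F5 B q).
(* Colours compatible, through [D], with some colour of [A]. *)
Definition M5 A D := mk5 (fun t => ex5 (fun s => mem5 A s && ~~ mem5 D (sub5 s t))).

Lemma M5P A D t : mem5 (M5 A D) t -> exists2 s, mem5 A s & ~~ mem5 D (sub5 s t).
Proof. by rewrite mem_mk5 => /ex5P [s /andP [? ?]]; exists s. Qed.

(** Each colour of [A] excludes an arc of two, and two distinct such arcs share at most one
    colour. *)
Lemma M5_card A D : cost D = 3 -> 0 < card5 A ->
  3 <= card5 (M5 A D) /\ (2 <= card5 A -> 4 <= card5 (M5 A D)).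
Proof.
have := allsP (f := fun A => alls (fun D => cost D == 3 =>> 0 < card5 A =>>
   (3 <= card5 (M5 A D)) && (2 <= card5 A =>> 4 <= card5 (M5 A D))))
  ltac:(by vm_compute) A.
move/allsP => /(_ D) H h1 h2; move: H; rewrite h1 eqxx h2 => /andP [-> H]; split=> // h3.
by rewrite h3 in H.
Qed.

(** An arc of two covers [X] in at most one position. *)
Lemma avoid1 X D : 2 <= card5 X -> cost D = 3 ->
  exists f, forall y, y <> f -> exists t, mem5 X t && mem5 (F5 D y) t.
Proof.
have := allsP (f := fun X => alls (fun D => 2 <= card5 X =>> cost D == 3 =>>
   ex5 (fun f => all5 (fun y => eq5 y f || ex5 (fun t => mem5 X t && mem5 (F5 D y) t)))))
  ltac:(by vm_compute) X.
move/allsP => /(_ D) H h1 h2; move: H; rewrite h1 h2 eqxx => /ex5P [f /all5P H].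
by exists f => y yf; have := H y; case: eq5P => //= _ /ex5P.
Qed.

(* Pairs of costs at the two outer ports of a light vertex. *)
Definition lt2 A B := [&& 3 <= cost A, 3 <= cost B & cost A + cost B <= 7].

Lemma lt2_N2 A B : lt2 A B -> [/\ cost (N2 A B) + 3 <= cost A + cost B,
  0 < runs (N2 A B) & cost (N2 A B) <= 4 * runs (N2 A B)].
Proof.
have := allsP (f := fun A => alls (fun B => lt2 A B =>> [&& cost (N2 A B) + 3 <= cost A + cost B,
  0 < runs (N2 A B) & cost (N2 A B) <= 4 * runs (N2 A B)]))
  ltac:(by vm_compute) A.
by move/allsP => /(_ B) H h; move: H; rewrite h => /and3P [].
Qed.

Lemma lt2_card A B : lt2 A B ->
  [/\ 2 <= card5 (mk5 (fun x => 2 <= card5 (AA A B z0 x))),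
      4 <= card5 (mk5 (fun x => 1 <= card5 (AA A B z0 x))),
      2 <= card5 (mk5 (fun x => 2 <= card5 (AA A B x z0))) &
      4 <= card5 (mk5 (fun x => 1 <= card5 (AA A B x z0)))].
Proof.
have := allsP (f := fun A => alls (fun B => lt2 A B =>>
  [&& 2 <= card5 (mk5 (fun x => 2 <= card5 (AA A B z0 x))),
      4 <= card5 (mk5 (fun x => 1 <= card5 (AA A B z0 x))),
      2 <= card5 (mk5 (fun x => 2 <= card5 (AA A B x z0))) &
      4 <= card5 (mk5 (fun x => 1 <= card5 (AA A B x z0)))])) ltac:(by vm_compute) A.
by move/allsP => /(_ B) H h; move: H; rewrite h => /and4P [].
Qed.

(** At least two differences leave the first vertex two colours, at least four leave the second
    vertex a colour, and 2 + 4 > 5. *)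
Lemma same_ports_table A1 B1 A2 B2 : lt2 A1 B1 -> lt2 A2 B2 ->
  exists d, 2 <= card5 (AA A1 B1 d z0) /\ 0 < card5 (AA A2 B2 d z0).
Proof.
move=> /lt2_card [_ _ h1 _] /lt2_card [_ _ _ h2].
have h := card_cap (mk5 (fun x => 2 <= card5 (AA A1 B1 x z0))) (mk5 (fun x => 1 <= card5 (AA A2 B2 x z0))).
have [|d] := @card5_gt0 (cap5 (mk5 (fun x => 2 <= card5 (AA A1 B1 x z0))) (mk5 (fun x => 1 <= card5 (AA A2 B2 x z0)))); first by alia.
by rewrite mem_cap !mem_mk5 => /andP []; exists d.
Qed.

(** [D] is an arc of at most three, so every [x] has at least two admissible [y], and at most one
    value of [y] leaves the second vertex no colour. *)
Lemma common_port_table A1 B1 A2 B2 D : lt2 A1 B1 -> lt2 A2 B2 -> cost D <= 4 -> runs D = 1 ->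
  exists x y, [/\ 2 <= card5 (AA A1 B1 z0 x), 0 < card5 (AA A2 B2 z0 y) & ~~ mem5 D (sub5 x y)].
Proof.
move=> /lt2_card [H1 _ _ _] /lt2_card [_ H2 _ _] h3 h4.
have := allsP (f := fun X => 2 <= card5 X =>> alls (fun Y => 4 <= card5 Y =>> alls (fun D =>
  cost D <= 4 =>> runs D == 1 =>> ex5 (fun x => ex5 (fun y => [&& mem5 X x, mem5 Y y & ~~ mem5 D (sub5 x y)])))))
  ltac:(by vm_compute) (mk5 (fun x => 2 <= card5 (AA A1 B1 z0 x))).
rewrite H1 => /allsP /(_ (mk5 (fun x => 1 <= card5 (AA A2 B2 z0 x)))); rewrite H2.
move/allsP => /(_ D); rewrite h3 h4 eqxx => /ex5P [x /ex5P [y /and3P []]]; rewrite !mem_mk5.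
by exists x, y.
Qed.

(** Only two differences are allowed, so fixing one of them forbids a single further one. *)
Lemma fix_table D d : cost D = 4 -> runs D = 1 -> ~~ mem5 D d ->
  cost (cup5 D (cpl5 (one5 d))) <= cost D + 1 /\ runs D <= runs (cup5 D (cpl5 (one5 d))).
Proof. by case: D => [[] [] [] [] []]; case: d. Qed.

Lemma cost_fix d : cost (cpl5 (one5 d)) = 5. Proof. by case: d. Qed.
Lemma runs_fix d : runs (cpl5 (one5 d)) = 1. Proof. by case: d. Qed.
Lemma fixP d e : ~~ mem5 (cpl5 (one5 d)) e -> e = d.
Proof. by rewrite !mem_mk5 negbK => /eq5P. Qed.

Section MinCex.
Variables (V : finType) (C : V -> V -> s5).
Hypothesis K : mincex C.
Implicit Types (S W R X : {set V}) (x : V -> z5).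
Let sC : sym_inst C. Proof. by case: K. Qed.
Local Notation N := (N C).
Local Notation c := (c C).
Local Notation nbs := (nbs C).

(** Constraints see only differences, so a colouring may be translated to give [r] the colour 0. *)
Lemma reduce_base r l (R : {set V}) : okl C l -> R <> setT ->
  (forall x, x r = z0 -> valid C x R -> resp l x R -> col C setT) ->
  exists W : {set V}, [/\ W \subset R, 2 <= #|W|, W <> setT & touch l W] /\
    (5 * #|W| + 1 <= eC C W + kap l W + 3 \/
     (5 * #|W| <= eC C W + kap l W + 3 /\ rC C W + rho l W <= #|W|)).
Proof.
move=> okL RT ext.
have [|W [H [_ H']]] := reduce K okL RT; last by exists W.
move=> x xR rx; apply: (ext (fun u => sub5 (x u) (x r))).
- by case: (x r).
- by move=> u v uR vR; rewrite sub5BB; apply: xR.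
by elim: (l) rx => //= m l' IH [h1 h2]; split; [rewrite sub5BB|exact: IH].
Qed.

Lemma ext_set (Q : {set V}) x x' : valid C x (~: Q) -> {in ~: Q, x' =1 x} ->
  (forall u w, u \in Q -> w \in N u -> ~~ mem5 (C u w) (sub5 (x' u) (x' w))) -> col C setT.
Proof.
move=> xQ ex H; have H' u w : u \in Q -> ~~ mem5 (C u w) (sub5 (x' u) (x' w)).
  move=> uQ; case: (boolP (w \in N u)) => [|]; first exact: H.
  by rewrite mem_N negbK => /empbP ->; case: (sub5 _ _).
exists x' => u w _ _; case: (boolP (u \in Q)) => [|uQ]; first exact: H'.
case: (boolP (w \in Q)) => [wQ|wQ]; last by rewrite !ex ?inE //; apply: xQ; rewrite !inE.
by rewrite (proj1 sC) mem_neg; apply: H'.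
Qed.

Lemma aN_count u s W : nbs u s -> aN C u W = count (mem W) s.
Proof.
move=> [us e]; rewrite /aN /deg -sum1_count big_mkcond [RHS]big_mkcond /=.
rewrite [RHS]big_uniq // [RHS]big_mkcond /=; apply: eq_bigr => w _.
rewrite /wadj -mem_N e /=; by case: (w \in W); case: (w \in s).
Qed.

Lemma wholeQ (s : seq V) W : uniq s -> ~: W =i s -> 3 * #|W| <= (rC C W).*2 + \sum_(q <- s) aN C q W.
Proof.
move=> us e; have := whole K W; rewrite /cross big_uniq //= .
by rewrite (eq_bigl (mem s)).
Qed.

Lemma e_le_4r W : eC C W <= 4 * rC C W.
Proof.
rewrite /eC /rC /ew big_distrr /=; apply: leq_sum => u _; rewrite big_distrr /=.
by apply: leq_sum => w _; apply: cost_le_runs; apply: (c4 K).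
Qed.

Section Two.
Variables (v a1 a2 r : V).
Hypotheses (nv : nbs v [:: a1; a2; r]) (v1 : c v a1 = 3) (v2 : c v a2 = 3) (v3 : c v r = 3).

Let Q := [set a1; v; a2].

Lemma Q_sub W : W \subset ~: Q -> [/\ a1 \notin W, v \notin W & a2 \notin W].
Proof.
by move/subsetP => H; split; apply/negP => /H; rewrite !inE eqxx ?orbT.
Qed.

Lemma Q_uniq : uniq [:: a1; v; a2].
Proof.
have [uv _] := nv; move: uv; rewrite /= !inE !negb_or => /and3P [/andP [a12 _] _ _].
have [_ n1] := nbs_in K nv (u := a1) ltac:(by rewrite !inE eqxx).
have [_ n2] := nbs_in K nv (u := a2) ltac:(by rewrite !inE eqxx orbT).
by move: n1 n2; rewrite !inE a12 => -> ; rewrite eq_sym => ->.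
Qed.

Lemma Q_T : ~: Q <> setT.
Proof. by move/setP/(_ v); rewrite !inE eqxx orbT. Qed.

Lemma Q_add W s1 s2 : W \subset ~: Q -> uniq s1 -> uniq s2 ->
  all (mem W) s1 -> all (mem W) s2 ->
  let S := v |: (a2 |: (a1 |: W)) in
  let k := \sum_(u <- s1) c a1 u + \sum_(u <- s2) c a2 u + 6 in
  [/\ #|S| = #|W| + 3, eC C W + k <= eC C S,
      r \in W -> eC C W + k + 3 <= eC C S &
      S = setT -> ~: W =i [:: a1; v; a2]].
Proof.
move=> WR u1 u2 sW1 sW2 S k; have [n1 n2 n3] := Q_sub WR.
have := Q_uniq; rewrite /= !inE !negb_or => /and3P [/andP [a1v a12] va2 _].
have [ca ea] := addv K n1 u1 (sub_list sW1).
have m2 : a2 \notin a1 |: W by rewrite !inE negb_or eq_sym a12.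
have [|cb eb] := addv K m2 u2; first by move=> u /(sub_list sW2) uW; rewrite inE uW orbT.
have m3 : v \notin a2 |: (a1 |: W) by rewrite !inE !negb_or va2 eq_sym a1v.
have [uv _] := nv; move: (uv); rewrite /= !inE !negb_or => /and3P [_ a2r _].
have [||cc ec] := @addv _ _ K v [:: a1; a2] _ m3.
- by rewrite /= !inE a12.
- by apply: sub_list; rewrite /= !inE !eqxx !orbT.
rewrite !big_cons big_nil v1 v2 in ec.
split; rewrite /S /k; first by alia.
- by alia.
- move=> rW; have [||cd ed] := @addv _ _ K v [:: a1; a2; r] _ m3.
  + exact: uv.
  + by apply: sub_list; rewrite /= !inE !eqxx rW !orbT.
  by rewrite !big_cons big_nil v1 v2 v3 in ed; alia.
move=> ST u; rewrite !inE; move/setP: ST => /(_ u); rewrite !inE.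
case: (eqVneq u v) => [->|_]; first by rewrite n2 orbT.
case: (eqVneq u a2) => [->|_]; first by rewrite n3 !orbT.
case: (eqVneq u a1) => [->|_]; first by rewrite n1.
by move=> /= ->.
Qed.

Variables (p1 q1 p2 q2 : V).
Hypotheses (n1 : nbs a1 [:: v; p1; q1]) (n2 : nbs a2 [:: v; p2; q2]).
Hypotheses (l1 : lt2 (C a1 p1) (C a1 q1)) (l2 : lt2 (C a2 p2) (C a2 q2)).
Hypothesis a12 : c a1 a2 = 0.

Lemma ports : [/\ p1 \in ~: Q, q1 \in ~: Q, p2 \in ~: Q & q2 \in ~: Q].
Proof.
have A u : u \in N a1 -> u != v -> u \in ~: Q.
  move=> h uv; rewrite !inE !negb_or uv (N_neq K h) /=; apply: contraTneq h => ->.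
  by rewrite cN a12.
have B u : u \in N a2 -> u != v -> u \in ~: Q.
  move=> h uv; rewrite !inE !negb_or uv (N_neq K h) !andbT; apply: contraTneq h => ->.
  by rewrite cN (cC K) a12.
have [u1 e1] := n1; have [u2 e2] := n2.
rewrite /= !inE !negb_or in u1 u2.
case/and3P: u1 => [/andP [vp1 vq1] _ _]; case/and3P: u2 => [/andP [vp2 vq2] _ _].
by split; [apply: A|apply: A|apply: B|apply: B]; rewrite ?e1 ?e2 ?inE ?eqxx ?orbT // eq_sym.
Qed.

(** At most five pairs join [Q] to [W], so the degrees would give
    [3 * #|W| <= 2 * (#|W| - 2) + 5]. *)
Lemma Q_whole W : W \subset ~: Q -> 2 <= #|W| -> ~: W =i [:: a1; v; a2] ->
  rC C W + 2 <= #|W| -> False.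
Proof.
move=> WR W2 e rW; have := wholeQ Q_uniq e; have [m1 m2 m3] := Q_sub WR.
rewrite !big_cons big_nil (aN_count _ nv) (aN_count _ n1) (aN_count _ n2) /=.
rewrite (negPf m1) (negPf m2) (negPf m3).
case: (r \in W); case: (p1 \in W); case: (q1 \in W); case: (p2 \in W); case: (q2 \in W); rewrite /=; alia.
Qed.

Lemma Q_ext x t s1 s2 : valid C x (~: Q) -> mem5 (F5 (C v r) (x r)) t ->
  mem5 (AA (C a1 p1) (C a1 q1) (x p1) (x q1)) s1 -> ~~ mem5 (C a1 v) (sub5 s1 t) ->
  mem5 (AA (C a2 p2) (C a2 q2) (x p2) (x q2)) s2 -> ~~ mem5 (C a2 v) (sub5 s2 t) ->
  r \in ~: Q -> col C setT.
Proof.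
move=> xQ; rewrite !mem_cap !mem_F5 => tr /andP [s1p s1q] s1t /andP [s2p s2q] s2t rQ.
have [P1 Q1 P2 Q2] := ports.
have := Q_uniq; rewrite /= !inE !negb_or => /and3P [/andP [a1v a12'] va2 _].
pose x' := upd (upd (upd x a1 s1) a2 s2) v t.
have xv : x' v = t by rewrite /x' /upd eqxx.
have xa1 : x' a1 = s1 by rewrite /x' /upd (negPf a1v) (negPf a12') eqxx.
have xa2 : x' a2 = s2 by rewrite /x' /upd eq_sym (negPf va2) eqxx.
have xo u : u \in ~: Q -> x' u = x u.
  by rewrite !inE !negb_or /x' /upd => /andP [/andP [/negPf -> /negPf ->] /negPf ->].
apply: (ext_set (x' := x') xQ) => [u|u w]; first exact: xo.
move=> uQ; have /or3P : [|| u == a1, u == v | u == a2] by move: uQ; rewrite !inE orbA.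
case=> /eqP -> .
- rewrite (proj2 n1) !inE => /or3P [] /eqP ->; rewrite ?xv xa1 ?xo //.
- rewrite (proj2 nv) !inE => /or3P [] /eqP ->; rewrite ?xv ?xa1 ?xa2 ?xo //.
    by rewrite (proj1 sC) mem_neg.
  by rewrite (proj1 sC) mem_neg.
- rewrite (proj2 n2) !inE => /or3P [] /eqP ->; rewrite ?xv xa2 ?xo //.
Qed.

Lemma Q_ext_card x f : valid C x (~: Q) -> r \in ~: Q ->
  let A1 := AA (C a1 p1) (C a1 q1) (x p1) (x q1) in
  let A2 := AA (C a2 p2) (C a2 q2) (x p2) (x q2) in
  0 < card5 A1 -> 0 < card5 A2 ->
  (forall y, y <> f -> exists t, mem5 (cap5 (M5 A1 (C a1 v)) (M5 A2 (C a2 v))) t && mem5 (F5 (C v r) y) t) ->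
  x r <> f -> col C setT.
Proof.
move=> xQ rQ A1 A2 c1 c2 H rf; have [t /andP []] := H _ rf; rewrite mem_cap => /andP [t1 t2] tr.
have [s1 h1 h1'] := M5P t1; have [s2 h2 h2'] := M5P t2.
exact: (@Q_ext x t s1 s2).
Qed.

End Two.

End MinCex.

Lemma sub5_inj x a b : sub5 x a = sub5 x b -> a = b.
Proof. by case: x; case: a; case: b. Qed.
Lemma sub5_0 x : sub5 x z0 = x.
Proof. by case: x. Qed.

Lemma lt2C A B : lt2 A B = lt2 B A.
Proof. by rewrite /lt2 addnC andbCA. Qed.

Lemma M5_two A1 A2 D1 D2 : 2 <= card5 A1 -> 0 < card5 A2 -> cost D1 = 3 -> cost D2 = 3 ->
  2 <= card5 (cap5 (M5 A1 D1) (M5 A2 D2)).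
Proof.
move=> a1 a2 d1 d2; have [_ /(_ a1) h1] := M5_card d1 (ltnW a1); have [h2 _] := M5_card d2 a2.
have := card_cap (M5 A1 D1) (M5 A2 D2); alia.
Qed.

Section MinCex.
Variables (V : finType) (C : V -> V -> s5).
Hypothesis K : mincex C.
Implicit Types (S W R X : {set V}) (x : V -> z5).
Let sC : sym_inst C. Proof. by case: K. Qed.
Local Notation N := (N C).
Local Notation c := (c C).
Local Notation nbs := (nbs C).

Lemma nbs_swap v a p q : nbs v [:: a; p; q] -> nbs v [:: a; q; p].
Proof. by apply: nbs_perm; rewrite perm_cons (perm_catC [:: p] [:: q]). Qed.

Lemma Q_r v a1 a2 r : nbs v [:: a1; a2; r] -> r \in ~: [set a1; v; a2].
Proof.
move=> nv; have [uv _] := nv; move: uv; rewrite /= !inE !negb_or => /and3P [/andP [_ a1r] a2r _].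
have [_ rv] := nbs_in K nv (u := r) ltac:(by rewrite !inE eqxx ?orbT).
by move: rv; rewrite !inE [r == a1]eq_sym [r == a2]eq_sym a1r a2r => ->.
Qed.

Lemma S_all v a1 a2 r W : nbs v [:: a1; a2; r] -> ~: W =i [:: a1; v; a2] -> r \in W.
Proof.
move=> /Q_r; rewrite !inE !negb_or => h e; move: (e r); rewrite !inE.
by move/andP: h => [/andP [/negPf -> /negPf ->] /negPf ->] /negbFE.
Qed.

(** Fixing the difference of the common ports costs 5 and leaves [a1] two colours and [a2] one; then
    a single position of [r] is bad, and forbidding it costs 2. The count is 3 + 7 + 15 - 13 - 9 =
    3, with the runs excluding equality. *)
Lemma light_pair_same_ports v a1 a2 r p q :
  nbs v [:: a1; a2; r] -> c v a1 = 3 -> c v a2 = 3 -> c v r = 3 ->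
  nbs a1 [:: v; p; q] -> nbs a2 [:: v; p; q] ->
  lt2 (C a1 p) (C a1 q) -> lt2 (C a2 p) (C a2 q) ->
  c a1 a2 = 0 -> c a1 r = 0 -> c p q = 0 ->
  13 <= c a1 p + c a1 q + c a2 p + c a2 q -> False.
Proof.
move=> nv v1 v2 v3 n1 n2 l1 l2 a12 a1r cpq s13.
have [P Q _ _] := ports K n1 n2 a12.
have rQ := Q_r nv.
have [u1 _] := n1; move: (u1); rewrite /= !inE !negb_or => /and3P [_ pq _].
have rp : r != p by apply: contraTneq l1 => <-; rewrite /lt2 -/(c a1 r) a1r.
have rq : r != q by apply: contraTneq l1 => <-; rewrite /lt2 -/(c a1 r) a1r andbF.
have [d [d1 d2]] := same_ports_table l1 l2.
have cA1 : cost (C a1 v) = 3 by rewrite -/(c a1 v) cC.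
have cA2 : cost (C a2 v) = 3 by rewrite -/(c a2 v) cC.
have [f Hf] := avoid1 (M5_two d1 d2 cA1 cA2) v3.
pose l := [:: mdd p q (cpl5 (one5 d)); mdd r q (one5 f)].
have okL : okl C l by split; [exact: okm_dd|split=> //; exact: okm_dd].
have [||W [[WR W2 WT] tW gW]] := reduce_base K (r := q) (R := ~: [set a1; v; a2]) okL.
- exact: Q_T.
- move=> x xq xS; rewrite /= /touched /= P Q rQ xq !sub5_0 => [[/(_ isT) /fixP r1 [/(_ isT) /one5P r2 _]]].
  apply: (@Q_ext_card _ _ K v a1 a2 r nv p q p q n1 n2 a12 x f xS rQ) => //; rewrite r1 xq //.
  by apply: ltnW.
move: gW; rewrite /= /touched /= cost_one runs_one cost_fix runs_fix !addn0.
have T := @trap _ _ K W W2; have {}T : ~ (5 * #|W| <= eC C W + 5) by move=> H; apply: WT; apply: T.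
case: (boolP ((p \in W) && _)) => [/andP [pW qW]|_]; last by case: ifP => _; alia.
have sW : all (mem W) [:: p; q] by rewrite /= pW qW.
have upq : uniq [:: p; q] by rewrite /= inE pq.
have [cS eS eS' ST] := Q_add K nv v1 v2 v3 WR upq upq sW sW.
rewrite !big_cons !big_nil in eS eS'.
rewrite qW andbT; case: ifP => rW gW.
  have eS2 := eS' rW.
  have VT : v |: (a2 |: (a1 |: W)) = setT by apply: (trap K); alia.
  rewrite VT in cS eS2.
  case: gW => [gW|[gW rr]]; first by apply: (not_good K); alia.
  by apply: (Q_whole K nv v1 v2 v3 n1 n2 a12 WR W2 (ST VT)); alia.
have VT : v |: (a2 |: (a1 |: W)) = setT by apply: (trap K); alia.
have eS2 := eS' (S_all nv (ST VT)).
rewrite VT in cS eS2; apply: (not_good K); alia.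
Qed.

(** The pair [g, h] already costs 4, so fixing its difference as well adds one unit to the 7 spent
    with equal ports; the costs at the ports now total 14, and the count is again 3. *)
Lemma light_pair_common_port v a1 a2 r s g h :
  nbs v [:: a1; a2; r] -> c v a1 = 3 -> c v a2 = 3 -> c v r = 3 ->
  nbs a1 [:: v; s; g] -> nbs a2 [:: v; s; h] ->
  lt2 (C a1 s) (C a1 g) -> lt2 (C a2 s) (C a2 h) ->
  c a1 a2 = 0 -> c a1 r = 0 -> g != h -> c g h = 4 -> runs (C g h) = 1 ->
  c a1 s + c a1 g = 7 -> c a2 s + c a2 h = 7 -> False.
Proof.
move=> nv v1 v2 v3 n1 n2 l1 l2 a12 a1r gh cgh rgh s1 s2.
have [P Q _ H] := ports K n1 n2 a12.
have rQ := Q_r nv.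
have [u1 _] := n1; move: (u1); rewrite /= !inE !negb_or => /and3P [_ sg _].
have [u2 _] := n2; move: (u2); rewrite /= !inE !negb_or => /and3P [_ sh _].
have rs : r != s by apply: contraTneq l1 => <-; rewrite /lt2 -/(c a1 r) a1r.
have rg : r != g by apply: contraTneq l1 => <-; rewrite /lt2 -/(c a1 r) a1r andbF.
have [y [z [d1 d2 d3]]] := common_port_table l1 l2 (c4 K g h) rgh.
have cA1 : cost (C a1 v) = 3 by rewrite -/(c a1 v) cC.
have cA2 : cost (C a2 v) = 3 by rewrite -/(c a2 v) cC.
have [f Hf] := avoid1 (M5_two d1 d2 cA1 cA2) v3.
pose l := [:: mdd g s (cpl5 (one5 y)); Md g h (cpl5 (one5 (sub5 y z))) 1 0; mdd r s (one5 f)].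
have okL : okl C l.
  split; first by apply: okm_dd; rewrite eq_sym.
  split; last by split=> //; exact: okm_dd.
  rewrite /okm /= addp_other /=; last first.
    by apply/eqP => /setP /(_ g); rewrite !inE eqxx [g == r]eq_sym (negPf rg) [g == s]eq_sym (negPf sg).
  have [k1 k2] := fix_table cgh rgh d3.
  by split=> //; rewrite addn0; split=> //; right.
have [||W [[WR W2 WT] tW gW]] := reduce_base K (r := s) (R := ~: [set a1; v; a2]) okL.
- exact: Q_T.
- move=> x xs xS; rewrite /= /touched /= P Q H rQ xs !sub5_0 => [[/(_ isT) /fixP r1 [/(_ isT) /fixP r2 [/(_ isT) /one5P r3 _]]]].
  rewrite r1 in r2; have {}r2 := sub5_inj r2.
  apply: (@Q_ext_card _ _ K v a1 a2 r nv s g s h n1 n2 a12 x f xS rQ) => //; rewrite ?r1 ?r2 xs //.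
  by apply: ltnW.
move: gW; rewrite /= /touched /= cost_one runs_one cost_fix runs_fix !addn0.
have T := @trap _ _ K W W2; have {}T : ~ (5 * #|W| <= eC C W + 5) by move=> HH; apply: WT; apply: T.
case: (boolP (g \in W)) => gW; case: (boolP (s \in W)) => sW; rewrite /= ?andbF ?andbT; last 3 first.
- by case: ifP => _; alia.
- by case: ifP => _; alia.
- by alia.
have a7 : 3 <= c a2 s by case/and3P: l2.
have usg : uniq [:: s; g] by rewrite /= inE sg.
have ush : uniq [:: s; h] by rewrite /= inE sh.
case: (boolP (h \in W)) => hW.
  have m1 : all (mem W) [:: s; g] by rewrite /= sW gW.
  have m2 : all (mem W) [:: s; h] by rewrite /= sW hW.
  have [cS eS eS' ST] := Q_add K nv v1 v2 v3 WR usg ush m1 m2.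
  rewrite !big_cons !big_nil in eS eS'.
  case: ifP => rW GW.
    have eS2 := eS' rW.
    have VT : v |: (a2 |: (a1 |: W)) = setT by apply: (trap K); alia.
    rewrite VT in cS eS2.
    case: GW => [GW|[GW rr]]; first by apply: (not_good K); alia.
    by apply: (Q_whole K nv v1 v2 v3 n1 n2 a12 WR W2 (ST VT)); alia.
  have VT : v |: (a2 |: (a1 |: W)) = setT by apply: (trap K); alia.
  have eS2 := eS' (S_all nv (ST VT)).
  rewrite VT in cS eS2; apply: (not_good K); alia.
(* If [h] is outside [W], the unit at [g, h] is not charged; adding [h] with its cost 4 at [g]
   raises the potential by the same unit. *)
have [||ch eh] := @addv _ _ K h [:: g] W hW; first by [].
  by move=> u; rewrite inE => /eqP ->.
rewrite big_cons big_nil (cC K h g) cgh in eh.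
have m1 : all (mem (h |: W)) [:: s; g] by rewrite /= !inE sW gW !orbT.
have m2 : all (mem (h |: W)) [:: s; h] by rewrite /= !inE sW eqxx !orbT.
have hWR : h |: W \subset ~: [set a1; v; a2].
  by apply/subsetP => u; rewrite in_setU1 => /orP [/eqP -> //|]; apply: (subsetP WR).
have [cS eS eS' ST] := Q_add K nv v1 v2 v3 hWR usg ush m1 m2.
rewrite !big_cons !big_nil in eS eS'.
case: ifP => rW GW.
  have eS2 := eS' (setU1r _ rW).
  have VT : v |: (a2 |: (a1 |: (h |: W))) = setT by apply: (trap K); alia.
  rewrite VT in cS eS2.
  case: GW => [GW|[GW rr]]; first by apply: (not_good K); alia.
  have W3 : 3 <= #|W|.
    rewrite -(card3 (u := s) (v := g) (w := r)) 1?eq_sym //; last by rewrite eq_sym.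
    by apply: subset_leq_card; apply/subsetP => u; rewrite !inE => /orP [/orP []|] /eqP ->.
  have := e_le_4r K W; alia.
have VT : v |: (a2 |: (a1 |: (h |: W))) = setT by apply: (trap K); alia.
have eS2 := eS' (S_all nv (ST VT)).
rewrite VT in cS eS2; apply: (not_good K); alia.
Qed.

(** [W] is the small set left over in [light_pair]. With three distinct ports the pair of cost 4
    must be [g, h]: at [s] it would form with [a1] or [a2] a triangle of cost 7 + 4, against
    [tri]. *)
Lemma light_pair_small v a1 a2 r s g h :
  nbs v [:: a1; a2; r] -> c v a1 = 3 -> c v a2 = 3 -> c v r = 3 ->
  nbs a1 [:: v; s; g] -> nbs a2 [:: v; s; h] ->
  lt2 (C a1 s) (C a1 g) -> lt2 (C a2 s) (C a2 h) ->
  c a1 a2 = 0 -> c a1 r = 0 ->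
  13 <= c a1 s + c a1 g + c a2 s + c a2 h ->
  forall W, s \in W -> g \in W -> h \in W -> #|W| <= 3 -> 
  (#|W| = 3 -> [/\ c a1 s + c a1 g = 7, c a2 s + c a2 h = 7, eC C W = 4 & rC C W = 1]) ->
  (#|W| = 2 -> eC C W = 0) -> False.
Proof.
move=> nv v1 v2 v3 n1 n2 l1 l2 a12 a1r s13 W sW gW hW W3 H3 H2.
have [u1 _] := n1; move: (u1); rewrite /= !inE !negb_or => /and3P [/andP [vs vg] sg _].
have [u2 _] := n2; move: (u2); rewrite /= !inE !negb_or => /and3P [/andP [_ vh] sh _].
have a1s : a1 != s.
  by have [_] := nbs_in K n1 (u := s) ltac:(by rewrite !inE eqxx ?orbT); rewrite !inE eq_sym.
have a1g : a1 != g.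
  by have [_] := nbs_in K n1 (u := g) ltac:(by rewrite !inE eqxx ?orbT); rewrite !inE eq_sym.
have a2s : a2 != s.
  by have [_] := nbs_in K n2 (u := s) ltac:(by rewrite !inE eqxx ?orbT); rewrite !inE eq_sym.
have a2h : a2 != h.
  by have [_] := nbs_in K n2 (u := h) ltac:(by rewrite !inE eqxx ?orbT); rewrite !inE eq_sym.
have t1 := tri K a1s a1g sg; have t2 := tri K a2s a2h sh.
have pick (t : V) : t != s -> t != g -> t \in W -> W = [set s; g; t].
  move=> ts tg tW; apply/eqP; rewrite eq_sym eqEcard card3 1?eq_sym //; last by rewrite eq_sym.
  by rewrite andbC W3; apply/subsetP => u; rewrite !inE => /orP [/orP []|] /eqP ->.
have R1 u w : c u w = 0 \/ 1 <= runs (C u w).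
  case: (boolP (empb (C u w))) => [|/runs_gt0]; [|by right].
  by rewrite cost_emp => /eqP; left.
case: (eqVneq g h) => gh.
  have sg0 : c s g = 0.
    case: (ltnP #|W| 3) => W2.
      have [tW|] := set_0Vmem (W :\ s :\ g).
        have : W \subset [set s; g].
          apply/subsetP => u uW; apply: contraT; rewrite !inE negb_or => /andP [us ug].
          by move/setP/(_ u): tW; rewrite !inE us ug uW.
        move/subset_leq_card; rewrite cards2 sg => W2'.
        have EW : [set s; g] = W.
          apply/eqP; rewrite eqEcard cards2 sg -ltnS W2 andbT.
          by apply/subsetP => u; rewrite !inE => /orP [] /eqP ->.
        by rewrite -(e2 K sg) EW; apply: H2; rewrite -EW cards2 sg.
      case=> t; rewrite !inE => /and3P [tg ts tW].
      by have := pick t ts tg tW => EW; move: W2; rewrite EW card3 // eq_sym.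
    have W3' : #|W| = 3 by alia.
    have [k1 k2 k3 k4] := H3 W3'.
    have : 0 < #|W :\ s :\ g|.
      move: (cardsD1 s W) (cardsD1 g (W :\ s)); rewrite sW !inE gW eq_sym sg W3'; alia.
    case/card_gt0P => t; rewrite !inE => /and3P [tg ts tW].
    have st : s != t by rewrite eq_sym. have gt : g != t by rewrite eq_sym.
    have EW := pick t ts tg tW; move: k3 k4; rewrite EW e3 // r3 // /wruns.
    have := R1 s g; have := R1 s t; have := R1 g t; have := cost_le_runs (c4 K s g); rewrite -/(c s g).
    alia.
  by subst h; apply: (light_pair_same_ports nv v1 v2 v3 n1 n2 l1 l2 a12 a1r sg0); alia.
have hs : h != s by rewrite eq_sym. have hg : h != g by rewrite eq_sym.
have EW := pick h hs hg hW.
have W3' : #|W| = 3 by rewrite EW card3.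
have [k1 k2 k3 k4] := H3 W3'.
have [k5 k6] : c g h = 4 /\ runs (C g h) = 1.
  move: k3 k4; rewrite EW e3 // r3 // /wruns.
  have := R1 s g; have := R1 s h; have := R1 g h.
  have := cost_le_runs (c4 K s g); have := cost_le_runs (c4 K s h); have := cost_le_runs (c4 K g h).
  rewrite -!/(c _ _); alia.
exact: (light_pair_common_port nv v1 v2 v3 n1 n2 l1 l2 a12 a1r gh k5 k6 k1 k2).
Qed.

(** Keeping two colours at each of [a1] and [a2] leaves [v] at least 4 + 4 + 3 - 10 = 1 colour. By
    [lt2_N2] the final count is at most 6, one too many; only the exceptional alternative attains
    it, and then [W] is so small that the two light vertices share a port. *)
Lemma light_pair v a1 a2 r p1 q1 p2 q2 :
  nbs v [:: a1; a2; r] -> c v a1 = 3 -> c v a2 = 3 -> c v r = 3 ->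
  nbs a1 [:: v; p1; q1] -> nbs a2 [:: v; p2; q2] ->
  lt2 (C a1 p1) (C a1 q1) -> lt2 (C a2 p2) (C a2 q2) -> False.
Proof.
move=> nv v1 v2 v3 n1 n2 l1 l2.
have [uv _] := nv; move: (uv); rewrite /= !inE !negb_or => /and3P [/andP [a12' a1r'] a2r' _].
have va1 : v != a1.
  by have [_] := nbs_in K nv (u := a1) ltac:(by rewrite !inE eqxx ?orbT); rewrite !inE eq_sym.
have va2 : v != a2.
  by have [_] := nbs_in K nv (u := a2) ltac:(by rewrite !inE eqxx ?orbT); rewrite !inE eq_sym.
have vr : v != r.
  by have [_] := nbs_in K nv (u := r) ltac:(by rewrite !inE eqxx ?orbT); rewrite !inE eq_sym.
have big t : t \in N a1 -> t != v -> 3 <= c a1 t.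
  rewrite (proj2 n1) !inE => /or3P [] /eqP -> //; first by rewrite eqxx.
    by case/and3P: l1.
  by case/and3P: l1.
have nv' : nbs v [:: a1; r; a2] := nbs_swap nv.
have zero t : t != v -> c v a1 + c v t + c a1 t <= 9 -> c v t = 3 -> (c a1 t = 3 -> False) -> c a1 t = 0.
  move=> tv h1 h2 h3; apply/eqP; apply: contraT; rewrite -cN => tN.
  by have := big t tN tv; alia.
have a12 : c a1 a2 = 0.
  apply: zero => //; [by rewrite eq_sym|exact: (tri K)|exact: (D_no_triangle K nv)].
have a1r : c a1 r = 0.
  apply: zero => //; [by rewrite eq_sym|exact: (tri K)|exact: (D_no_triangle K nv')].
have [P1 Q1 P2 Q2] := ports K n1 n2 a12.
have [u1 _] := n1; move: (u1); rewrite /= !inE !negb_or => /and3P [/andP [vp1 vq1] pq1 _].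
have [u2 _] := n2; move: (u2); rewrite /= !inE !negb_or => /and3P [/andP [vp2 vq2] pq2 _].
set M1 := N2 (C a1 p1) (C a1 q1); set M2 := N2 (C a2 p2) (C a2 q2).
have [k1 r1 kr1] := lt2_N2 l1; have [k2 r2 kr2] := lt2_N2 l2.
rewrite -/M1 in k1 r1 kr1; rewrite -/M2 in k2 r2 kr2.
pose l := [:: mdd p1 q1 M1; mdd p2 q2 M2].
have okL : okl C l by split; [exact: okm_dd|split=> //; exact: okm_dd].
have cA1 : cost (C a1 v) = 3 by rewrite -/(c a1 v) cC.
have cA2 : cost (C a2 v) = 3 by rewrite -/(c a2 v) cC.
have rQ := Q_r nv.
have [||W [[WR W2 WT] tW [_ gW]]] := reduce (R := ~: [set a1; v; a2]) K okL.
- exact: Q_T.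
- move=> x xS; rewrite /= /touched /= P1 Q1 P2 Q2 => [[/(_ isT) /N2P s1 [/(_ isT) /N2P s2 _]]].
  rewrite -!/(AA _ _ _ _) in s1 s2.
  have [_ /(_ s1) h1] := M5_card cA1 (ltnW s1); have [_ /(_ s2) h2] := M5_card cA2 (ltnW s2).
  set X1 := M5 _ _ in h1; set X2 := M5 _ _ in h2.
  have h3 := card_cap X1 X2; have h4 := card_F5 (C v r) (x r); rewrite (cost3_card v3) in h4.
  have h5 := card_cap (cap5 X1 X2) (F5 (C v r) (x r)).
  have [|t] := @card5_gt0 (cap5 (cap5 X1 X2) (F5 (C v r) (x r))); first by alia.
  rewrite !mem_cap => /andP [/andP [/M5P [s h6 h6'] /M5P [s' h7 h7']] tr].
  exact: (Q_ext K nv n1 n2 a12 xS tr h6 h6' h7 h7' rQ).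
move: gW; rewrite /= /touched /= !addn0.
have T := @trap _ _ K W W2; have {}T : ~ (5 * #|W| <= eC C W + 5) by move=> H; apply: WT; apply: T.
have up1 : uniq [:: p1; q1] by rewrite /= inE pq1.
have up2 : uniq [:: p2; q2] by rewrite /= inE pq2.
have [m1 mv m2] := Q_sub WR.
rewrite /c in v1 v2 v3; rewrite -!/(c _ _) in v1 v2 v3 k1 k2.
case: (boolP ((p1 \in W) && _)) => [/andP [pW1 qW1]|_]; last first.
  case: ifP => [/andP [pW2 qW2]|_]; last by alia.
  have [|ca ea] := addv K m2 up2; first by apply: sub_list; rewrite /= pW2 qW2.
  rewrite !big_cons big_nil in ea => gW.
  have : a2 |: W = setT by apply: (trap K); alia.
  by move/setP/(_ v); rewrite !inE (negPf va2) (negPf mv).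
have sW1 : all (mem W) [:: p1; q1] by rewrite /= pW1 qW1.
case: (boolP ((p2 \in W) && _)) => [/andP [pW2 qW2]|_]; last first.
  have [|ca ea] := addv K m1 up1; first exact: sub_list.
  rewrite !big_cons big_nil in ea => gW.
  have : a1 |: W = setT by apply: (trap K); alia.
  by move/setP/(_ v); rewrite !inE (negPf va1) (negPf mv).
have sW2 : all (mem W) [:: p2; q2] by rewrite /= pW2 qW2.
have [cS eS eS' ST] := Q_add K nv v1 v2 v3 WR up1 up2 sW1 sW2.
rewrite !big_cons !big_nil in eS eS'.
case=> [gW|[gW rr]].
  have VT : v |: (a2 |: (a1 |: W)) = setT by apply: (trap K); alia.
  have eS2 := eS' (S_all nv (ST VT)).
  rewrite VT in cS eS2; apply: (not_good K); alia.
have E4 := e_le_4r K W.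
(* [5 * #|W| <= 4 * (rC C W + runs M1 + runs M2) + 3 <= 4 * #|W| + 3]. *)
have W3 : #|W| <= 3 by alia.
have l1' : c a1 p1 + c a1 q1 <= 7 by case/and3P: l1.
have l2' : c a2 p2 + c a2 q2 <= 7 by case/and3P: l2.
have s13 : 13 <= c a1 p1 + c a1 q1 + c a2 p2 + c a2 q2 by alia.
have H3 : #|W| = 3 -> [/\ c a1 p1 + c a1 q1 = 7, c a2 p2 + c a2 q2 = 7, eC C W = 4 & rC C W = 1].
  by move=> h; split; alia.
have H2 : #|W| = 2 -> eC C W = 0 by alia.
have share : [\/ p2 = p1, p2 = q1, q2 = p1 | q2 = q1].
  case: (eqVneq p2 p1) => [->|np1]; first by constructor 1.
  case: (eqVneq p2 q1) => [->|np2]; first by constructor 2.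
  case: (eqVneq q2 p1) => [->|np3]; first by constructor 3.
  case: (eqVneq q2 q1) => [->|np4]; first by constructor 4.
  have : #|q2 |: [set p2; p1; q1]| <= #|W|.
    apply: subset_leq_card; apply/subsetP => u; rewrite !inE.
    by case/or3P => [/eqP ->|/orP [] /eqP ->|/eqP ->].
  by rewrite cardsU1 !inE !negb_or card3 // eq_sym pq2 np3 np4 /=; alia.
have n1' := nbs_swap n1; have n2' := nbs_swap n2.
have l1s : lt2 (C a1 q1) (C a1 p1) by rewrite lt2C.
have l2s : lt2 (C a2 q2) (C a2 p2) by rewrite lt2C.
have H3' : #|W| = 3 -> [/\ c a1 q1 + c a1 p1 = 7, c a2 p2 + c a2 q2 = 7, eC C W = 4 & rC C W = 1].
  by rewrite [c a1 q1 + _]addnC.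
have H3'' : #|W| = 3 -> [/\ c a1 p1 + c a1 q1 = 7, c a2 q2 + c a2 p2 = 7, eC C W = 4 & rC C W = 1].
  by rewrite [c a2 q2 + _]addnC.
have H3''' : #|W| = 3 -> [/\ c a1 q1 + c a1 p1 = 7, c a2 q2 + c a2 p2 = 7, eC C W = 4 & rC C W = 1].
  by rewrite [c a2 q2 + _]addnC [c a1 q1 + _]addnC.
case: share => E; subst.
- by apply: (light_pair_small nv v1 v2 v3 n1 n2 l1 l2 a12 a1r s13 pW1 qW1 qW2 W3 H3 H2).
- by apply: (light_pair_small nv v1 v2 v3 n1' n2 l1s l2 a12 a1r _ qW1 pW1 qW2 W3 H3' H2); alia.
- by apply: (light_pair_small nv v1 v2 v3 n1 n2' l1 l2s a12 a1r _ pW1 qW1 pW2 W3 H3'' H2); alia.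
- by apply: (light_pair_small nv v1 v2 v3 n1' n2' l1s l2s a12 a1r _ qW1 pW1 pW2 W3 H3''' H2); alia.
Qed.

End MinCex.

(** * Vertices of type (2,3,3,3) *)

Lemma N2_33 A B : cost A = 3 -> cost B = 3 -> cost (N2 A B) = 3 /\ runs (N2 A B) = 1.
Proof.
have := allsP (f := fun A => alls (fun B => cost A == 3 =>> cost B == 3 =>>
  (cost (N2 A B) == 3) && (runs (N2 A B) == 1))) ltac:(by vm_compute) A.
by move/allsP => /(_ B) H h1 h2; move: H; rewrite h1 h2 !eqxx => /andP [/eqP -> /eqP ->].
Qed.

Section MinCex.
Variables (V : finType) (C : V -> V -> s5).
Hypothesis K : mincex C.
Implicit Types (S W R X : {set V}) (x : V -> z5).
Let sC : sym_inst C. Proof. by case: K. Qed.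
Local Notation N := (N C).
Local Notation c := (c C).
Local Notation nbs := (nbs C).

(* The type [D] of the header: the vertices that lack one unit in the discharging. *)
Definition isD v p q r := [/\ nbs v [:: p; q; r], c v p = 3, c v q = 3 & c v r = 3].

Lemma D_sep u v p q w : isD v u p q -> c u w = 3 -> w != v -> w \notin N v.
Proof.
move=> [nv c1 c2 c3] cw wv; apply/negP; rewrite (proj2 nv) !inE => /or3P [] /eqP E.
- by move: cw; rewrite E c0.
- by apply: (D_no_triangle K nv) => //; rewrite -E.
by apply: (D_no_triangle K (nbs_swap nv)) => //; rewrite -E.
Qed.

Lemma nbs_ne v s t : nbs v s -> t \in s -> v != t.
Proof. by move=> h h'; have [_] := nbs_in K h h'; rewrite !inE eq_sym. Qed.

Section no_2DDD.
Variables (u a v1 v2 v3 p1 q1 p2 q2 p3 q3 : V).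
Hypotheses (nu : nbs u [:: a; v1; v2; v3]) (ca : c u a = 2).
Hypotheses (c1 : c u v1 = 3) (c2 : c u v2 = 3) (c3 : c u v3 = 3).
Hypotheses (D1 : isD v1 u p1 q1) (D2 : isD v2 u p2 q2) (D3 : isD v3 u p3 q3).

Let Q := [set u; v1; v2; v3].

Lemma DDD_port v p q w : isD v u p q -> v \in [:: v1; v2; v3] -> w \in [:: p; q] -> w \in ~: Q.
Proof.
move=> Dv vv wpq; have [nv e1 e2 e3] := Dv.
have [uv _] := nv; rewrite /= !inE !negb_or in uv; case/and3P: uv => [/andP [up uq] pq _].
have wN : w \in N v by rewrite (proj2 nv) inE wpq orbT.
have wu : w != u by move: wpq; rewrite !inE => /orP [] /eqP ->; rewrite eq_sym.
have out t : c u t = 3 -> t != w.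
  move=> ct; case: (eqVneq t v) => [->|tv]; first by rewrite eq_sym (N_neq K).
  by apply: contraNneq (D_sep Dv ct tv) => ->.
by rewrite !inE !negb_or wu /= ![w == _]eq_sym !out.
Qed.

(** Adding [v], [v'] and then [u] lowers the potential by one each time; 8 becomes 5, although [v'']
    is missing. *)
Lemma DDD_two W v p q v' p' q' v'' :
  isD v u p q -> isD v' u p' q' -> v \notin W -> v' \notin W -> u \notin W ->
  v'' \notin W -> uniq [:: u; v; v'; v''] -> all (mem W) [:: p; q; p'; q'] ->
  c u v = 3 -> c u v' = 3 -> 5 * #|W| <= eC C W + 8 -> False.
Proof.
move=> [n1 e1 e2 e3] [n2 f1 f2 f3] vW v'W uW v''W uq /= /and5P [pW qW p'W q'W _] cv cv' PW.
move: (uq); rewrite /= !inE !negb_or => /and4P [/and3P [uv uv' uv''] /andP [vv' vv''] v'v'' _].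
have [u1 _] := n1; move: (u1); rewrite /= !inE !negb_or => /and3P [_ pq _].
have [u2 _] := n2; move: (u2); rewrite /= !inE !negb_or => /and3P [_ pq' _].
have [||k1 h1] := @addv _ _ K v [:: p; q] W vW.
- by rewrite /= inE pq.
- by apply: sub_list; rewrite /= pW qW.
have m2 : v' \notin v |: W by rewrite !inE negb_or eq_sym vv'.
have [||k2 h2] := @addv _ _ K v' [:: p'; q'] _ m2.
- by rewrite /= inE pq'.
- by apply: sub_list; rewrite /= !inE p'W q'W !orbT.
have m3 : u \notin v' |: (v |: W) by rewrite !inE !negb_or uv' uv.
have [||k3 h3] := @addv _ _ K u [:: v; v'] _ m3.
- by rewrite /= inE vv'.
- by apply: sub_list; rewrite /= !inE !eqxx !orbT.
rewrite !big_cons !big_nil in h1 h2 h3.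
have : u |: (v' |: (v |: W)) = setT by apply: (trap K); alia.
by move/setP/(_ v''); rewrite !inE ![v'' == _]eq_sym (negPf uv'') (negPf vv'') (negPf v'v'') (negPf v''W).
Qed.

(** Two colours at each of [v1], [v2], [v3] leave [u] four colours apiece, and [a] leaves four: 4 *
    4 - 15 = 1. By [N2_33] this costs 9, and putting [Q] back gives 3 + 9 - 3 + 5 - 9 = 5 before [a]
    is counted. *)
Lemma no_2DDD : False.
Proof.
have [un _] := nu; move: (un); rewrite /= !inE !negb_or => /and4P [/and3P [av1 av2 av3] /andP [v12 v13] v23 _].
have uv1 := nbs_ne nu (t := v1) ltac:(by rewrite !inE eqxx ?orbT).
have uv2 := nbs_ne nu (t := v2) ltac:(by rewrite !inE eqxx ?orbT).
have uv3 := nbs_ne nu (t := v3) ltac:(by rewrite !inE eqxx ?orbT).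
have ua := nbs_ne nu (t := a) ltac:(by rewrite !inE eqxx ?orbT).
have P1 := DDD_port D1 (w := p1) ltac:(by rewrite !inE eqxx ?orbT) ltac:(by rewrite !inE eqxx ?orbT).
have Q1 := DDD_port D1 (w := q1) ltac:(by rewrite !inE eqxx ?orbT) ltac:(by rewrite !inE eqxx ?orbT).
have P2 := DDD_port D2 (w := p2) ltac:(by rewrite !inE eqxx ?orbT) ltac:(by rewrite !inE eqxx ?orbT).
have Q2 := DDD_port D2 (w := q2) ltac:(by rewrite !inE eqxx ?orbT) ltac:(by rewrite !inE eqxx ?orbT).
have P3 := DDD_port D3 (w := p3) ltac:(by rewrite !inE eqxx ?orbT) ltac:(by rewrite !inE eqxx ?orbT).
have Q3 := DDD_port D3 (w := q3) ltac:(by rewrite !inE eqxx ?orbT) ltac:(by rewrite !inE eqxx ?orbT).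
have aQ : a \in ~: Q by rewrite !inE !negb_or eq_sym ua av1 av2 av3.
have [n1 x1 y1 t1] := D1; have [n2 x2 y2 t2] := D2; have [n3 x3 y3 t3] := D3.
have [u1 _] := n1; move: (u1); rewrite /= !inE !negb_or => /and3P [_ pq1 _].
have [u2 _] := n2; move: (u2); rewrite /= !inE !negb_or => /and3P [_ pq2 _].
have [u3 _] := n3; move: (u3); rewrite /= !inE !negb_or => /and3P [_ pq3 _].
have [k1 r1] := N2_33 y1 t1; have [k2 r2] := N2_33 y2 t2; have [k3 r3] := N2_33 y3 t3.
pose l := [:: mdd p1 q1 (N2 (C v1 p1) (C v1 q1)); mdd p2 q2 (N2 (C v2 p2) (C v2 q2));
              mdd p3 q3 (N2 (C v3 p3) (C v3 q3))].
have okL : okl C l by split; [|split; [|split=> //]]; exact: okm_dd.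
have [||W [[WR W2 WT] tW [_ gW]]] := reduce (R := ~: Q) K okL.
- by move/setP/(_ u); rewrite !inE eqxx.
- move=> x xS; rewrite /= /touched /= P1 Q1 P2 Q2 P3 Q3.
  move=> [/(_ isT) /N2P s1 [/(_ isT) /N2P s2 [/(_ isT) /N2P s3 _]]].
  have [_ /(_ s1) h1] := M5_card x1 (ltnW s1); have [_ /(_ s2) h2] := M5_card x2 (ltnW s2).
  have [_ /(_ s3) h3] := M5_card x3 (ltnW s3).
  have h4 := card_F5 (C u a) (x a); rewrite (cost2_card ca) in h4.
  set X1 := M5 _ _ in h1; set X2 := M5 _ _ in h2; set X3 := M5 _ _ in h3.
  have g1 := card_cap X1 X2; have g2 := card_cap (cap5 X1 X2) X3.
  have g3 := card_cap (cap5 (cap5 X1 X2) X3) (F5 (C u a) (x a)).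
  have [|t] := @card5_gt0 (cap5 (cap5 (cap5 X1 X2) X3) (F5 (C u a) (x a))); first by alia.
  rewrite !mem_cap mem_F5 => /andP [/andP [/andP [/M5P [b1 z1 w1] /M5P [b2 z2 w2]] /M5P [b3 z3 w3]] ta].
  move: z1 z2 z3; rewrite !mem_cap !mem_F5 => /andP [i1 j1] /andP [i2 j2] /andP [i3 j3].
  pose x' := upd (upd (upd (upd x u t) v1 b1) v2 b2) v3 b3.
  have xv3 : x' v3 = b3 by rewrite /x' /upd eqxx.
  have xv2 : x' v2 = b2 by rewrite /x' /upd (negPf v23) eqxx.
  have xv1 : x' v1 = b1 by rewrite /x' /upd (negPf v13) (negPf v12) eqxx.
  have xu : x' u = t by rewrite /x' /upd (negPf uv1) (negPf uv2) (negPf uv3) eqxx.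
  have xo w : w \in ~: Q -> x' w = x w.
    by rewrite !inE !negb_or /x' /upd => /andP [/andP [/andP [/negPf -> /negPf ->] /negPf ->] /negPf ->].
  apply: (ext_set K (x' := x') xS) => [w|w w'']; first exact: xo.
  move=> wQ; have /or4P : [|| w == u, w == v1, w == v2 | w == v3] by move: wQ; rewrite !inE !orbA.
  case=> /eqP ->.
  + rewrite (proj2 nu) !inE => /or4P [] /eqP ->; rewrite xu ?xv1 ?xv2 ?xv3 ?xo // (proj1 sC) mem_neg //.
  + rewrite (proj2 n1) !inE => /or3P [] /eqP ->; rewrite xv1 ?xu ?xo //.
  + rewrite (proj2 n2) !inE => /or3P [] /eqP ->; rewrite xv2 ?xu ?xo //.
  + rewrite (proj2 n3) !inE => /or3P [] /eqP ->; rewrite xv3 ?xu ?xo //.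
move: gW; rewrite /= /touched /= !addn0 k1 k2 k3 r1 r2 r3.
have T := @trap _ _ K W W2; have {}T : ~ (5 * #|W| <= eC C W + 5) by move=> H; apply: WT; apply: T.
have nW w : w \in Q -> w \notin W by move=> wQ; apply/negP => /(subsetP WR); rewrite inE wQ.
have uW := nW u ltac:(by rewrite !inE eqxx ?orbT).
have v1W := nW v1 ltac:(by rewrite !inE eqxx ?orbT).
have v2W := nW v2 ltac:(by rewrite !inE eqxx ?orbT).
have v3W := nW v3 ltac:(by rewrite !inE eqxx ?orbT).
have E4 := e_le_4r K W.
have one v p q : isD v u p q -> v \notin W -> u != v -> p \in W -> q \in W -> 5 * #|W| <= eC C W + 6 -> False.
  move=> [n e1 e2 e3] vW uv pW qW PW.
  have [un' _] := n; move: (un'); rewrite /= !inE !negb_or => /and3P [_ pq _].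
  have [||h1 h2] := @addv _ _ K v [:: p; q] W vW.
  - by rewrite /= inE pq.
  - by apply: sub_list; rewrite /= pW qW.
  rewrite !big_cons !big_nil in h2.
  have : v |: W = setT by apply: (trap K); alia.
  by move/setP/(_ u); rewrite !inE (negPf uv) (negPf uW).
case: (boolP ((p1 \in W) && _)) => [/andP [pW1 qW1]|_];
case: (boolP ((p2 \in W) && _)) => [/andP [pW2 qW2]|_];
case: (boolP ((p3 \in W) && _)) => [/andP [pW3 qW3]|_] gW.
- have [||g1 h1] := @addv _ _ K v1 [:: p1; q1] W v1W; [by rewrite /= inE pq1|by apply: sub_list; rewrite /= pW1 qW1|].
  have m2 : v2 \notin v1 |: W by rewrite !inE negb_or eq_sym v12.
  have [||g2 h2] := @addv _ _ K v2 [:: p2; q2] _ m2; [by rewrite /= inE pq2|by apply: sub_list; rewrite /= !inE pW2 qW2 !orbT|].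
  have m3 : v3 \notin v2 |: (v1 |: W) by rewrite !inE !negb_or eq_sym v23 eq_sym v13.
  have [||g3 h3] := @addv _ _ K v3 [:: p3; q3] _ m3; [by rewrite /= inE pq3|by apply: sub_list; rewrite /= !inE pW3 qW3 !orbT|].
  have m4 : u \notin v3 |: (v2 |: (v1 |: W)) by rewrite !inE !negb_or uv1 uv2 uv3.
  have [||g4 h4] := @addv _ _ K u [:: v1; v2; v3] _ m4.
  + by rewrite /= !inE negb_or v12 v13 v23.
  + by apply: sub_list; rewrite /= !inE !eqxx !orbT.
  rewrite !big_cons !big_nil in h1 h2 h3 h4.
  have ST : u |: (v3 |: (v2 |: (v1 |: W))) = setT by apply: (trap K); alia.
  have aS : a \in v3 |: (v2 |: (v1 |: W)).
    by move/setP/(_ a): ST; rewrite in_setU1 in_setT eq_sym (negPf ua).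
  have [|g5 h5] := @addv _ _ K u [:: a; v1; v2; v3] _ m4 un.
    by apply: sub_list; rewrite /= aS !inE !eqxx !orbT.
  rewrite !big_cons !big_nil ST in h5; rewrite ST in g4.
  by apply: (not_good K); alia.
- apply: (@DDD_two W v1 p1 q1 v2 p2 q2 v3) => //; first by rewrite /= !inE !negb_or uv1 uv2 uv3 v12 v13 v23.
    by rewrite /= pW1 qW1 pW2 qW2.
  by alia.
- apply: (@DDD_two W v1 p1 q1 v3 p3 q3 v2) => //; first by rewrite /= !inE !negb_or uv1 uv2 uv3 v12 v13 eq_sym v23.
    by rewrite /= pW1 qW1 pW3 qW3.
  by alia.
- by apply: (one v1 p1 q1) => //; alia.
- apply: (@DDD_two W v2 p2 q2 v3 p3 q3 v1) => //; first by rewrite /= !inE !negb_or uv1 uv2 uv3 v23 ![_ == v1]eq_sym v12 v13.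
    by rewrite /= pW2 qW2 pW3 qW3.
  by alia.
- by apply: (one v2 p2 q2) => //; alia.
- by apply: (one v3 p3 q3) => //; alia.
- by alia.
Qed.

End no_2DDD.

End MinCex.

(** * Vertices of type (2,2,3,3) *)

Lemma arc_shift A B : cost A = 3 -> cost B = 3 ->
  exists s, forall t, mem5 A (sub5 t s) = mem5 B t.
Proof.
have := allsP (f := fun A => alls (fun B => cost A == 3 =>> cost B == 3 =>>
  ex5 (fun s => all5 (fun t => mem5 A (sub5 t s) == mem5 B t)))) ltac:(by vm_compute) A.
move/allsP => /(_ B) H h1 h2; move: H; rewrite h1 h2 !eqxx => /ex5P [s /all5P H].
by exists s => t; apply/eqP.
Qed.

Lemma sub5_addr t a b : sub5 t (add5 a b) = sub5 (sub5 t a) b.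
Proof. by case: t; case: a; case: b. Qed.
Lemma sub5_opp a b s : sub5 (sub5 a b) (opp5 s) = sub5 (add5 a s) b.
Proof. by case: a; case: b; case: s. Qed.
Lemma sub5_move a b c d v : sub5 a b = sub5 c d ->
  sub5 (add5 b (sub5 v d)) a = sub5 v c.
Proof.
move=> /(congr1 (fun t => add5 t b)); rewrite sub5K => ->.
by case: b; case: c; case: d; case: v.
Qed.
Lemma cost3_runs A : cost A = 3 -> runs A = 1.
Proof. by case: A => [[] [] [] [] []]. Qed.

(** That the two colours are consecutive matters for [two_kill]: forbidding both kills takes an arc
    of cost only 3. *)
Lemma two_common A B d : cost A = 3 -> cost B = 3 -> 2 <= card5 (cap5 (F5 A d) (F5 B z0)) ->
  exists o, [&& mem5 (F5 A d) o, mem5 (F5 A d) (suc5 o), mem5 (F5 B z0) o & mem5 (F5 B z0) (suc5 o)].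
Proof.
have := allsP (f := fun A => alls (fun B => cost A == 3 =>> cost B == 3 =>> all5 (fun d =>
  2 <= card5 (cap5 (F5 A d) (F5 B z0)) =>> ex5 (fun o => [&& mem5 (F5 A d) o,
   mem5 (F5 A d) (suc5 o), mem5 (F5 B z0) o & mem5 (F5 B z0) (suc5 o)]))))
  ltac:(by vm_compute) A.
move/allsP => /(_ B) H h1 h2 h3; move: H; rewrite h1 h2 !eqxx => /all5P /(_ d).
by rewrite h3 => /ex5P.
Qed.

Lemma two_kill A o : cost A = 2 -> exists M, [/\ cost M = 3, runs M = 1 &
  forall d, ~~ mem5 M d -> ~~ mem5 A (sub5 o d) /\ ~~ mem5 A (sub5 (suc5 o) d)].
Proof.
have := allsP (f := fun A => cost A == 2 =>> all5 (fun o =>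
  let M := mk5 (fun d => mem5 A (sub5 o d) || mem5 A (sub5 (suc5 o) d)) in
   (cost M == 3) && (runs M == 1))) ltac:(by vm_compute) A.
move=> H h; move: H; rewrite h eqxx => /all5P /(_ o) /andP [/eqP h1 /eqP h2].
exists (mk5 (fun d => mem5 A (sub5 o d) || mem5 A (sub5 (suc5 o) d))); split=> // d.
by rewrite mem_mk5 negb_or => /andP.
Qed.

Section MinCex.
Variables (V : finType) (C : V -> V -> s5).
Hypothesis K : mincex C.
Implicit Types (S W R X : {set V}) (x : V -> z5).
Let sC : sym_inst C. Proof. by case: K. Qed.
Local Notation N := (N C).
Local Notation c := (c C).
Local Notation nbs := (nbs C).
Local Notation isD := (isD C).

(** Cost at most four times the runs, together with few runs, leaves only two vertices. Their pair
    then costs 4, and being uncolourable after the modification it has become full. *)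
Lemma trapped_pair (D : V -> V -> s5) d y M W : sym_inst D -> crit D W -> d != y ->
  D d y = cup5 (C d y) M -> d \in W -> y \in W ->
  5 * #|W| <= eC C W + 6 -> rC C W + 1 <= #|W| ->
  [/\ c d y = 4, runs (C d y) = 1 & fullb (cup5 (C d y) M)].
Proof.
move=> sD cW dy DE dW yW PW rW; have E4 := e_le_4r K W.
have EW : [set d; y] = W.
  apply/eqP; rewrite eqEcard cards2 dy; apply/andP; split; last by alia.
  by apply/subsetP => u; rewrite !inE => /orP [] /eqP ->.
have cW2 : #|W| = 2 by rewrite -EW cards2 dy.
rewrite cW2 in PW rW; rewrite -EW e2 // in PW E4.
have rE : rC C [set d; y] = runs (C d y) by apply: ew2 dy; apply: wrunsC.
rewrite rE in E4; rewrite -EW rE in rW.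
have c4' := c4 K d y.
split; [by alia|by alia|].
apply: contraT => nf; case: cW => nc _; case: nc.
have [t Ht] : exists t, ~~ mem5 (cup5 (C d y) M) t.
  apply: NNPP => H; case/negP: nf; apply/all5P => t; apply: contraT => Ht; case: H; by exists t.
exists (fun u => if u == d then t else z0) => u u'; rewrite -EW !inE => /orP [] /eqP -> /orP [] /eqP ->;
  rewrite ?eqxx ?[y == d]eq_sym ?(negPf dy) ?(proj2 sD) //.
- by case: (sub5 t t).
- by rewrite DE sub5_0.
by rewrite (proj1 sD) mem_neg DE sub5_0.
Qed.

(* In the colouring of [v] that constrains [u] exactly as [d] does, the difference
   of [v] and [y] is forbidden whenever that of [d] and [y] is allowed. *)
Definition alig u v d y := [/\ c d y = 4, runs (C d y) = 1 &
  exists s, (forall t, mem5 (C u v) (sub5 t s) = mem5 (C u d) t) /\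
            fullb (cup5 (C d y) (shift5 (C v y) (opp5 s)))].

Section D_aligned.
Variables (u a b d v y w : V).
Hypotheses (nu : nbs u [:: a; b; d; v]) (ca : c u a = 2) (cb : c u b = 2).
Hypotheses (cd : c u d = 3) (Dv : isD v u y w).

Let Q := [set u; v].
Let nv : nbs v [:: u; y; w]. Proof. by case: Dv. Qed.
Let cvu : c v u = 3. Proof. by case: Dv. Qed.
Let cvy : c v y = 3. Proof. by case: Dv. Qed.
Let cvw : c v w = 3. Proof. by case: Dv. Qed.
Let cuv : c u v = 3. Proof. by rewrite cC. Qed.

Lemma UV_distinct : [/\ uniq [:: a; b; d; v], uniq [:: u; y; w], u != v &
   [/\ a \in ~: Q, b \in ~: Q, d \in ~: Q, y \in ~: Q & w \in ~: Q]].
Proof.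
have [h1 _] := nu; have [h2 _] := nv.
have uv := nbs_ne K nu (t := v) ltac:(by rewrite !inE eqxx ?orbT).
have ua := nbs_ne K nu (t := a) ltac:(by rewrite !inE eqxx ?orbT).
have ub := nbs_ne K nu (t := b) ltac:(by rewrite !inE eqxx ?orbT).
have ud := nbs_ne K nu (t := d) ltac:(by rewrite !inE eqxx ?orbT).
have vy := nbs_ne K nv (t := y) ltac:(by rewrite !inE eqxx ?orbT).
have vw := nbs_ne K nv (t := w) ltac:(by rewrite !inE eqxx ?orbT).
split=> //.
rewrite /= !inE !negb_or in h1 h2.
case/and4P: h1 => [/and3P [_ _ av] /andP [_ bv] dv _]; case/and3P: h2 => [/andP [uy uw] _ _].
by rewrite !inE !negb_or ![_ == u]eq_sym ua ub ud uy uw ![y == v]eq_sym ![w == v]eq_sym av bv dv vy vw.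
Qed.

Lemma UV_dy : d != y /\ d != w.
Proof.
have [h1 _ _ _] := UV_distinct; rewrite /= !inE !negb_or in h1.
case/and4P: h1 => [_ _ dv _]; have := D_sep K Dv cd dv.
by rewrite (proj2 nv) !inE !negb_or => /and3P [].
Qed.

Lemma UV_ext x tu tv : valid C x (~: Q) ->
  [&& mem5 (F5 (C u a) (x a)) tu, mem5 (F5 (C u b) (x b)) tu & mem5 (F5 (C u d) (x d)) tu] ->
  mem5 (F5 (C v y) (x y)) tv && mem5 (F5 (C v w) (x w)) tv -> ~~ mem5 (C u v) (sub5 tu tv) ->
  col C setT.
Proof.
have [_ _ uv [aQ bQ dQ yQ wQ]] := UV_distinct.
move=> xS; rewrite !mem_F5 => /and3P [t1 t2 t3] /andP [t4 t5] t6.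
pose x' := upd (upd x u tu) v tv.
have xv : x' v = tv by rewrite /x' /upd eqxx.
have xu : x' u = tu by rewrite /x' /upd (negPf uv) eqxx.
have xo t : t \in ~: Q -> x' t = x t.
  by rewrite !inE negb_or /x' /upd => /andP [/negPf -> /negPf ->].
apply: (ext_set K (x' := x') xS) => [t|t t']; first exact: xo.
rewrite in_set2 => /orP [] /eqP ->.
  by rewrite (proj2 nu) !inE => /or4P [] /eqP ->; rewrite xu ?xv ?xo.
by rewrite (proj2 nv) !inE => /or3P [] /eqP ->; rewrite xv ?xu ?xo // (proj1 sC) mem_neg.
Qed.

Lemma UV_add S : S \subset ~: Q -> d \in S -> y \in S -> w \in S ->
  [/\ #|v |: (u |: S)| = #|S| + 2,
    eC C S + 12 + 2 * (a \in S) + 2 * (b \in S) <= eC C (v |: (u |: S)) &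
    v |: (u |: S) = setT -> S = ~: Q].
Proof.
have [h1 h2 uv _] := UV_distinct.
move=> SQ dS yS wS.
have uS : u \notin S by apply/negP => /(subsetP SQ); rewrite !inE eqxx.
have vS : v \notin S by apply/negP => /(subsetP SQ); rewrite !inE eqxx orbT.
have [||k1 g1] := @addv _ _ K u (filter (mem S) [:: a; b; d]) _ uS.
- by apply: filter_uniq; apply: (subseq_uniq _ h1); exact: (prefix_subseq [:: a; b; d] [:: v]).
- by move=> t; rewrite mem_filter => /andP [].
have m2 : v \notin u |: S by rewrite !inE negb_or eq_sym uv.
have [||k2 g2] := @addv _ _ K v [:: u; y; w] _ m2; first exact: h2.
- by apply: sub_list; rewrite /= !inE eqxx yS wS !orbT.
split; [by alia| |].
- rewrite !big_cons !big_nil in g2; move: g1; rewrite big_filter !big_cons big_nil /= dS.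
  by case: (a \in S); case: (b \in S); alia.
move=> ST; apply/setP => t; rewrite !inE negb_or; move/setP/(_ t): ST; rewrite !inE.
case: (eqVneq t v) => [->|_]; first by rewrite (negPf vS) andbF.
by case: (eqVneq t u) => [->|_] //=; rewrite (negPf uS).
Qed.

(** Adding [u] and [v] directly gives 8 + 10 - 12 = 6, one too many, with [a] and [b] outside [X].
    The missing unit comes from a second reduction: colour [X] and [v] so that [u] keeps two
    consecutive colours, contract [X], and forbid at cost 3 that [a] kills either of them; [b] kills
    at most one. *)
Lemma UV_both X : X \subset ~: Q -> d \in X -> y \in X -> w \in X -> 5 * #|X| <= eC C X + 8 -> False.
Proof.
have [h1 h2 uv [aQ bQ dQ yQ wQ]] := UV_distinct; have [dy dw] := UV_dy.
move=> XQ dX yX wX PX; have [k1 k2 k3] := UV_add XQ dX yX wX.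
have [aX bX] : a \notin X /\ b \notin X.
  have H : ~ (a \in X \/ b \in X).
    move=> H; have VT : v |: (u |: X) = setT.
      apply: (trap K); first by alia.
      by rewrite k1; case: H => H; rewrite H in k2; alia.
    have XE := k3 VT; rewrite VT XE aQ bQ -XE in k1 k2.
    by apply: (not_good K); alia.
  by split; apply/negP => h; apply: H; auto.
have uX : u \notin X by apply/negP => /(subsetP XQ); rewrite !inE eqxx.
have vX : v \notin X by apply/negP => /(subsetP XQ); rewrite !inE eqxx orbT.
have vd : v != d by rewrite eq_sym; move: h1; rewrite /= !inE !negb_or => /and4P [].
have au : a != u by move: aQ; rewrite !inE negb_or => /andP [].
have av : a != v by move: aQ; rewrite !inE negb_or => /andP [].
have [M1 r1] := N2_33 cuv cd.
pose l := [:: mdd v d (N2 (C u v) (C u d))].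
have okL : okl C l by split=> //; exact: okm_dd.
(* Otherwise a critical set contains [v] and [d] and has potential at most 3 + 3; with [u] it
   reaches 5, although [a] is missing. *)
have [f fX] : col (addl C l) (v |: X).
  apply: NNPP => nc; have [W2 W2X cW] := uncol_crit nc.
  have uW2 : u \notin W2 by apply/negP => /(subsetP W2X); rewrite !inE (negPf uv) (negPf uX).
  have W2T : W2 <> setT by move=> E; rewrite E inE in uW2.
  have gW : good (addl C l) W2 by case: K => _ IH _ _; apply: IH => //; apply: addl_sym.
  have tW : touch l W2.
    apply: contraT => nt; case: cW => H _; case: H.
    by have [x xW] := proper_col K W2T; exists x; apply: valid_untouch.
  have [eW _] := addl_e W2 sC okL; rewrite /= orbF in tW.
  have kE : kap l W2 = 3 by rewrite /= tW addn0.
  rewrite kE in eW.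
  have [vW dW] := andP tW; rewrite /= in vW dW.
  have [||g1 g2] := @addv _ _ K u [:: v; d] W2 uW2; first by rewrite /= inE vd.
    by apply: sub_list; rewrite /= vW dW.
  rewrite !big_cons big_nil in g2.
  have W22 : 2 <= #|W2|.
    by rewrite ltnNge; apply/negP => W1; case: cW => H _; apply: H; apply: small_col => //; exact: addl_sym.
  have : u |: W2 = setT by apply: (trap K); move: gW; rewrite /good; alia.
  move/setP/(_ a); rewrite !inE (negPf au) /= => /(subsetP W2X).
  by rewrite !inE (negPf av) (negPf aX).
have [fX1 [fX2 _]] := addl_valid okL fX.
move: fX2; rewrite /touched /= !inE eqxx dX orbT => /(_ isT).
have -> : sub5 (f v) (f d) = sub5 (sub5 (f v) (f d)) z0 by rewrite sub5_0.
move=> /N2P /(two_common cuv cd) [o /and4P [o1 o2 o3 o4]].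
have [M [cM rM HM]] := two_kill o ca.
have fX' : valid C f X by move=> t t' tX t'X; apply: fX1; apply: setU1r.
pose l2 := [:: mdd a d M].
have ad : a != d by apply: contraNneq aX => ->.
have ok2 : okl (con C X d f) l2 by split=> //; exact: okm_dd.
have [||W [WR W2 tW H]] := con_reduce K dX fX' XQ ok2.
- by left; move/setP/(_ u); rewrite !inE eqxx.
- move=> x xS ex; rewrite /= /touched /= !inE eqxx (negPf aX) (negPf ad) /= => -[].
  have aQ' := aQ; rewrite !inE in aQ'; rewrite aQ' => /(_ isT) /HM [m1 m2] _.
  apply: (uncolT K).
  have xy := ex y yX; have xw := ex w wX.
  have vy : mem5 (F5 (C v y) (x y)) (add5 (x d) (sub5 (f v) (f d))).
    rewrite mem_F5; have := fX1 v y; rewrite !inE eqxx yX orbT => /(_ isT isT).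
    by rewrite -(sub5_move (f v) xy).
  have vw : mem5 (F5 (C v w) (x w)) (add5 (x d) (sub5 (f v) (f d))).
    rewrite mem_F5; have := fX1 v w; rewrite !inE eqxx wX orbT => /(_ isT isT).
    by rewrite -(sub5_move (f v) xw).
  have good t : mem5 (F5 (C u v) (sub5 (f v) (f d))) t -> mem5 (F5 (C u d) z0) t ->
      ~~ mem5 (C u a) (sub5 t (sub5 (x a) (x d))) -> ~~ mem5 (C u b) (sub5 (add5 t (x d)) (x b)) -> col C setT.
    rewrite !mem_F5 sub5_0 => g1 g2 g3 g4.
    apply: (@UV_ext x (add5 t (x d)) (add5 (x d) (sub5 (f v) (f d))) xS).
    + by rewrite !mem_F5 add5K g2 g4 sub5_addl g3.
    + by rewrite vy vw.
    by rewrite sub5_addr add5K.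
  have cb1 := cost2_card cb.
  case: (boolP (mem5 (C u b) (sub5 (add5 o (x d)) (x b)))) => ob; last exact: (good o).
  apply: (good (suc5 o)) => //; apply/negP => ob'.
  have := cb1; move: ob ob'; case: (C u b) => [[] [] [] [] []] //; by case: o {o1 o2 o3 o4 HM m1 m2 good}; case: (x d); case: (x b).
move: tW H; rewrite /= /touched /= orbF.
case: (boolP (d \in W)) => dW; last by rewrite andbF.
move=> _ [Y [WE YR Y0 PY]].
have YX : [disjoint Y & X].
  by apply: (disjointWl YR); rewrite -setI_eq0; apply/eqP/setP => t; rewrite !inE; case: (t \in X); rewrite ?andbF.
have SQ : Y :|: X \subset ~: Q.
  by rewrite subUset XQ andbT; apply: (subset_trans YR); exact: subsetDl.
have [s1 s2 s3] := UV_add SQ (S := Y :|: X) ltac:(by rewrite inE dX orbT) ltac:(by rewrite inE yX orbT) ltac:(by rewrite inE wX orbT).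
have aY : (a \in W) = (a \in Y) by rewrite WE !inE (negPf ad).
have aYX : (a \in Y :|: X) = (a \in Y) by rewrite inE (negPf aX) orbF.
have bYX : (b \in Y :|: X) = (b \in Y) by rewrite inE (negPf bX) orbF.
rewrite andbT aY !addn0 cM rM in PY; rewrite aYX bYX in s2.
(* The cost 3 at [a, d] is charged only if [a] is in [Y], and then [u] has the further cost 2 at
   [a]: 8 - 2 + 3 + 10 - 12 - 2 = 5. *)
have VT : v |: (u |: (Y :|: X)) = setT.
  apply: (trap K); first by alia.
  by case: (a \in Y) PY s2; alia.
have SE := s3 VT; rewrite VT in s1 s2.
have aY1 : a \in Y by rewrite -aYX SE.
have bY1 : b \in Y by rewrite -bYX SE.
rewrite aY1 bY1 /= in PY s2.
case: PY => [PY|[PY rY]]; first by apply: (not_good K); alia.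
have YC t : t \in Y -> 3 <= aN C t Y + (deg (wadj C) t X + deg (wadj C) t Q).
  move=> tY; have -> : deg (wadj C) t X + deg (wadj C) t Q = aN C t (~: Y).
    rewrite -degU; last first.
      by rewrite -setI_eq0; apply/eqP/setP => z; rewrite !inE; case: (eqVneq z u) => [->|_]; rewrite ?(negPf uX) //; case: (eqVneq z v) => [->|_]; rewrite ?(negPf vX) ?andbF.
    congr (deg _ _ _); apply/setP => z; move/setP/(_ z): SE; rewrite !inE.
    case: (boolP (z \in Y)) => zY /=; last by case: (z \in X) => /=; [|move/esym/negbFE].
    by rewrite (disjointFr YX zY) /= => /esym /negPf.
  exact: (aN_ge K).
have S3 : 3 * #|Y| <= (aC C Y).*2 + (cross (wadj C) Y X + cross (wadj C) Y Q).
  rewrite /aC -(sum_deg (wadjC sC) (wadj0 sC)) /cross -!big_split /= mulnC -sum_nat_const.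
  by apply: leq_sum => t; exact: YC.
have cQ : cross (wadj C) Y Q = 2.
  rewrite (crossC (wadjC sC)) /cross big_setU1 ?inE //= big_set1 -!/(aN _ _ _).
  rewrite (aN_count _ nu) (aN_count _ nv) /= aY1 bY1.
  have nY t : t \in Q -> t \in Y = false.
    by move=> tQ; apply/negP => /(subsetP YR); rewrite inE inE tQ andbF.
  by rewrite (disjointFl YX dX) (disjointFl YX yX) (disjointFl YX wX) !nY // !inE eqxx ?orbT.
have ar : aC C Y <= rC C Y by apply: leq_ew => t z; exact: wadj_runs.
have cr : cross (wadj C) Y X <= cross (wruns C) Y X.
  by apply: leq_sum => t _; apply: leq_deg => z z'; exact: wadj_runs.
have aB := aC_bound K Y.
have Y2 : 2 <= #|Y|.
  have ab : a != b by move: h1; rewrite /= !inE !negb_or => /and4P [/and3P []].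
  have : #|[set a; b]| <= #|Y| by apply: subset_leq_card; apply/subsetP => t; rewrite !inE => /orP [] /eqP ->.
  by rewrite cards2 ab.
(* The runs and the degrees give [2 * #|Y| - 2 <= aC C Y <= #|Y|], and two vertices would then need
   two pairs. *)
have Y2' : #|Y| = 2 by alia.
rewrite Y2' in aB S3 rY; alia.
Qed.

(** Arcs of two are translates, so the colour [x d + s] of [v] forbids for [u] exactly what [d]
    forbids, and [u] keeps 5 - 1 - 1 - 2 = 1 colour. Only [y] and [w] can prevent this colour of
    [v]; keeping them from it costs 3 each, and the critical set obtained is a pair formed by [d]
    and one of them. *)
Lemma D_aligned : alig u v d y \/ alig u v d w.
Proof.
have [h1 h2 uv [aQ bQ dQ yQ wQ]] := UV_distinct; have [dy dw] := UV_dy.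
have yw : y != w by move: h2; rewrite /= !inE !negb_or => /and3P [].
have [s Hs] := arc_shift cuv cd.
pose Ny := shift5 (C v y) (opp5 s); pose Nw := shift5 (C v w) (opp5 s).
have [cy ry] : cost Ny = 3 /\ runs Ny = 1 by rewrite cost_shift runs_shift (cost3_runs cvy).
have [cw rw] : cost Nw = 3 /\ runs Nw = 1 by rewrite cost_shift runs_shift (cost3_runs cvw).
pose l := [:: mdd d y Ny; mdd d w Nw].
have okL : okl C l by split; [|split=> //]; exact: okm_dd.
have [||W [[WR W2 WT] tW [cW gW]]] := reduce (R := ~: Q) K okL.
- by move/setP/(_ u); rewrite !inE eqxx.
- move=> x xS; rewrite /= /touched /= dQ yQ wQ => [[/(_ isT) r1 [/(_ isT) r2 _]]].
  rewrite !mem_mk5 !sub5_opp in r1 r2.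
  have g1 := card_F5 (C u a) (x a); have g2 := card_F5 (C u b) (x b); have g3 := card_F5 (C u d) (x d).
  rewrite (cost2_card ca) in g1; rewrite (cost2_card cb) in g2; rewrite (cost3_card cd) in g3.
  have g4 := card_cap (F5 (C u a) (x a)) (F5 (C u b) (x b)).
  have g5 := card_cap (cap5 (F5 (C u a) (x a)) (F5 (C u b) (x b))) (F5 (C u d) (x d)).
  have [|t] := @card5_gt0 (cap5 (cap5 (F5 (C u a) (x a)) (F5 (C u b) (x b))) (F5 (C u d) (x d))); first by alia.
  rewrite !mem_cap => /andP [/andP [t1 t2] t3].
  apply: (@UV_ext x t (add5 (x d) s) xS).
  + by rewrite t1 t2 t3.
  + by rewrite !mem_F5 r1 r2.
  by rewrite sub5_addr Hs -mem_F5.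
move: gW; rewrite /= /touched /= !addn0 cy cw ry rw.
have T := @trap _ _ K W W2; have {}T : ~ (5 * #|W| <= eC C W + 5) by move=> H; apply: WT; apply: T.
have sD := addl_sym sC okL.
have E4 := e_le_4r K W.
have ne : [set d; y] != [set d; w].
  by apply/eqP => /setP /(_ y); rewrite !inE eqxx [y == d]eq_sym (negPf dy) (negPf yw).
case: (boolP ((d \in W) && (y \in W))) => [/andP [dW yW]|_]; case: (boolP ((d \in W) && (w \in W))) => [/andP [dW' wW]|_] gW.
- exfalso; apply: (UV_both WR dW yW wW).
  have W3 : 3 <= #|W|.
    rewrite -(card3 dy dw yw); apply: subset_leq_card.
    by apply/subsetP => t; rewrite !inE => /orP [/orP []|] /eqP ->.
  alia.
- left; have DE : addl C l d y = cup5 (C d y) Ny by rewrite /= addp_pq /= addp_other.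
  have [||k1 k2 k3] := trapped_pair sD cW dy DE dW yW; [by alia|by alia|].
  by split=> //; exists s.
- have dW := dW'.
  right; have DE : addl C l d w = cup5 (C d w) Nw.
    by rewrite /= addp_other /= ?addp_pq // eq_sym.
  have [||k1 k2 k3] := trapped_pair sD cW dw DE dW wW; [by alia|by alia|].
  by split=> //; exists s.
- by alia.
Qed.

End D_aligned.

End MinCex.

(** * Colouring an aligned square *)

Definition arc k t := eq5 t k || eq5 t (suc5 k).

Lemma cost2_one A : cost A = 2 -> exists i, forall t, mem5 A t = eq5 t i.
Proof.
have := allsP (f := fun A => cost A == 2 =>> ex5 (fun i => all5 (fun t => mem5 A t == eq5 t i)))
  ltac:(by vm_compute) A.
move=> H h; move: H; rewrite h eqxx => /ex5P [i /all5P H]; exists i => t; exact/eqP.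
Qed.

Lemma cost3_arc A : cost A = 3 -> exists k, forall t, mem5 A t = arc z0 (sub5 t k).
Proof.
have := allsP (f := fun A => cost A == 3 =>> ex5 (fun k => all5 (fun t => mem5 A t == arc z0 (sub5 t k))))
  ltac:(by vm_compute) A.
move=> H h; move: H; rewrite h eqxx => /ex5P [i /all5P H]; exists i => t; exact/eqP.
Qed.

(** After translating the colours of each vertex, three sides of the square [u, v, y, d] forbid the
    differences 0 and 1, while the fourth, [d, y], allows exactly these by alignment. The outside
    kills [i] and [j] at [u], and [k1], [k2], [k3] locate the arcs it forbids at [v], [y], [d]. *)
Lemma square_table i j k1 k2 k3 : exists tu tv ty td,
  [/\ tu <> i, tu <> j, ~~ arc z0 (sub5 tv k1), ~~ arc z0 (sub5 ty k2) & ~~ arc z0 (sub5 td k3)] /\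
  [/\ ~~ arc z0 (sub5 tu td), ~~ arc z0 (sub5 tu tv), ~~ arc z0 (sub5 tv ty) & arc z0 (sub5 td ty)].
Proof.
have : all5 (fun i => all5 (fun j => all5 (fun k1 => all5 (fun k2 => all5 (fun k3 =>
  ex5 (fun ty => ~~ arc z0 (sub5 ty k2) && ex5 (fun td => (~~ arc z0 (sub5 td k3) && arc z0 (sub5 td ty)) &&
  ex5 (fun tv => (~~ arc z0 (sub5 tv k1) && ~~ arc z0 (sub5 tv ty)) && ex5 (fun tu =>
  [&& ~~ eq5 tu i, ~~ eq5 tu j, ~~ arc z0 (sub5 tu td) & ~~ arc z0 (sub5 tu tv)])))))))))
  by vm_compute.
move/all5P => /(_ i) /all5P /(_ j) /all5P /(_ k1) /all5P /(_ k2) /all5P /(_ k3).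
case/ex5P => ty /andP [h1 /ex5P [td /andP [/andP [h2 h3] /ex5P [tv /andP [/andP [h4 h5] /ex5P [tu /and4P [h6 h7 h8 h9]]]]]]].
by exists tu, tv, ty, td; split=> //; split=> //; apply/eq5P.
Qed.

Lemma full_disj A B d : cost A = 4 -> runs A = 1 -> cost B = 3 -> fullb (cup5 A B) ->
  mem5 B d -> ~~ mem5 A d.
Proof.
have := allsP (f := fun A => alls (fun B => cost A == 4 =>> runs A == 1 =>> cost B == 3 =>>
  fullb (cup5 A B) =>> all5 (fun d => mem5 B d ==> ~~ mem5 A d))) ltac:(by vm_compute) A.
move/allsP => /(_ B) H h1 h2 h3 h4; move: H; rewrite h1 h2 h3 h4 => /all5P /(_ d) /implyP.
exact.
Qed.

Lemma sub5_subr a b c : sub5 a (sub5 b c) = add5 (sub5 a b) c.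
Proof. by case: a; case: b; case: c. Qed.
Lemma sub5_DD a b c : sub5 (add5 a c) (add5 b c) = sub5 a b.
Proof. by case: a; case: b; case: c. Qed.
Lemma trans1 t t' s k : sub5 (add5 (sub5 t (sub5 (add5 t' s) k)) s) k = sub5 t t'.
Proof. by case: t; case: t'; case: s; case: k. Qed.
Lemma trans2 t t' s k : sub5 (add5 (add5 (sub5 t (add5 t' s)) k) s) k = sub5 t t'.
Proof. by case: t; case: t'; case: s; case: k. Qed.

Section MinCex.
Variables (V : finType) (C : V -> V -> s5).
Hypothesis K : mincex C.
Implicit Types (S W R X : {set V}) (x : V -> z5).
Let sC : sym_inst C. Proof. by case: K. Qed.
Local Notation N := (N C).
Local Notation c := (c C).
Local Notation nbs := (nbs C).
Local Notation isD := (isD C).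

(** Whatever colouring the other vertices receive by minimality, [square_table] extends it to the
    four vertices of the square. *)
Lemma no_aligned_square u a b d v y w y2 t : nbs u [:: a; b; d; v] -> c u a = 2 -> c u b = 2 ->
  c u d = 3 -> isD v u y w -> alig C u v d y ->
  nbs y [:: v; d; y2] -> c y y2 = 3 -> nbs d [:: u; y; t] -> c d t = 3 -> False.
Proof.
move=> nu ca cb cd Dv [cdy rdy [s [Hs Hf]]] ny cy2 nd cdt.
have [nv cvu cvy cvw] := Dv.
have cuv : c u v = 3 by rewrite cC.
have [h1 h2 uv [aQ bQ dQ yQ wQ]] := UV_distinct K nu Dv; have [dy dw] := UV_dy K nu cd Dv.
have [u3 _] := ny; have [u4 _] := nd; rewrite /= !inE !negb_or in h1 h2 u3 u4.
case/and4P: h1 => [/and3P [ab ad av] /andP [bd bv] dv _].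
case/and3P: h2 => [/andP [uy uw] yw _].
case/and3P: u3 => [/andP [vd vy2] dy2 _]; case/and3P: u4 => [/andP [_ ut] yt _].
have yd := nbs_ne K ny (t := d) ltac:(by rewrite !inE eqxx ?orbT).
have yy2 := nbs_ne K ny (t := y2) ltac:(by rewrite !inE eqxx ?orbT).
have dt := nbs_ne K nd (t := t) ltac:(by rewrite !inE eqxx ?orbT).
have vy := nbs_ne K nv (t := y) ltac:(by rewrite !inE eqxx ?orbT).
have vw := nbs_ne K nv (t := w) ltac:(by rewrite !inE eqxx ?orbT).
have ud := nbs_ne K nu (t := d) ltac:(by rewrite !inE eqxx ?orbT).
have ua := nbs_ne K nu (t := a) ltac:(by rewrite !inE eqxx ?orbT).
have ub := nbs_ne K nu (t := b) ltac:(by rewrite !inE eqxx ?orbT).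
have uy2 : u != y2.
  apply/eqP => E; subst y2; have : y \in N u by rewrite (N_sym K) (proj2 ny) !inE eqxx !orbT.
  rewrite (proj2 nu) !inE => /or4P [] /eqP E; subst.
  - by move: cy2; rewrite cC // ca.
  - by move: cy2; rewrite cC // cb.
  - by rewrite eqxx in yd.
  - by rewrite eqxx in vy.
have yu : y \notin N u.
  by rewrite (N_sym K) (proj2 ny) !inE !negb_or uv ud uy2.
have ay : a != y by apply: contraNneq yu => <-; rewrite (proj2 nu) !inE eqxx.
have by' : b != y by apply: contraNneq yu => <-; rewrite (proj2 nu) !inE eqxx orbT.
have vt : v != t.
  apply/eqP => E; subst t; have : d \in N v by rewrite (N_sym K) (proj2 nd) !inE eqxx !orbT.
  by rewrite (proj2 nv) !inE ![d == _]eq_sym (negPf ud) (negPf yd) eq_sym (negPf dw).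
pose Q := [set u; v; y; d].
have [x xS] : col C (~: Q) by apply: (proper_col K); move/setP/(_ u); rewrite !inE eqxx.
have [i Hi] := cost2_one ca; have [j Hj] := cost2_one cb.
have [k1 H1] := cost3_arc cd; have [k3 H3] := cost3_arc cvy.
have [kv Hv] := cost3_arc cvw; have [ky Hy] := cost3_arc cy2; have [kd Hd] := cost3_arc cdt.
have H2 z : mem5 (C u v) z = arc z0 (sub5 (add5 z s) k1) by rewrite -H1 -Hs add5K.
have [tu [tv [ty [td [[g1 g2 g3 g4 g5] [g6 g7 g8 g9]]]]]] := square_table
  (add5 i (x a)) (add5 j (x b)) (sub5 (add5 (add5 kv (x w)) k1) s)
  (sub5 (add5 (add5 (add5 ky (x y2)) k3) k1) s) (add5 (add5 kd (x t)) k1).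
(* [T] undoes the translation of the colours at [v]; [y] needs a further shift by [k3], and [d] the
   shift by [k1] alone. *)
pose T z := sub5 (add5 z s) k1.
pose x' := upd (upd (upd (upd x u tu) v (T tv)) y (sub5 (T ty) k3)) d (sub5 td k1).
have xd : x' d = sub5 td k1 by rewrite /x' /upd eqxx.
have xy : x' y = sub5 (T ty) k3 by rewrite /x' /upd (negPf yd) eqxx.
have xv : x' v = T tv by rewrite /x' /upd (negPf vd) (negPf vy) eqxx.
have xu : x' u = tu by rewrite /x' /upd (negPf ud) (negPf uy) (negPf uv) eqxx.
have xo z : z \in ~: Q -> x' z = x z.
  by rewrite !inE !negb_or /x' /upd => /andP [/andP [/andP [/negPf -> /negPf ->] /negPf ->] /negPf ->].
have aO : a \in ~: Q by rewrite !inE !negb_or eq_sym ua av ay ad.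
have bO : b \in ~: Q by rewrite !inE !negb_or eq_sym ub bv by' bd.
have wO : w \in ~: Q by rewrite !inE !negb_or ![w == _]eq_sym uw vw yw dw.
have y2O : y2 \in ~: Q by rewrite !inE !negb_or ![y2 == _]eq_sym uy2 vy2 yy2 dy2.
have tO : t \in ~: Q by rewrite !inE !negb_or ![t == _]eq_sym ut vt yt dt.
have Eua : ~~ mem5 (C u a) (sub5 (x' u) (x' a)).
  rewrite xu (xo a) // Hi; apply/eq5P => E; apply: g1; by rewrite -E sub5K.
have Eub : ~~ mem5 (C u b) (sub5 (x' u) (x' b)).
  rewrite xu (xo b) // Hj; apply/eq5P => E; apply: g2; by rewrite -E sub5K.
have Eud : ~~ mem5 (C u d) (sub5 (x' u) (x' d)) by rewrite xu xd H1 sub5_subr add5K.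
have Euv : ~~ mem5 (C u v) (sub5 (x' u) (x' v)) by rewrite xu xv H2 trans1.
have Evy : ~~ mem5 (C v y) (sub5 (x' v) (x' y)).
  by rewrite xv xy H3 sub5_subr add5K sub5BB sub5_DD.
have Evw : ~~ mem5 (C v w) (sub5 (x' v) (x' w)).
  by rewrite xv (xo w) // Hv /T !sub5_add sub5_addl.
have Eyy2 : ~~ mem5 (C y y2) (sub5 (x' y) (x' y2)).
  by rewrite xy (xo y2) // Hy /T !sub5_add sub5_addl.
have Edt : ~~ mem5 (C d t) (sub5 (x' d) (x' t)).
  by rewrite xd (xo t) // Hd !sub5_add.
have Edy : ~~ mem5 (C d y) (sub5 (x' d) (x' y)).
  apply: (full_disj cdy rdy _ Hf); first by rewrite cost_shift.
  rewrite mem_mk5 xd xy H3 sub5_subr sub5BB.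
  have -> : sub5 (add5 (sub5 td (add5 ty s)) k3) (opp5 s) = add5 (add5 (sub5 td (add5 ty s)) k3) s.
    by case: (add5 (sub5 _ _) _); case: (s).
  by rewrite trans2.
apply: (uncolT K).
have R z z' : ~~ mem5 (C z z') (sub5 (x' z) (x' z')) -> ~~ mem5 (C z' z) (sub5 (x' z') (x' z)).
  by rewrite (proj1 sC z' z) mem_neg.
apply: (ext_set K (x' := x') xS) => [z|z z']; first exact: xo.
move=> zQ; have /or4P : [|| z == u, z == v, z == y | z == d] by move: zQ; rewrite !inE !orbA.
case=> /eqP ->.
- by rewrite (proj2 nu) !inE => /or4P [] /eqP ->.
- by rewrite (proj2 nv) !inE => /or3P [] /eqP -> //; apply: R.
- by rewrite (proj2 ny) !inE => /or3P [] /eqP -> //; apply: R.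
- by rewrite (proj2 nd) !inE => /or3P [] /eqP -> //; apply: R.
Qed.

End MinCex.

(** * Discharging *)

Lemma set_rcons (V : finType) (T : {set V}) v : v \in T ->
  exists s, [/\ size s = #|T|.-1, uniq (rcons s v) & T =i rcons s v].
Proof.
move=> vT; exists (enum (T :\ v)); split.
- by rewrite -cardE (cardsD1 v T) vT.
- by rewrite rcons_uniq mem_enum !inE eqxx enum_uniq.
by move=> u; rewrite mem_rcons inE mem_enum !inE; case: eqVneq => [->|].
Qed.

Section MinCex.
Variables (V : finType) (C : V -> V -> s5).
Hypothesis K : mincex C.
Implicit Types u v d t : V.
Let sC : sym_inst C. Proof. by case: K. Qed.
Local Notation N := (N C).
Local Notation c := (c C).
Local Notation nbs := (nbs C).
Local Notation isD := (isD C).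

Definition T k u := [set t | c u t == k].
Definition dg u := deg (wcost C) u setT.

Lemma cost_cases u t : [\/ c u t = 0, c u t = 2, c u t = 3 | c u t = 4].
Proof.
have := c4 K u t; have := @cost_ge2 (C u t); rewrite cost_emp -/(c u t).
case: (c u t) => [|[|[|[|[|k]]]]] // h; try (by move: (h isT)); move=> _;
by [constructor 1|constructor 2|constructor 3|constructor 4].
Qed.

Lemma dgE u : dg u = 2 * #|N u| + #|T 3 u| + 2 * #|T 4 u| /\
  #|N u| = #|T 2 u| + #|T 3 u| + #|T 4 u|.
Proof.
have cE (P : pred V) : #|[set t | P t]| = \sum_(t in [set: V]) P t.
  by rewrite -sum1dep_card big_mkcond [RHS]big_mkcond /=; apply: eq_bigr => t _; rewrite inE; case: (P t).
have NE : #|N u| = \sum_(t in [set: V]) (c u t != 0).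
  by rewrite -cE; apply: eq_card => t; rewrite inE -cN.
rewrite NE /T !cE /dg /deg; split.
  rewrite !big_distrr -!big_split /=; apply: eq_bigr => t _; rewrite /wcost -/(c u t).
  by case: (cost_cases u t) => ->.
by rewrite -!big_split /=; apply: eq_bigr => t _; case: (cost_cases u t) => ->.
Qed.

Lemma nbs_split u s2 s3 s4 : T 2 u =i s2 -> T 3 u =i s3 -> T 4 u =i s4 ->
  uniq s2 -> uniq s3 -> uniq s4 -> nbs u (s2 ++ s3 ++ s4).
Proof.
move=> e2 e3 e4 u2 u3 u4; split.
  rewrite !cat_uniq u2 u3 u4 /= andbT; apply/andP; split.
    apply/hasPn => t; rewrite mem_cat -e2 -e3 -e4 !inE.
    by case/orP => /eqP ->.
  by apply/hasPn => t; rewrite -e3 -e4 !inE => /eqP ->.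
move=> t; rewrite !mem_cat -e2 -e3 -e4 !inE -mem_N cN.
by case: (cost_cases u t) => ->.
Qed.

Lemma T_enum k u : T k u =i enum (T k u).
Proof. by move=> t; rewrite mem_enum. Qed.

Lemma N3_at a v : #|N a| = 3 -> v \in N a -> exists p q, nbs a [:: v; p; q].
Proof.
move=> n3 vN; have [s [sz us e]] := set_rcons vN; rewrite n3 in sz.
case: s sz us e => [|p [|q []]] //= _ us e; exists p, q.
apply: (@nbs_perm _ _ a [:: p; q; v]); first by rewrite (perm_catC [:: p; q] [:: v]).
by split.
Qed.

Lemma N3_ge3 a p q r : nbs a [:: p; q; r] -> [/\ 3 <= c a p, 3 <= c a q & 3 <= c a r].
Proof.
have H p' q' r' : nbs a [:: p'; q'; r'] -> 3 <= c a r'.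
  move=> n; have := cN2 (C := C) (u := a) (v := r'); rewrite (proj2 n) !inE eqxx !orbT => /(_ isT).
  case: (eqVneq (c a r') 2) => [/(deg3_no_cost2 K n) //|]; alia.
move=> n; split; last exact: H n.
  by apply: (H q r p); apply: nbs_perm n; rewrite (perm_catC [:: p] [:: q; r]).
by apply: (H p r q); apply: nbs_swap.
Qed.

Lemma dg_nbs u s : nbs u s -> dg u = \sum_(t <- s) c u t.
Proof.
move=> [us e]; apply: deg_eq_seq => // [t _|t _ ts]; first by rewrite inE.
apply/eqP; rewrite -[wcost C u t]/(c u t).
by apply: contraR ts; rewrite -cN e.
Qed.

Definition Db v := (#|N v| == 3) && (dg v == 9).

Lemma D_at v u : Db v -> u \in N v -> exists p q, isD v u p q.
Proof.
move=> /andP [/eqP n3 /eqP d9] uN; have [p [q n]] := N3_at n3 uN; exists p, q.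
have := dg_nbs n; have [h1 h2 h3] := N3_ge3 n; rewrite d9 !big_cons big_nil.
by move=> h; split=> //; alia.
Qed.

Definition light v := (#|N v| == 3) && (dg v <= 10).
(** By [dgE] the inequality reads [2 * #|N v| + 2 * #|T 4 v| >= 10]. Since 10 is the balanced value
    of [dg], a rich vertex can afford one unit along each of its pairs of cost 3. *)
Definition rich v := ~~ light v && (dg v >= 10 + #|T 3 v|).
(** Here [dg v = 8 + #|T 3 v|], so three or four pairs cost 3, and the surplus over 10 is two or
    four half units. *)
Definition four v := [&& #|N v| == 4, #|T 4 v| == 0 & 11 <= dg v].

Lemma N3_T2 v : #|N v| = 3 -> #|T 2 v| = 0.
Proof.
move=> n3; apply/eqP; rewrite cards_eq0; apply/eqP/setP => t; rewrite !inE; apply/negP => /eqP ct.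
have tN : t \in N v by rewrite cN ct.
have [p [q n]] := N3_at n3 tN; have [h1 _ _] := N3_ge3 n; alia.
Qed.

Lemma no_2222_count u : #|N u| = 4 -> #|T 3 u| + #|T 4 u| = 0 -> False.
Proof.
move=> n4 t34; have [_ nE] := dgE u.
have t2 : #|T 2 u| = 4 by alia.
have [p [q [r [t E]]]] := size4 (s := enum (T 2 u)) ltac:(by rewrite -cardE).
have e3 : T 3 u =i [::].
  have : #|T 3 u| == 0 by rewrite -leqn0; alia.
  by rewrite cards_eq0 => /eqP -> z; rewrite inE.
have e4 : T 4 u =i [::].
  have : #|T 4 u| == 0 by rewrite -leqn0; alia.
  by rewrite cards_eq0 => /eqP -> z; rewrite inE.
have n := nbs_split (@T_enum 2 u) e3 e4 (enum_uniq _) isT isT; rewrite E /= in n.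
have cc z : z \in [:: p; q; r; t] -> card5 (C u z) = 1.
  by rewrite -E mem_enum inE => /eqP /cost2_card.
have [x xS] := proper_col K (@setC1T _ u).
apply: (uncolT K); apply: (ext_all K n xS).
have g1 := card_F5 (C u p) (x p); have g2 := card_F5 (C u q) (x q).
have g3 := card_F5 (C u r) (x r); have g4 := card_F5 (C u t) (x t).
have h1 := cc p ltac:(by rewrite !inE eqxx ?orbT); have h2 := cc q ltac:(by rewrite !inE eqxx ?orbT).
have h3 := cc r ltac:(by rewrite !inE eqxx ?orbT); have h4 := cc t ltac:(by rewrite !inE eqxx ?orbT).
have i1 := card_cap (F5 (C u p) (x p)) (F5 (C u q) (x q)).
have i2 := card_cap (cap5 (F5 (C u p) (x p)) (F5 (C u q) (x q))) (F5 (C u r) (x r)).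
have i3 := card_cap (cap5 (cap5 (F5 (C u p) (x p)) (F5 (C u q) (x q))) (F5 (C u r) (x r))) (F5 (C u t) (x t)).
have [|z] := @card5_gt0 (cap5 (cap5 (cap5 (F5 (C u p) (x p)) (F5 (C u q) (x q))) (F5 (C u r) (x r))) (F5 (C u t) (x t))); first by alia.
by rewrite !mem_cap => /andP [/andP [/andP [z1 z2] z3] z4]; exists z; rewrite /= z1 z2 z3 z4.
Qed.

Lemma no_2223_count u : #|N u| = 4 -> #|T 4 u| = 0 -> #|T 3 u| = 1 -> False.
Proof.
move=> n4 t4 t3; have [_ nE] := dgE u.
have t2 : #|T 2 u| = 3 by alia.
have [p [q [r E]]] := size3 (s := enum (T 2 u)) ltac:(by rewrite -cardE).
have [d dE] : exists d, enum (T 3 u) = [:: d].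
  by move: t3; rewrite cardE; case: (enum (T 3 u)) => [|d []] // _; exists d.
have e4 : T 4 u =i [::].
  have : #|T 4 u| == 0 by rewrite t4.
  by rewrite cards_eq0 => /eqP -> z; rewrite inE.
have n := nbs_split (@T_enum 2 u) (@T_enum 3 u) e4 (enum_uniq _) (enum_uniq _) isT; rewrite E dE /= in n.
have cc z : z \in [:: p; q; r] -> c u z = 2 by rewrite -E mem_enum inE => /eqP.
have cd : c u d = 3 by apply/eqP; have : d \in enum (T 3 u) by [rewrite dE inE]; rewrite mem_enum inE.
by apply: (no_2223 K n) => //; apply: cc; rewrite !inE eqxx ?orbT.
Qed.

(** With three neighbours no cost is 2, so 9 is reached only by type [D]; with four neighbours the
    types (2,2,2,2) and (2,2,2,3) are excluded. *)
Lemma dg_ge10 u : ~~ Db u -> 10 <= dg u.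
Proof.
have [dE nE] := dgE u; have := degree_ge3 K u; have := @no_2222_count u; have := @no_2223_count u; have := @N3_T2 u.
rewrite /Db negb_and; case: (eqVneq #|N u| 3) => [n3|n3] /=.
  by move=> /(_ n3) h _ _ _ d9; alia.
move=> _ h1 h2 h3 _.
case: (eqVneq #|N u| 4) => n4; last by alia.
case: (posnP #|T 4 u|) => t4; last by alia.
case: (posnP #|T 3 u|) => t3; first by case: h2 => //; alia.
case: (eqVneq #|T 3 u| 1) => t3'; first by case: h1.
alia.
Qed.

(** Five neighbours make a vertex rich, and so do four with a pair of cost 4; with three neighbours,
    failing to be light means two pairs of cost 4, again rich. *)
Lemma poor_class u : ~~ rich u -> ~~ light u -> #|N u| = 4 /\ #|T 4 u| = 0.
Proof.
rewrite /rich => + nl; rewrite nl /= -ltnNge => r.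
have [dE nE] := dgE u; have := degree_ge3 K u; have := @N3_T2 u; move: nl; rewrite /light.
case: (eqVneq #|N u| 3) => [n3|n3] /=; first by rewrite -ltnNge => h /(_ n3); alia.
move=> _ _; alia.
Qed.

Lemma light_at a v : light a -> v \in N a -> c a v = 3 ->
  exists p q, nbs a [:: v; p; q] /\ lt2 (C a p) (C a q).
Proof.
move=> /andP [/eqP n3 d10] vN cv; have [p [q n]] := N3_at n3 vN; exists p, q; split=> //.
have [_ h2 h3] := N3_ge3 n; move: d10; rewrite (dg_nbs n) !big_cons big_nil cv.
rewrite /lt2 -!/(c _ _) h2 h3 /=; alia.
Qed.

(* The vertex [v] of type [D] gives half a unit to each of [t1] and [t2]. When
   [t1 = t2], the gift is charged to the pair [t1, e] of cost 3, and no such pair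
   is charged twice. *)
Definition target v (t1 t2 e : V) :=
  [\/ [/\ t1 = t2, rich t1, c t1 v = 3 & e = v],
      [/\ t1 = t2, rich t1, c t1 e = 3 & T 3 e = [set t1; v] /\ t1 != v /\ #|N e| = 4] |
      [/\ t1 <> t2, four t1, four t2, c t1 v = 3 & c t2 v = 3]].

(** By [light_pair] at most one of the three neighbours is light. *)
Lemma four_nbrs v x y z : isD v x y z ->
  (forall t, t \in N v -> light t || four t) ->
  exists t1 t2, [/\ t1 <> t2, four t1, four t2, c t1 v = 3 & c t2 v = 3].
Proof.
move=> Dv H; have [n cx cy cz] := Dv.
have NE := proj2 n.
have lf t : t \in [:: x; y; z] -> light t || four t by rewrite -NE; exact: H.
have two a b r : isD v a b r -> ~~ (light a && light b).
  move=> [n' ca cb cr]; apply/negP => /andP [la lb].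
  have cav : c a v = 3 by rewrite cC.
  have cbv : c b v = 3 by rewrite cC.
  have [|p [q [na l1]]] := light_at la _ cav; first by rewrite cN cav.
  have [|p' [q' [nb l2]]] := light_at lb _ cbv; first by rewrite cN cbv.
  exact: (light_pair K n' ca cb cr na nb l1 l2).
have [un _] := n; rewrite /= !inE !negb_or in un; case/and3P: un => [/andP [xy xz] yz _].
have D2 : isD v x z y by split=> //; exact: nbs_swap.
have D3 : isD v y z x by split=> //; apply: nbs_perm n; rewrite (perm_catC [:: x] [:: y; z]).
have := lf x ltac:(by rewrite !inE eqxx ?orbT); have := lf y ltac:(by rewrite !inE eqxx ?orbT).
have := lf z ltac:(by rewrite !inE eqxx ?orbT).
have := two _ _ _ Dv; have := two _ _ _ D2; have := two _ _ _ D3.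
have cxv : c x v = 3 by rewrite cC. have cyv : c y v = 3 by rewrite cC. have czv : c z v = 3 by rewrite cC.
case: (boolP (light x)) => lx; case: (boolP (light y)) => ly; case: (boolP (light z)) => lz //=.
- by move=> _ _ _ fz fy _; exists y, z; split=> //; apply/eqP.
- by move=> _ _ _ fz fy fx; exists x, z; split=> //; apply/eqP.
- by move=> _ _ _ fz fy fx; exists x, y; split=> //; apply/eqP.
by move=> _ _ _ fz fy fx; exists x, y; split=> //; apply/eqP.
Qed.

(** The pair [d, y] costs 4, so by [poor_class] each of its ends is rich or light. Were both light,
    their costs 3 and 4 would leave exactly 3 for the last neighbour, which is the excluded
    square. *)
Lemma square_rich u a b d v y w : nbs u [:: a; b; d; v] -> c u a = 2 -> c u b = 2 ->
  c u d = 3 -> isD v u y w -> alig C u v d y -> ~~ rich y -> rich d.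
Proof.
move=> nu ca cb cd Dv al nry; have [cdy _ _] := al.
have [nv cvu cvy cvw] := Dv.
have [h1 _ _ _] := UV_distinct K nu Dv; rewrite /= !inE !negb_or in h1; case/and4P: h1 => [_ _ dv _].
have cyd : c y d = 4 by rewrite cC.
have cyv : c y v = 3 by rewrite cC.
have cdu : c d u = 3 by rewrite cC.
have T4_pos t t' : c t t' = 4 -> 0 < #|T 4 t| by move=> h; apply/card_gt0P; exists t'; rewrite inE h.
have ly : light y.
  apply: contraT => nl; have [_ t4] := poor_class nry nl.
  by have := T4_pos _ _ cyd; rewrite t4.
apply: contraT => nrd.
have ld : light d.
  apply: contraT => nl; have [_ t4] := poor_class nrd nl.
  by have := T4_pos _ _ cdy; rewrite t4.
have third z p q : light z -> p \in N z -> q \in N z -> p != q -> c z p = 3 -> c z q = 4 ->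
    exists r, nbs z [:: p; q; r] /\ c z r = 3.
  move=> lz pN qN pq cp cq; have [p' [q' [n l2]]] := light_at lz pN cp.
  have := qN; rewrite (proj2 n) !inE eq_sym (negPf pq) /=.
  case/and3P: l2; rewrite -!/(c _ _) => l1 l2 l3.
  case/orP => /eqP E; subst.
    by exists q'; split=> //; alia.
  by exists p'; split; [exact: nbs_swap|alia].
have [|||y2 [ny cy2]] := third y v d ly _ _ _ cyv cyd; try by rewrite cN ?cyv ?cyd.
  by rewrite eq_sym.
have uy : u != y.
  by have [uv _] := nv; move: uv; rewrite /= !inE !negb_or => /and3P [/andP []].
have [||t [nd cdt]] := third d u y ld _ _ uy cdu cdy; try by rewrite cN ?cdu ?cdy.
by case: (no_aligned_square K nu ca cb cd Dv al ny cy2 nd cdt).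
Qed.

(** When no neighbour is rich and some neighbour [u] is neither light nor [four], [u] has type
    (2,2,3,3); the gift then comes through [u] from its other neighbour [d] of cost 3, which is rich
    by alignment. *)
Lemma target_ex v : Db v -> exists t1 t2 e, target v t1 t2 e.
Proof.
move=> Dbv; have /andP [/eqP n3 _] := Dbv.
have cv3 t : t \in N v -> c t v = 3.
  by move=> tN; have [p [q [_ h _ _]]] := D_at Dbv tN; rewrite cC.
case: (classic (exists2 t, t \in N v & rich t)) => [[t tN rt]|nr].
  by exists t, t, v; constructor 1; split=> //; exact: cv3.
have nrich t : t \in N v -> ~~ rich t by move=> tN; apply/negP => rt; apply: nr; exists t.
case: (classic (exists u, [/\ u \in N v, ~~ light u & ~~ four u])) => [[u [uN nl nf]]|nu].
  have [n4 t4] := poor_class (nrich u uN) nl.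
  have [dE nE] := dgE u; have cuv := cv3 u uN.
  have vT : v \in T 3 u by rewrite inE cuv.
  have t3 : #|T 3 u| = 2.
    have : 0 < #|T 3 u| by apply/card_gt0P; exists v.
    move: nf; rewrite /four n4 t4 !eqxx /= -ltnNge => d11.
    have := @no_2223_count u n4 t4; case: (eqVneq #|T 3 u| 1) => [h /(_ h) //|h _ h0]; alia.
  have t2 : #|T 2 u| = 2 by alia.
  have [s [sz us eT]] := set_rcons vT; rewrite t3 in sz.
  case: s sz us eT => [|d []] //= _ us eT.
  have [a [b abE]] : exists a b, enum (T 2 u) = [:: a; b].
    by move: t2; rewrite cardE; case: (enum (T 2 u)) => [|a [|b []]] // _; exists a, b.
  have e4 : T 4 u =i [::].
    have : #|T 4 u| == 0 by rewrite t4.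
    by rewrite cards_eq0 => /eqP -> z; rewrite inE.
  have n := nbs_split (@T_enum 2 u) eT e4 (enum_uniq _) us isT; rewrite abE /= in n.
  have ca : c u a = 2 by apply/eqP; have : a \in enum (T 2 u) by [rewrite abE inE eqxx]; rewrite mem_enum inE.
  have cb : c u b = 2 by apply/eqP; have : b \in enum (T 2 u) by [rewrite abE !inE eqxx orbT]; rewrite mem_enum inE.
  have cd : c u d = 3 by apply/eqP; have := eT d; rewrite !inE eqxx.
  have [y [w Dv]] := D_at Dbv uN.
  have rd : rich d.
    have [nv c1 c2 c3] := Dv.
    case: (D_aligned K n ca cb cd Dv) => al.
      by apply: (square_rich n ca cb cd Dv al); apply: nrich; rewrite (proj2 nv) !inE eqxx orbT.
    have Dv' : isD v u w y by split=> //; exact: nbs_swap.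
    by apply: (square_rich n ca cb cd Dv' al); apply: nrich; rewrite (proj2 nv) !inE eqxx !orbT.
  exists d, d, u; constructor 2; split=> //; first by rewrite cC.
  split; first by apply/setP => z; rewrite eT !inE.
  by split=> //; move: us; rewrite inE andbT.
have [u uN] : exists u, u \in N v by apply/card_gt0P; rewrite n3.
have [p [q Dv]] := D_at Dbv uN.
have [t tN|t1 [t2 h]] := four_nbrs Dv.
  by apply: contraT; rewrite negb_or => /andP [nl nf]; case: nu; exists t.
by exists t1, t2, v; constructor 3.
Qed.

(** [r u] counts the half units that [u] gives. A vertex not of type [D] keeps at least 10, while a
    vertex [D] gives nothing and receives two halves on top of 9; the sum is
    [5 * #|V| <= eC C setT]. *)
Lemma discharge : False.
Proof.
have [f fP] : exists f : V -> V * V * V, forall v, Db v -> target v (f v).1.1 (f v).1.2 (f v).2.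
  have H v : exists p : V * V * V, Db v -> target v p.1.1 p.1.2 p.2.
    case: (boolP (Db v)) => [/target_ex [t1 [t2 [e h]]]|_]; first by exists (t1, t2, e).
    by exists (v, v, v).
  by have [f Hf] := fin_all_exists H; exists f.
pose D := [set v | Db v].
pose r u := \sum_(v in D) (((f v).1.1 == u) + ((f v).1.2 == u)).
have rsum : \sum_(u in [set: V]) r u = 2 * #|D|.
  have one w : \sum_(u in [set: V]) (w == u : nat) = 1.
    rewrite (bigD1 w) ?inE //= eqxx big1 // => u /andP [_ uw].
    by rewrite eq_sym (negPf uw).
  rewrite /r exchange_big /= (eq_bigr (fun=> 2)) ?sum_nat_const 1?mulnC // => v _.
  by rewrite big_split /= !one.
have noD u : Db u -> r u = 0.
  move=> Du; rewrite /r big1 // => v; rewrite inE => Dv.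
  have /andP [/eqP n3 /eqP d9] := Du.
  have lu : light u by rewrite /light n3 d9.
  have nr : ~~ rich u by rewrite /rich lu.
  have nf : ~~ four u by rewrite /four n3.
  case: (fP v Dv) => [[<- r1 _ _]|[<- r1 _ _]|[_ f1 f2 _ _]].
  - by case: eqP => // E; rewrite E (negPf nr) in r1.
  - by case: eqP => // E; rewrite E (negPf nr) in r1.
  by case: eqP => [E|_]; [rewrite E (negPf nf) in f1|case: eqP => // E; rewrite E (negPf nf) in f2].
have bound u : ~~ Db u -> r u + 20 <= 2 * dg u.
  move=> nD; have d10 := dg_ge10 nD.
  case: (boolP (rich u)) => [ru|nr].
    have nf : ~~ four u.
      apply/negP => /and3P [/eqP n4 /eqP t4 _]; have [dE _] := dgE u.
      by have /andP [_] := ru; rewrite dE n4 t4; alia.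
    have r2 : r u = 2 * #|[set v | Db v && ((f v).1.1 == u)]|.
      rewrite /r -sum1dep_card big_distrr /= big_mkcond [RHS]big_mkcond /=; apply: eq_bigr => v _.
      rewrite inE /=; case: (boolP (Db v)) => //= Dv.
      case: (fP v Dv) => [[<- _ _ _]|[<- _ _ _]|[_ f1 f2 _ _]]; try by case: eqP.
      by case: eqP => [E|_]; [rewrite E (negPf nf) in f1|case: eqP => // E; rewrite E (negPf nf) in f2].
    (* The recorded vertex [e] is either [v] itself, with three neighbours, or a vertex with four,
       so the two kinds of charge differ; in the second kind [v] is recovered as the neighbour of
       cost 3 of [e] other than [u]. *)
    have inj : {in [set v | Db v && ((f v).1.1 == u)] &, injective (fun v => (f v).2)}.
      move=> v v'; rewrite !inE => /andP [Dv /eqP Eu] /andP [Dv' /eqP Eu'] /= E.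
      case: (fP v Dv); rewrite Eu; case: (fP v' Dv'); rewrite Eu' -?E.
      - by move=> [_ _ _ ->] [_ _ _ ->].
      - move=> [_ _ _ [_ [_ n4]]] [_ _ _ ev]; move: n4; rewrite ev.
        by have /andP [/eqP -> _] := Dv.
      - by move=> [_ f1 _ _ _]; rewrite f1 in nf.
      - move=> [_ _ _ ev] [_ _ _ [_ [_ n4]]]; move: n4; rewrite ev.
        by have /andP [/eqP -> _] := Dv'.
      - move=> [_ _ _ [T1 [n1 _]]] [_ _ _ [T2 [n2 _]]].
        have : v \in [set u; v'] by rewrite -T1 T2 !inE eqxx orbT.
        by rewrite !inE eq_sym (negPf n2) /= => /eqP.
      - by move=> [_ f1 _ _ _]; rewrite f1 in nf.
      - by move=> _ [_ f1 _ _ _]; rewrite f1 in nf.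
      - by move=> _ [_ f1 _ _ _]; rewrite f1 in nf.
      - by move=> _ [_ f1 _ _ _]; rewrite f1 in nf.
    have : #|[set v | Db v && ((f v).1.1 == u)]| <= #|T 3 u|.
      rewrite -(card_in_imset inj); apply: subset_leq_card; apply/subsetP => e /imsetP [v].
      rewrite !inE => /andP [Dv /eqP Eu] ->.
      case: (fP v Dv); rewrite Eu; [by move=> [_ _ c1 ->]; rewrite c1|by move=> [_ _ c1 _]; rewrite c1|].
      by move=> [_ f1 _ _ _]; rewrite f1 in nf.
    by have /andP [_] := ru; rewrite r2; alia.
  have rD : r u <= #|[set v | Db v && (c u v == 3)]|.
    rewrite /r -sum1dep_card big_mkcond [X in _ <= X]big_mkcond /=; apply: leq_sum => v _.
    rewrite inE /=; case: (boolP (Db v)) => //= Dv.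
    case: (fP v Dv) => [[<- r1 _ _]|[<- r1 _ _]|[ne f1 f2 c1 c2]].
    - by case: eqP => [E|_]; [rewrite E (negPf nr) in r1|exact: leq0n].
    - by case: eqP => [E|_]; [rewrite E (negPf nr) in r1|exact: leq0n].
    case: (eqVneq _ u) => [E1|_]; case: (eqVneq _ u) => [E2|_] //=.
    - by case: ne; rewrite E1 E2.
    - by rewrite -E1 c1.
    by rewrite -E2 c2.
  case: (boolP (four u)) => [/and3P [/eqP n4 /eqP t4 d11]|nf]; last first.
    suff -> : r u = 0 by alia.
    rewrite /r big1 // => v; rewrite inE => Dv.
    case: (fP v Dv) => [[<- r1 _ _]|[<- r1 _ _]|[_ f1 f2 _ _]].
    - by case: eqP => // E; rewrite E (negPf nr) in r1.
    - by case: eqP => // E; rewrite E (negPf nr) in r1.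
    by case: eqP => [E|_]; [rewrite E (negPf nf) in f1|case: eqP => // E; rewrite E (negPf nf) in f2].
  have [dE nE] := dgE u.
  have sub : [set v | Db v && (c u v == 3)] \subset T 3 u.
    by apply/subsetP => v; rewrite !inE => /andP [].
  have cs := subset_leq_card sub.
  case: (ltnP #|T 3 u| 4) => t3; last by alia.
  have t3' : #|T 3 u| = 3 by alia.
  have t2 : #|T 2 u| = 1 by alia.
  (* With three pairs of cost 3 the surplus is two halves, so these pairs must not all lead to
     vertices of type [D]. *)
  suff : #|[set v | Db v && (c u v == 3)]| < #|T 3 u| by alia.
  rewrite ltn_neqAle cs andbT; apply/eqP => E.
  have ET : [set v | Db v && (c u v == 3)] = T 3 u by apply/eqP; rewrite eqEcard sub E leqnn.
  have [a aE] : exists a, enum (T 2 u) = [:: a].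
    by move: t2; rewrite cardE; case: (enum (T 2 u)) => [|a []] // _; exists a.
  have [v1 [v2 [v3 vE]]] := size3 (s := enum (T 3 u)) ltac:(by rewrite -cardE).
  have e4 : T 4 u =i [::].
    have : #|T 4 u| == 0 by rewrite t4.
    by rewrite cards_eq0 => /eqP -> z; rewrite inE.
  have n := nbs_split (@T_enum 2 u) (@T_enum 3 u) e4 (enum_uniq _) (enum_uniq _) isT; rewrite aE vE /= in n.
  have ca : c u a = 2 by apply/eqP; have : a \in enum (T 2 u) by [rewrite aE inE]; rewrite mem_enum inE.
  have HD w : w \in [:: v1; v2; v3] -> c u w = 3 /\ exists p q, isD w u p q.
    rewrite -vE mem_enum -ET inE => /andP [Dw /eqP cw]; split=> //.
    by apply: D_at => //; rewrite cN cC // cw.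
  have [c1 [p1 [q1 D1]]] := HD v1 ltac:(by rewrite !inE eqxx ?orbT).
  have [c2 [p2 [q2 D2]]] := HD v2 ltac:(by rewrite !inE eqxx ?orbT).
  have [c3 [p3 [q3 D3]]] := HD v3 ltac:(by rewrite !inE eqxx ?orbT).
  exact: (no_2DDD K n ca c1 c2 c3 D1 D2 D3).
have total : \sum_(u in [set: V]) (r u + 20) <= \sum_(u in [set: V]) (2 * dg u + 2 * Db u).
  apply: leq_sum => u _; case: (boolP (Db u)) => Du; last by rewrite muln0 addn0; apply: bound.
  by rewrite noD //; have /andP [_ /eqP ->] := Du.
move: total; rewrite !big_split /= rsum !sum_nat_const.
have -> : \sum_(u in [set: V]) dg u = (eC C setT).*2 := sum_deg (wcostC sC) (wcost0 sC) _.
have -> : \sum_(u in [set: V]) Db u = #|D|.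
  by rewrite -sum1dep_card big_mkcond [RHS]big_mkcond /=; apply: eq_bigr => t _; rewrite !inE; case: (Db t).
move=> h; apply: (not_good K); alia.
Qed.

End MinCex.

(** * Graphs *)

Section Restrict.
Variables (V : finType) (C : V -> V -> s5) (W : {set V}).
Let U := {x : V | x \in W}.
Definition res (u v : U) := C (val u) (val v).

Lemma res_sym : sym_inst C -> sym_inst res.
Proof. by move=> [sC iC]; split=> [u v|v]; [exact: sC|exact: iC]. Qed.

Lemma res_col (S : {set U}) : col C (val @: S) <-> col res S.
Proof.
split=> [[x xS]|[x xS]].
  by exists (fun u => x (val u)) => u v uS vS; apply: xS; apply: imset_f.
exists (fun u => if insub u is Some u' then x u' else z0) => u v /imsetP [u' uS ->] /imsetP [v' vS ->].
by rewrite !valK; apply: xS.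
Qed.

Lemma val_setT : val @: [set: U] = W.
Proof.
apply/setP => u; apply/imsetP/idP => [[u' _ ->]|uW]; first exact: (valP u').
by exists (Sub u uW).
Qed.

Lemma card_res : #|[set: U]| = #|W|.
Proof. by have := card_imset [set: U] val_inj; rewrite val_setT. Qed.

Lemma res_crit : crit C W -> crit res setT.
Proof.
move=> [nc pc]; split.
  by move/res_col; rewrite val_setT.
move=> S ST; apply/res_col; apply: pc; rewrite properE; apply/andP; split.
  by apply/subsetP => u /imsetP [u' _ ->]; apply: (valP u').
move: ST; rewrite properT; apply: contraNN => WS; rewrite -subTset; apply/subsetP => u _.
by have /(subsetP WS) /imsetP [u' u'S /val_inj ->] := valP u.
Qed.

(** Counting both sides twice, by degrees, avoids comparing [enum_rank] on [U] with [enum_rank] on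
    [V]. *)
Lemma ew_res (w : V -> V -> nat) : (forall x y, w x y = w y x) -> (forall x, w x x = 0) ->
  ew (fun u v : U => w (val u) (val v)) setT = ew w W.
Proof.
move=> wC w0; apply: double_inj; rewrite -!sum_deg //.
have sumE (F : V -> nat) : \sum_(u in [set: U]) F (val u) = \sum_(u in W) F u.
  by rewrite (big_sub W); apply: eq_bigl => u; rewrite inE.
rewrite -sumE; apply: eq_bigr => u _; exact: sumE.
Qed.

Lemma res_good : sym_inst C -> good res setT -> good C W.
Proof.
move=> sC; rewrite /good /eC /rC.
have -> : ew (wcost res) setT = ew (wcost C) W by apply: ew_res; [exact: wcostC|exact: wcost0].
have -> : ew (wruns res) setT = ew (wruns C) W by apply: ew_res; [exact: wrunsC|exact: wruns0].
by rewrite card_res.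
Qed.

End Restrict.

(** Minimal counterexamples are taken critical on their whole type, so [W] is made a type of its own
    by [res]; the induction hypothesis then serves its proper subsets. *)
Lemma crit_good n : forall (V : finType) (C : V -> V -> s5) (W : {set V}),
  #|W| <= n -> sym_inst C -> crit C W -> good C W.
Proof.
elim: n => [|n IH] V C W Wn sC cW.
  case: cW => nc _; case: nc; apply: small_col => //; alia.
apply: res_good => //; apply: NNPP => ng.
apply: (@discharge _ (@res V C W)); split=> //.
- exact: res_sym.
- move=> C' W' sC' W'T cW'; apply: IH => //.
  rewrite -ltnS; apply: leq_trans Wn.
  rewrite -(card_res W).
  by apply: proper_card; rewrite properT; apply/eqP.
exact: res_crit.
Qed.

(** * From constraint instances back to graphs *)

Section Graph.
Variable G : sgraph.

(* Doubling identifies the edges of [C_5] with the differences 2 and 3. *)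
Definition gC (u v : G) := if adj u v then S5 true true false false true else emp5.

Lemma gC_sym : sym_inst gC.
Proof.
split=> [u v|v]; rewrite /gC; last by rewrite adj_irrefl.
by rewrite adj_sym; case: ifP.
Qed.

(** Multiplication by 2; [of_z5] is the inverse, multiplication by 3. *)
Definition z5_of (i : 'I_5) := nth z0 [:: z0; z2; z4; z1; z3] i.
Definition of_z5 (a : z5) : 'I_5 :=
  match a with z0 => inord 0 | z1 => inord 3 | z2 => inord 1 | z3 => inord 4 | z4 => inord 2 end.

Lemma z5_ofP (i j : 'I_5) : cycle_adj i j ->
  ~~ mem5 (S5 true true false false true) (sub5 (z5_of i) (z5_of j)).
Proof.
by rewrite /cycle_adj; case: i => [[|[|[|[|[|i]]]]] Hi] //; case: j => [[|[|[|[|[|j]]]]] Hj].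
Qed.

Lemma of_z5P a b : ~~ mem5 (S5 true true false false true) (sub5 a b) -> cycle_adj (of_z5 a) (of_z5 b).
Proof.
by case: a; case: b => // _; rewrite /cycle_adj -!val_eqE /= !inordK.
Qed.

Lemma gC_crit : critical52 G -> crit gC setT.
Proof.
move=> [nh ph]; split.
  move=> [x xG]; apply: nh; exists (fun u => of_z5 (x u)) => u v uv; apply: of_z5P.
  by have := xG u v (in_setT _) (in_setT _); rewrite /gC uv.
move=> S ST.
pose a u v := [&& adj u v, u \in S & v \in S] : bool.
have aS : symmetric a by move=> u v; rewrite /a adj_sym [(u \in S) && _]andbC.
have aA u v : a u v -> adj u v by case/and3P.
have aV u v : a u v -> (u \in S) && (v \in S) by case/and3P => _ -> ->.
pose H := @Subgraph G S a aS aA aV.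
have [|f fH] := ph H.
  by move=> [/= HS _]; move: ST; rewrite HS properxx.
exists (fun u => if insub u is Some u' then z5_of (f u') else z0) => u v uS vS.
rewrite (insubT (fun x => x \in S) uS) (insubT (fun x => x \in S) vS) /gC.
case: (boolP (adj u v)) => uv; last by case: (sub5 _ _).
by apply: z5_ofP; apply: fH; rewrite /= /graph_of_sub_adj /= /a uv uS vS.
Qed.

Lemma gC_cost S : eC gC S = 4 * aC gC S /\ rC gC S = aC gC S.
Proof.
rewrite /eC /rC /aC /ew; split; last first.
  by apply: eq_bigr => u _; apply: eq_bigr => v _; rewrite /wruns /wadj /gC; case: ifP.
rewrite big_distrr /=; apply: eq_bigr => u _; rewrite big_distrr /=; apply: eq_bigr => v _.
by rewrite /wcost /wadj /gC; case: ifP.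
Qed.

Lemma gC_adj u v : wadj gC u v = adj u v.
Proof. by rewrite /wadj /gC; case: ifP. Qed.

Lemma gC_edges : aC gC setT = #|edges G|.
Proof.
pose O := [set p : G * G | adj p.1 p.2 && (enum_rank p.1 < enum_rank p.2)].
have -> : edges G = [set [set p.1; p.2] | p in O].
  apply/setP => A; rewrite inE; apply/existsP/imsetP => [[u /existsP [v /andP [uv /eqP ->]]]|[[u v]]].
    case: (ltngtP (enum_rank u) (enum_rank v)) => h.
    - by exists (u, v); rewrite ?inE //= uv h.
    - by exists (v, u); rewrite ?inE /= 1?setUC // adj_sym uv h.
    - by move/ord_inj/enum_rank_inj: h uv => ->; rewrite adj_irrefl.
  by rewrite inE /= => /andP [uv _] ->; exists u; apply/existsP; exists v; rewrite uv eqxx.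
rewrite card_in_imset; last first.
  move=> [u v] [u' v']; rewrite !inE /= => /andP [uv ruv] /andP [uv' ruv'] E.
  have hu : u \in [set u'; v'] by rewrite -E !inE eqxx.
  have hv : v \in [set u'; v'] by rewrite -E !inE eqxx orbT.
  move: hu hv uv ruv; rewrite !inE => /orP [] /eqP -> /orP [] /eqP -> //; rewrite ?adj_irrefl //.
  by rewrite ltnNge (ltnW ruv').
rewrite /aC /ew pair_big_dep /= -sum1dep_card big_mkcond [RHS]big_mkcond /=.
apply: eq_bigr => [[u v]] _ /=.
by rewrite !in_setT gC_adj /=; case: (adj u v); case: (_ < _).
Qed.

Lemma triangle_iso : #|[set: G]| = 3 -> aC gC setT = 3 -> isomorphic G (cycle_graph 3).
Proof.
move=> n3 a3.
have adjE (u v : G) : adj u v = (u != v).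
  case: (eqVneq u v) => [->|uv]; first by rewrite adj_irrefl.
  have : 0 < #|[set: G] :\ u :\ v|.
    move: (cardsD1 u [set: G]) (cardsD1 v ([set: G] :\ u)).
    rewrite !inE eq_sym uv n3 /=; alia.
  case/card_gt0P => t; rewrite !inE andbT => /andP [tv tu].
  have ut : u != t by rewrite eq_sym. have vt : v != t by rewrite eq_sym.
  have ET : [set u; v; t] = setT.
    by apply/eqP; rewrite eqEcard subsetT n3 card3.
  move: a3; rewrite -ET /aC ew3 //; last exact: wadjC gC_sym.
  by rewrite !gC_adj; case: (adj u v) => //; case: (adj u t); case: (adj v t).
have n3' : #|G| = 3 by rewrite -cardsT.
exists (fun u : G => cast_ord n3' (enum_rank u)).
  exists (fun i => enum_val (cast_ord (esym n3') i)) => [u|i].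
    by rewrite cast_ordK enum_rankK.
  by rewrite enum_valK cast_ordKV.
move=> u v; rewrite adjE /= /cycle_adj.
have -> : (u != v) = (cast_ord n3' (enum_rank u) != cast_ord n3' (enum_rank v)).
  by rewrite (inj_eq (@cast_ord_inj _ _ n3')) (inj_eq enum_rank_inj).
move: (cast_ord _ _) (cast_ord _ _).
by case=> [[|[|[|i]]] Hi] //; case=> [[|[|[|j]]] Hj].
Qed.

End Graph.

Import GRing.Theory Num.Theory.
Local Open Scope ring_scope.

Theorem theorem1 (G : sgraph) :
  critical52 G -> ~ isomorphic G (cycle_graph 3) -> potential G <= 2.
Proof.
move=> cG nI; rewrite /potential -gC_edges -cardsT.
have := crit_good (leqnn _) (gC_sym G) (gC_crit cG); rewrite /good.
have [-> ->] := gC_cost [set: G].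
(* With [n] vertices and [a] edges the second alternative reads [5 n <= 4 a + 3] and [a <= n], so
   [n <= 3]; a potential above 2 is then possible only for [n = a = 3]. *)
have [//|n3] := classic (#|[set: G]| = 3%N /\ aC (gC (G:=G)) setT = 3%N).
  by move=> [n3 a3]; case: nI; apply: triangle_iso.
move: n3; lia.
Qed.
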